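(* Let $m\ge3$, let $\mathfrak g$ be the simple Lie algebra of type $D_m$, and let $w=s_1\cdots s_{m-2}s_{m-1}s_ms_{m-2}\cdots s_1$. There is a surjective group homomorphism $C_{\mathfrak g}\to Tog(w)$ from the cactus group to the toggle group such that for every $n\ge1$ the action of $C_{\mathfrak g}$ on the crystal $B(n\varpi_1)\cong RPP(w,n)$ factors through this homomorphism, i.e. is its composition with the action of $Tog(w)$ on $RPP(w,n)$.
   Context: Setting. $I=\{1,\dots,m\}$ is the Dynkin diagram of type $D_m$ with spin nodes $m-1,m$ (both adjacent to $m-2$; $i$ is adjacent to $i+1$ for $i\le m-2$), $\alpha_i=\epsilon_i-\epsilon_{i+1}$ for $i\le m-1$, $\alpha_m=\epsilon_{m-1}+\epsilon_m$, $W=\langle s_i\rangle$ is the Weyl group. The crystal $B(n\varpi_1)$ is the set of rows $b_1b_2\cdots b_n$ of length $n$, weakly increasing in the poset $1<2<\dots<m-1<m,\overline m<\overline{m-1}<\dots<\overline 1$ in which $m$ and $\overline m$ are incomparable (so $m,\overline m$ never both appear). The weight is the sum of the weights of the entries, $\mathrm{wt}(i)=\epsilon_i$, $\mathrm{wt}(\overline i)=-\epsilon_i$. On single letters: $f_i(i)=i+1$, $f_i(\overline{i+1})=\overline i$ for $1\le i\le m-1$; $f_m(m-1)=\overline m$, $f_m(m)=\overline{m-1}$; all other $f_i$ of letters are $0$; $e_i(x)=y$ iff $f_i(y)=x$. On a row, for fixed $i$, write from left to right a $+$ for each letter $x$ with $f_i(x)\ne0$ and a $-$ for each letter with $e_i(x)\neq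 0$, successively cancel pairs $-+$, leaving $+\cdots+-\cdots-$; $f_i$ applies $f_i$ to the letter of the rightmost uncancelled $+$ (result $0$ if none) and $e_i$ applies $e_i$ to the letter of the leftmost uncancelled $-$ (result $0$ if none). Cactus group. For connected $J\subseteq I$ let $w_{0,J}$ be the longest element of $W_J=\langle s_j: j\in J\rangle$ and $\theta_J:J\to J$ be given by $\alpha_{\theta_J(j)}=-w_{0,J}\alpha_j$. $C_{\mathfrak g}$ is the group with generators $c_J$ for each nonempty connected subdiagram $J\subseteq I$ and relations $c_J^2=1$; $c_Jc_K=c_Kc_J$ if $J\cup K$ is disconnected (i.e. $J,K$ are disjoint with no edge between them); $c_Jc_K=c_Kc_{\theta_K(J)}$ if $J\subseteq K$. It acts on $B(n\varpi_1)$ as follows: $c_J$ acts as the unique map preserving each connected component of the crystal restricted to $J$ (keep only edges labelled by $J$) and satisfying $\mathrm{wt}(c_J b)=w_{0,J}\mathrm{wt}(b)$, $e_j c_J(b)=c_J(f_{\theta_J(j)}b)$, $f_jc_J(b)=c_J(e_{\theta_J(j)}b)$ for $j\in J$ (with $c_J(0)=0$). Heap and reverse plane partitions. The heap $H(w)$ is the poset with elements $x_1,\dots,x_m,y_{m-2},\dots,y_1$ and order generated by $x_1\prec\dots\prec x_{m-2}$, $x_{m-2}\prec x_{m-1}\prec y_{m-2}$, $x_{m-2}\prec x_m\prec y_{m-2}$, $y_{m-2}\prec y_{m-3}\prec\dots\prec y_1$; $x_i$ and $y_i$ are said to lie over $i\in I$. $RPP(w,n)$ is the set of functions $\Phi:H(w)\to\{0,\dots,n\}$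 with $\Phi(x)\ge\Phi(y)$ whenever $x\preceq y$. Such $\Phi$ is identified with the chain of order ideals (down-closed subsets) $\phi_1\subseteq\dots\subseteq\phi_n$, $\phi_i=\Phi^{-1}(\{n-i+1,\dots,n\})$; $\Phi$ is the sum of the indicator functions of the $\phi_i$. The identification $B(n\varpi_1)\cong RPP(w,n)$ sends a row $b_1\cdots b_n$ to the chain of ideals of its letters, where letter $p\le m-1$ corresponds to $\{x_1,\dots,x_{p-1}\}$, $m$ to $\{x_1,\dots,x_{m-1}\}$, $\overline m$ to $\{x_1,\dots,x_{m-2},x_m\}$, $\overline{m-1}$ to $\{x_1,\dots,x_m\}$, and $\overline p$ with $p\le m-2$ to $\{x_1,\dots,x_m,y_{m-2},\dots,y_p\}$. Toggles. For $x\in H(w)$ and an order ideal $S$, $t_x(S)$ is $S\cup\{x\}$ if $x\notin S$ and this is an order ideal, $S\setminus\{x\}$ if $x\in S$ and this is an order ideal, and $S$ otherwise. For $i\in I$, $t_i$ is the (commuting) product of the $t_x$ over the $x$ lying over $i$. It acts on $RPP(w,n)$ by sending $(\phi_1,\dots,\phi_n)$ to the sum of the indicator functions of $t_i(\phi_1),\dots,t_i(\phi_n)$. The toggle group $Tog(w)$ is the group generated by the $t_i$, $i\in I$, regarded as the subgroup of $\prod_{n\ge1}\mathrm{Sym}(RPP(w,n))$ generated by these actions. *)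

(* Defs.v *)
From HB Require Import structures.
From mathcomp Require Import all_boot all_order all_algebra all_fingroup.
From mathcomp Require Import generic_quotient boolp.
From mathcomp Require classical_sets.
From mathcomp Require Import zify.

Set Implicit Arguments.
Unset Strict Implicit.
Unset Printing Implicit Defensive.

Import GroupScope.

(* A word in the letters g (encoded as (g, false)) and g^-1 (as (g, true)). *)
Definition word (X : Type) := seq (X * bool).

Definition word_inv X (u : word X) : word X :=
  rev [seq (a.1, ~~ a.2) | a <- u].

Inductive pres_eq (X : Type) (R : word X -> word X -> Prop) :
    word X -> word X -> Prop :=
| pres_rel u v : R u v -> pres_eq R u v
| pres_cancel x s : pres_eq R [:: (x, s); (x, ~~ s)] [::]
| pres_ctx p q u v : pres_eq R u v -> pres_eq R (p ++ u ++ q) (p ++ v ++ q)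
| pres_refl u : pres_eq R u u
| pres_sym u v : pres_eq R u v -> pres_eq R v u
| pres_trans v u w : pres_eq R u v -> pres_eq R v w -> pres_eq R u w.

Section Presentation.
Variables (X : choiceType) (R : word X -> word X -> Prop).

Definition pres_rel_bool : rel (word X) := fun u v => `[< pres_eq R u v >].

Lemma pres_rel_refl : reflexive pres_rel_bool.
Proof. by move=> u; apply/asboolP/pres_refl. Qed.

Lemma pres_rel_sym : symmetric pres_rel_bool.
Proof. by move=> u v; apply/asboolP/asboolP; apply: pres_sym. Qed.

Lemma pres_rel_trans : transitive pres_rel_bool.
Proof.
move=> v u w /asboolP uv /asboolP vw; apply/asboolP; exact: pres_trans uv vw.
Qed.

Canonical pres_equiv :=
  EquivRel pres_rel_bool pres_rel_refl pres_rel_sym pres_rel_trans.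

Definition presented := {eq_quot pres_equiv}%qT.
HB.instance Definition _ := Choice.on presented.

Definition pres_class (u : word X) : presented := (\pi_presented u)%qT.

Lemma pres_classP u v : pres_class u = pres_class v <-> pres_eq R u v.
Proof.
by split=> [/eqmodP/asboolP | uv] //; apply/eqmodP/asboolP.
Qed.

Lemma pres_classK (a : presented) : pres_class (repr a) = a.
Proof. exact: reprK. Qed.

Lemma pres_repr u : pres_eq R (repr (pres_class u)) u.
Proof. by apply/pres_classP; rewrite pres_classK. Qed.

Definition pres_one := pres_class [::].
Definition pres_mul (a b : presented) := pres_class (repr a ++ repr b).
Definition pres_inv (a : presented) := pres_class (word_inv (repr a)).

Lemma pres_eq_cat u u' v v' :
  pres_eq R u u' -> pres_eq R v v' -> pres_eq R (u ++ v) (u' ++ v').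
Proof.
move=> uu' vv'; apply: (@pres_trans _ _ (u' ++ v)).
  exact: (@pres_ctx _ _ [::] v).
by have := @pres_ctx _ _ u' [::] _ _ vv'; rewrite !cats0.
Qed.

Lemma pres_mulE u v :
  pres_mul (pres_class u) (pres_class v) = pres_class (u ++ v).
Proof. by apply/pres_classP/pres_eq_cat; apply: pres_repr. Qed.

Lemma word_invK : involutive (@word_inv X).
Proof.
move=> u; rewrite /word_inv map_rev revK -map_comp map_id_in // => -[x s] _ /=.
by rewrite negbK.
Qed.

Lemma pres_cat_inv u : pres_eq R (u ++ word_inv u) [::].
Proof.
elim: u => [|[x s] u IH]; first exact: pres_refl.
rewrite /word_inv /= rev_cons -cats1 catA.
apply: pres_trans (@pres_ctx _ _ [:: (x, s)] [:: (x, ~~ s)] _ _ IH) _.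
exact: pres_cancel.
Qed.

Fact pres_mulA : associative pres_mul.
Proof.
move=> a b c; rewrite -(pres_classK a) -(pres_classK b) -(pres_classK c).
by rewrite !pres_mulE catA.
Qed.

Fact pres_mul1 : left_id pres_one pres_mul.
Proof. by move=> a; rewrite -(pres_classK a) pres_mulE. Qed.

Fact pres_mulr1 : right_id pres_one pres_mul.
Proof. by move=> a; rewrite -(pres_classK a) pres_mulE cats0. Qed.

Fact pres_mulrV : right_inverse pres_one pres_inv pres_mul.
Proof.
move=> a; rewrite -{1}(pres_classK a) pres_mulE.
by apply/pres_classP/pres_cat_inv.
Qed.

Fact pres_mulV : left_inverse pres_one pres_inv pres_mul.
Proof.
move=> a; rewrite -{2}(pres_classK a) pres_mulE; apply/pres_classP.
by have := pres_cat_inv (word_inv (repr a)); rewrite word_invK.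
Qed.

HB.instance Definition _ := isGroup.Build presented
  pres_mulA pres_mul1 pres_mulr1 pres_mulV pres_mulrV.

End Presentation.

(* Permutations acting on the left: (s * t) x = s (t x), whereas the group
   structure carried by {perm T} itself satisfies (s * t) x = t (s x). *)
Definition lsym (T : finType) := {perm T}.

Section LeftSym.
Variable T : finType.

HB.instance Definition _ := Choice.on (lsym T).

Definition lsym_one : lsym T := (1 : {perm T}).
Definition lsym_inv (s : lsym T) : lsym T := (s : {perm T})^-1.
Definition lsym_mul (s t : lsym T) : lsym T := (t : {perm T}) * (s : {perm T}).

Fact lsym_mulA : associative lsym_mul.
Proof. by move=> s t u; rewrite /lsym_mul mulgA. Qed.
Fact lsym_mul1 : left_id lsym_one lsym_mul.
Proof. by move=> s; rewrite /lsym_mul mulg1. Qed.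
Fact lsym_mulr1 : right_id lsym_one lsym_mul.
Proof. by move=> s; rewrite /lsym_mul mul1g. Qed.
Fact lsym_mulV : left_inverse lsym_one lsym_inv lsym_mul.
Proof. by move=> s; rewrite /lsym_mul mulgV. Qed.
Fact lsym_mulrV : right_inverse lsym_one lsym_inv lsym_mul.
Proof. by move=> s; rewrite /lsym_mul mulVg. Qed.

HB.instance Definition _ := isGroup.Build (lsym T)
  lsym_mulA lsym_mul1 lsym_mulr1 lsym_mulV lsym_mulrV.

Lemma lsymM (s t : lsym T) x : (s * t) x = s (t x).
Proof. exact: permM. Qed.

End LeftSym.

Definition prodg (I : Type) (G : I -> groupType) := forall i : I, G i.

Section ProductGroup.
Variables (I : Type) (G : I -> groupType).

HB.instance Definition _ := gen_eqMixin (prodg G).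
HB.instance Definition _ := gen_choiceMixin (prodg G).

Definition prodg_one : prodg G := fun i => 1.
Definition prodg_inv (a : prodg G) : prodg G := fun i => (a i)^-1.
Definition prodg_mul (a b : prodg G) : prodg G := fun i => a i * b i.

Fact prodg_mulA : associative prodg_mul.
Proof. by move=> a b c; apply: functional_extensionality_dep => i; apply: mulgA. Qed.
Fact prodg_mul1 : left_id prodg_one prodg_mul.
Proof. by move=> a; apply: functional_extensionality_dep => i; apply: mul1g. Qed.
Fact prodg_mulr1 : right_id prodg_one prodg_mul.
Proof. by move=> a; apply: functional_extensionality_dep => i; apply: mulg1. Qed.
Fact prodg_mulV : left_inverse prodg_one prodg_inv prodg_mul.
Proof. by move=> a; apply: functional_extensionality_dep => i; apply: mulVg. Qed.
Fact prodg_mulrV : right_inverse prodg_one prodg_inv prodg_mul.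
Proof. by move=> a; apply: functional_extensionality_dep => i; apply: mulgV. Qed.

HB.instance Definition _ := isGroup.Build (prodg G)
  prodg_mulA prodg_mul1 prodg_mulr1 prodg_mulV prodg_mulrV.

End ProductGroup.

Definition generated (G : groupType) (S : G -> Prop) : {pred G} :=
  fun g => `[< forall H : {pred G}, group_closed H ->
                 (forall s, S s -> s \in H) -> g \in H >].

Lemma generated_group (G : groupType) (S : G -> Prop) :
  group_closed (generated S).
Proof.
split=> [|a b /asboolP Ha /asboolP Hb]; apply/asboolP=> H gH SH.
  by case: gH.
by apply: (proj2 gH); [apply: Ha | apply: Hb].
Qed.

Definition gensub (G : groupType) (S : G -> Prop) :=
  {g : G | g \in generated S}.

Section GeneratedSubgroup.
Variables (G : groupType) (S : G -> Prop).
HB.instance Definition _ := SubChoice.on (gensub S).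
HB.instance Definition _ :=
  SubChoice_isSubGroup.Build G (generated S) (gensub S) (generated_group S).
End GeneratedSubgroup.

(* Nodes are elements of 'I_m; lab i is the label in 1..m used in the usual
   numbering, in which the spin nodes are m-1 and m. *)
Definition lab m (i : 'I_m) : nat := i.+1.

Definition dadj m (i j : 'I_m) : bool :=
  let edge a b := ((b == a.+1) && (a <= m - 2)) || ((a == m - 2) && (b == m)) in
  edge (lab i) (lab j) || edge (lab j) (lab i).

Definition dconnected m (J : {set 'I_m}) : bool :=
  (J != set0) &&
  [forall i in J, forall j in J,
     connect (fun a b => [&& a \in J, b \in J & dadj a b]) i j].

Section Roots.
Import GRing.Theory.
Local Open Scope ring_scope.
Variable m : nat.

Definition eps (k : nat) : 'rV[int]_m := \row_(j < m) (lab j == k)%:R.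

Definition alpha (i : 'I_m) : 'rV[int]_m :=
  if (lab i < m)%N then eps (lab i) - eps (lab i).+1 else eps m.-1 + eps m.

(* The diagram is simply laced, (alpha_i, alpha_i) = 2, so each simple root is
   identified with its coroot. *)
Definition srefl (i : 'I_m) (v : 'rV[int]_m) : 'rV[int]_m :=
  v - (\sum_(k < m) v 0 k * alpha i 0 k) *: alpha i.

(* The Weyl group element s_{i_1} ... s_{i_k} as a map on weights. *)
Definition wact (s : seq 'I_m) (v : 'rV[int]_m) : 'rV[int]_m :=
  foldr srefl v s.

Definition reduced (s : seq 'I_m) : Prop :=
  forall t, wact t =1 wact s -> (size s <= size t)%N.

(* s is a reduced word for an element of W_J of maximal length in W_J. *)
Definition longest_word (J : {set 'I_m}) (s : seq 'I_m) : Prop :=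
  [/\ {subset s <= J}, reduced s &
      forall t, {subset t <= J} -> reduced t -> (size t <= size s)%N].

Definition w0 (J : {set 'I_m}) : 'rV[int]_m -> 'rV[int]_m :=
  wact (classical_sets.xget [::] (longest_word J)).

Definition theta (J : {set 'I_m}) (j : 'I_m) : 'I_m :=
  odflt j [pick k in J | alpha k == - w0 J (alpha j)].

End Roots.

Definition cnode m := {J : {set 'I_m} | dconnected J}.
HB.instance Definition _ m := SubFinite.on (cnode m).

Definition cgen m (J : cnode m) : word (cnode m) := [:: (J, false)].

Inductive cactus_rel (m : nat) : word (cnode m) -> word (cnode m) -> Prop :=
| cactus_sq (J : cnode m) : cactus_rel (cgen J ++ cgen J) [::]
| cactus_comm (J K : cnode m) :
    [disjoint val J & val K] ->
    (forall j k, j \in val J -> k \in val K -> ~~ dadj j k) ->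
    cactus_rel (cgen J ++ cgen K) (cgen K ++ cgen J)
| cactus_nest (J K L : cnode m) :
    val J \subset val K -> val L = theta (val K) @: val J ->
    cactus_rel (cgen J ++ cgen K) (cgen K ++ cgen L).

Definition cactus m := presented (@cactus_rel m).
HB.instance Definition _ m := Group.on (cactus m).

Definition cact m (J : cnode m) : cactus m :=
  pres_class (@cactus_rel m) (cgen J).

(* (p, false) is the letter lab p and (p, true) is the letter lab p barred. *)
Definition letter m := ('I_m * bool)%type.

Definition letter_le m (x y : letter m) : bool :=
  match x, y with
  | (p, false), (q, false) => p <= q
  | (p, true), (q, true) => q <= p
  | (p, false), (q, true) => ~~ ((lab p == m) && (lab q == m))
  | (p, true), (q, false) => false
  end.

(* letter_arrow i x y means f_i(x) = y. *)
Definition letter_arrow m (i : 'I_m) (x y : letter m) : bool :=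
  let: (p, s) := x in let: (q, t) := y in
  if lab i < m then
    [&& ~~ s, ~~ t, lab p == lab i & lab q == (lab i).+1]
    || [&& s, t, lab p == (lab i).+1 & lab q == lab i]
  else
    [&& ~~ s, t, lab p == m.-1 & lab q == m]
    || [&& ~~ s, t, lab p == m & lab q == m.-1].

Definition fletter m (i : 'I_m) (x : letter m) : option (letter m) :=
  [pick y | letter_arrow i x y].
Definition eletter m (i : 'I_m) (y : letter m) : option (letter m) :=
  [pick x | letter_arrow i x y].

Definition row m n := {b : n.-tuple (letter m) | sorted (@letter_le m) b}.
HB.instance Definition _ m n := SubFinite.on (row m n).

Section Crystal.
Variables m n : nat.
Implicit Types (i : 'I_m) (b : row m n) (J : {set 'I_m}).

(* Reading step of the signature rule. The stack holds the positions of the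
   signs not cancelled so far, last one first, with true for + and false for -;
   a new + cancels against a - on top of the stack. *)
Definition sig_step i b (st : seq ('I_n * bool)) (k : 'I_n) :=
  let x := tnth (val b) k in
  if fletter i x is Some _ then
    if st is (_, false) :: st' then st' else (k, true) :: st
  else if eletter i x is Some _ then (k, false) :: st
  else st.

(* The uncancelled signs +...+-...-, from left to right. *)
Definition signature i b : seq ('I_n * bool) :=
  rev (foldl (sig_step i b) [::] (enum 'I_n)).

Definition rightmost_plus i b : option 'I_n :=
  ohead (rev [seq k.1 | k <- signature i b & k.2]).
Definition leftmost_minus i b : option 'I_n :=
  ohead [seq k.1 | k <- signature i b & ~~ k.2].

(* None plays the role of 0. For g = fletter i or eletter i and k as in frow and
   erow below, the modified tuple is again weakly increasing. *)
Definition change_letter (g : letter m -> option (letter m)) b (k : 'I_n) :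
    option (row m n) :=
  obind (fun y => insub [tuple (if l == k then y else tnth (val b) l) | l < n])
        (g (tnth (val b) k)).

Definition frow i b : option (row m n) :=
  obind (change_letter (fletter i) b) (rightmost_plus i b).
Definition erow i b : option (row m n) :=
  obind (change_letter (eletter i) b) (leftmost_minus i b).

Definition letter_wt (x : letter m) : 'rV[int]_m :=
  (if x.2 then - eps m (lab x.1) else eps m (lab x.1))%R.
Definition wt b : 'rV[int]_m := (\sum_(x <- val b) letter_wt x)%R.

Definition crystal_edge J : rel (row m n) := fun b b' =>
  [exists j in J, (frow j b == Some b') || (frow j b' == Some b)].

Definition same_component J : rel (row m n) := connect (crystal_edge J).

Definition cactus_map J (c : row m n -> row m n) : Prop :=
  [/\ forall b, same_component J b (c b),
      forall b, wt (c b) = w0 J (wt b) &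
      forall j b, j \in J ->
        erow j (c b) = omap c (frow (theta J j) b) /\
        frow j (c b) = omap c (erow (theta J j) b)].

Definition cactus_action (act : cactus m -> row m n -> row m n) : Prop :=
  [/\ forall b, act 1 b = b,
      forall g h b, act (g * h) b = act g (act h b) &
      forall J : cnode m,
        cactus_map (val J) (act (cact J)) /\
        forall c, cactus_map (val J) c -> c =1 act (cact J)].

End Crystal.

(* The heap of w = s_1 ... s_{m-2} s_{m-1} s_m s_{m-2} ... s_1. In terms of
   labels, inl i is x_i for i in 1..m and inr i is y_i for i in 1..m-2. *)
Definition heap m := ('I_m + 'I_(m - 2))%type.

Definition hcover m (h k : heap m) : bool :=
  match h, k with
  | inl i, inl j => ((lab j == (lab i).+1) && (lab j <= m - 2))
                    || ((lab i == m - 2) && (m.-1 <= lab j))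
  | inl i, inr j => (m.-1 <= lab i) && (lab j == m - 2)
  | inr i, inr j => lab i == (lab j).+1
  | inr _, inl _ => false
  end.

Definition hle m : rel (heap m) := connect (@hcover m).

Definition over m (h : heap m) : 'I_m :=
  match h with
  | inl i => i
  | inr i => widen_ord (leq_subr 2 m) i
  end.

Definition is_ideal m (S : {set heap m}) : bool :=
  [forall h, forall k, hle h k && (k \in S) ==> (h \in S)].

Definition ideal m := {S : {set heap m} | is_ideal S}.
HB.instance Definition _ m := SubFinite.on (ideal m).

Definition is_rpp m n (Phi : {ffun heap m -> 'I_n.+1}) : bool :=
  [forall h, forall k, hle h k ==> (Phi k <= Phi h)].

Definition rpp m n := {Phi : {ffun heap m -> 'I_n.+1} | is_rpp Phi}.
HB.instance Definition _ m n := SubFinite.on (rpp m n).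

Lemma is_idealP m (S : {set heap m}) :
  reflect (forall h k, hcover h k -> k \in S -> h \in S) (is_ideal S).
Proof.
apply: (iffP forallP) => [S_id h k hk Sk | S_id h].
  by move/forallP: (S_id h) => /(_ k); rewrite /hle connect1 //= Sk.
apply/forallP=> k; apply/implyP=> /andP[/connectP[p]].
elim: p h => [|l p IH] h /=; first by move=> _ ->.
by move=> /andP[hl lp] kE Sk; apply: (S_id _ l) => //; apply: IH.
Qed.

Section SumOfIdeals.
Variables (m n : nat) (S : 'I_n -> ideal m).

Lemma sum_ideals_bound (h : heap m) : \sum_(k < n) (h \in val (S k)) < n.+1.
Proof.
rewrite ltnS -[leqRHS]card_ord -sum1_card.
by apply: leq_sum => k _; case: (_ \in _).
Qed.

Definition sum_ideals_fun : {ffun heap m -> 'I_n.+1} :=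
  [ffun h => Ordinal (sum_ideals_bound h)].

Lemma sum_ideals_subproof : is_rpp sum_ideals_fun.
Proof.
apply/forallP=> h; apply/forallP=> k; apply/implyP=> hk; rewrite !ffunE /=.
apply: leq_sum => l _; case Sk: (k \in _) => //.
by move/forallP: (valP (S l)) => /(_ h) /forallP/(_ k); rewrite hk Sk /= => ->.
Qed.

Definition sum_ideals : rpp m n := Sub sum_ideals_fun sum_ideals_subproof.

Lemma sum_idealsE h : val sum_ideals h = \sum_(k < n) (h \in val (S k)) :> nat.
Proof. by rewrite /= ffunE. Qed.

End SumOfIdeals.

(* The chain of ideals of Phi: as k : 'I_n counts from 0, layer Phi k is
   phi_{k+1}, the preimage of {n-k, ..., n}. *)
Section Layers.
Variables (m n : nat) (Phi : rpp m n) (k : 'I_n).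

Definition layer_set : {set heap m} := [set h | n - k <= val Phi h].

Lemma layer_subproof : is_ideal layer_set.
Proof.
apply/forallP=> h; apply/forallP=> l; apply/implyP; rewrite !inE => /andP[hl].
move=> /leq_trans; apply.
by move/forallP: (valP Phi) => /(_ h) /forallP/(_ l); rewrite hl.
Qed.

Definition layer : ideal m := Sub layer_set layer_subproof.

End Layers.

(* In terms of labels: an unbarred p gives {x_i | i < p}, the barred m all x_i
   with i != m-1, and any other barred p all x_i and the y_i with p <= i. As y_i
   exists only for i <= m-2, there is no y_i in the ideals of the barred m and
   m-1. *)
Section LetterIdeal.
Variables (m : nat) (a : letter m).

Definition letter_ideal_set : {set heap m} :=
  let: (p, barred) := a in
  [set h : heap m | match h with
    | inl i => if barred then (lab p == m) ==> (lab i != m.-1)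
               else lab i < lab p
    | inr i => barred && (lab p <= lab i)
    end].

Lemma letter_ideal_subproof : is_ideal letter_ideal_set.
Proof.
apply/is_idealP; rewrite /letter_ideal_set; case: a => p [] [i|i] [j|j] //=;
  have := ltn_ord p; have := ltn_ord i; have := ltn_ord j;
  rewrite !inE /= /lab; lia.
Qed.

Definition letter_ideal : ideal m := Sub letter_ideal_set letter_ideal_subproof.

End LetterIdeal.

Definition row_rpp m n (b : row m n) : rpp m n :=
  sum_ideals (fun k => letter_ideal (tnth (val b) k)).

Definition toggle1 m (h : heap m) (S : ideal m) : ideal m :=
  insubd S (if h \in val S then val S :\ h else h |: val S).

(* The order of composition is irrelevant: elements over the same node are not
   in a cover relation, so their toggles commute. *)
Definition toggle m (i : 'I_m) (S : ideal m) : ideal m :=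
  foldr (@toggle1 m) S (enum [pred h | over h == i]).

Definition rpp_toggle m n (i : 'I_m) (Phi : rpp m n) : rpp m n :=
  sum_ideals (fun k => toggle i (layer Phi k)).

Section ToggleInvolution.
Variable m : nat.
Implicit Types (h k : heap m) (S : ideal m) (i : 'I_m).

Definition lower_in h S := [forall k, hcover k h ==> (k \in val S)].
Definition upper_out h S := [forall k, hcover h k ==> (k \notin val S)].

Lemma ideal_down h k S : hcover h k -> k \in val S -> h \in val S.
Proof. by move/is_idealP: (valP S); apply. Qed.

Lemma hcover_over h k : hcover h k -> over h != over k.
Proof.
rewrite -val_eqE; case: h k => i [] j //=; have := ltn_ord i; have := ltn_ord j;
  rewrite /lab /=; lia.
Qed.

Lemma hcover_irr h : hcover h h = false.
Proof. by apply/negP=> /hcover_over; rewrite eqxx. Qed.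

Lemma toggle1E h k S :
  (k \in val (toggle1 h S)) =
  if k == h then (if lower_in h S && upper_out h S then h \notin val S
                  else h \in val S)
  else k \in val S.
Proof.
rewrite /toggle1; case hS: (h \in val S); rewrite /= val_insubd.
- have -> : lower_in h S.
    by apply/forallP=> l; apply/implyP=> lh; apply: ideal_down lh hS.
  suff -> : is_ideal (val S :\ h) = upper_out h S.
    by case: ifP; rewrite ?in_setD1; case: eqP => [->|].
  apply/is_idealP/forallP => [H l | H l l' ll'].
    apply/implyP=> hl; apply/negP=> lS; have := H _ _ hl.
    rewrite !in_setD1 lS eqxx /= andbT => /implyP; rewrite implybF negbK => /eqP E.
    by move: hl; rewrite E hcover_irr.
  rewrite !in_setD1 => /andP[_ lS]; rewrite (ideal_down ll' lS) andbT.
  by apply/eqP=> lh; move: (H l'); rewrite -lh ll' lS.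
- have uh : upper_out h S.
    apply/forallP=> l; apply/implyP=> hl; apply/negP=> lS.
    by rewrite (ideal_down hl lS) in hS.
  rewrite uh andbT.
  suff -> : is_ideal (h |: val S) = lower_in h S.
    by case: ifP; rewrite ?in_setU1; case: eqP => [->|].
  apply/is_idealP/forallP => [H l | H l l' ll'].
    apply/implyP=> lh; have := H _ _ lh; rewrite !in_setU1 eqxx => /(_ isT).
    by case/orP=> // /eqP E; rewrite E hcover_irr in lh.
  rewrite !in_setU1 => /orP[/eqP E|lS]; last by rewrite (ideal_down ll' lS) orbT.
  by move: (H l); rewrite -E ll' /= => ->; rewrite orbT.
Qed.

Lemma toggleE i k S :
  (k \in val (toggle i S)) =
  if over k == i then (if lower_in k S && upper_out k S then k \notin val S
                       else k \in val S)
  else k \in val S.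
Proof.
have -> : (over k == i) = (k \in enum [pred h | over h == i]) by rewrite mem_enum.
rewrite /toggle.
have: forall h, h \in enum [pred h | over h == i] -> over h = i.
  by move=> h; rewrite mem_enum => /eqP.
elim: (enum _) (enum_uniq [pred h | over h == i]) k => //= h s IH.
case/andP=> hs s_uniq k si; have {}IH l := IH s_uniq l (fun h' Hh' => si h' (@mem_behead _ (h :: s) _ Hh')).
rewrite toggle1E in_cons; case: eqP => [-> /=|_ /=]; last exact: IH.
have hi : over h = i by apply: si; rewrite mem_head.
have off l : hcover l h || hcover h l -> l \in s = false.
  move=> lh; apply/negP=> ls; have li : over l = i by apply: si; apply: (@mem_behead _ (h :: s)).
  by case/orP: lh => /hcover_over; rewrite hi li eqxx.
rewrite !IH (negbTE hs).
congr (if _ && _ then _ else _); apply: eq_forallb => l; rewrite IH.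
  by case lh: (hcover l h) => //=; rewrite off ?lh.
by case lh: (hcover h l) => //=; rewrite off ?lh ?orbT.
Qed.

Lemma sum_leq_sub n a : a <= n -> \sum_(k < n) (n - k <= a) = a.
Proof.
elim: n a => [|n IH] a; first by rewrite big_ord0; lia.
case: a => [|a] an; first by rewrite big1 // => k _; have := ltn_ord k; lia.
rewrite big_ord_recr /= subSnn /=.
have [an'|an'] := ltnP a n.+1; last by lia.
transitivity (\sum_(k < n) (n - k <= a) + 1); last by rewrite IH; lia.
by congr (_ + _); apply: eq_bigr => k _; have := ltn_ord k; lia.
Qed.

Lemma sum_layers n (Phi : rpp m n) h :
  \sum_(k < n) (h \in val (layer Phi k)) = val Phi h.
Proof.
rewrite -[RHS](@sum_leq_sub n) ?leq_ord //.
by apply: eq_bigr => k _; rewrite inE.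
Qed.

Lemma rpp_toggle_off n i (Phi : rpp m n) h :
  over h != i -> val (rpp_toggle i Phi) h = val Phi h.
Proof.
move=> hi; apply: val_inj; rewrite /= sum_idealsE -sum_layers.
by apply: eq_bigr => k _; rewrite toggleE (negbTE hi).
Qed.

Lemma rpp_toggle_on n i (Phi : rpp m n) h : over h = i ->
  val (rpp_toggle i Phi) h + val Phi h =
  \sum_(k < n) (lower_in h (layer Phi k) + ~~ upper_out h (layer Phi k)).
Proof.
move=> hi; rewrite sum_idealsE -sum_layers -big_split /=.
apply: eq_bigr => k _; rewrite toggleE hi eqxx.
case hS: (h \in _).
  have -> : lower_in h (layer Phi k).
    by apply/forallP=> l; apply/implyP=> lh; apply: ideal_down lh hS.
  by case: (upper_out _ _).
have -> : upper_out h (layer Phi k).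
  apply/forallP=> l; apply/implyP=> hl; apply/negP=> lS.
  by rewrite (ideal_down hl lS) in hS.
by rewrite andbT; case: (lower_in _ _).
Qed.

Lemma rpp_toggleK n i : involutive (@rpp_toggle m n i).
Proof.
move=> Phi; apply: val_inj; apply/ffunP=> h.
have [hi|hi] := eqVneq (over h) i; last by rewrite !rpp_toggle_off.
apply: val_inj; apply: (@addIn (val (rpp_toggle i Phi) h)).
rewrite (rpp_toggle_on _ hi) addnC (rpp_toggle_on _ hi).
apply: eq_bigr => k _; congr (nat_of_bool _ + ~~ _); apply: eq_forallb => l.
  case lh: (hcover l h) => //=; rewrite !inE rpp_toggle_off // -hi.
  exact: hcover_over.
case hl: (hcover h l) => //=; rewrite !inE rpp_toggle_off // -hi eq_sym.
exact: hcover_over.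
Qed.

End ToggleInvolution.

Definition rpp_toggle_perm m n (i : 'I_m) : lsym (rpp m n) :=
  perm (inv_inj (@rpp_toggleK m n i)).

(* The product of the groups Sym(RPP(w, n)) over n >= 1; the factor of index k
   is the one with n = k+1. *)
Definition rpp_syms m := prodg (fun k : nat => lsym (rpp m k.+1)).
HB.instance Definition _ m := Group.on (rpp_syms m).

Definition toggle_elt m (i : 'I_m) : rpp_syms m :=
  fun k => rpp_toggle_perm k.+1 i.

Definition toggle_group m :=
  gensub (fun t : rpp_syms m => exists i, t = toggle_elt i).
HB.instance Definition _ m := SubGroup.on (toggle_group m).

Definition toggle_action m n (t : toggle_group m) (Phi : rpp m n.+1) :
    rpp m n.+1 :=
  (val t : rpp_syms m) n Phi.

(* Main.v *)
(* Describe a row by its weight v in Z^m and by the multiplicities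
   mu_k = min(number of k, number of k barred). For k = m this is 0; otherwise
   (v, mu) is any pair with mu >= 0 and sum |v_k| + 2 sum mu_k = n, and it
   determines the row. In these coordinates everything becomes linear:
   - f_i subtracts alpha_i from v and changes only mu_{min(i,m-1)}, by the amount
     that preserves n, and is 0 when the result would be negative;
   - t_i acts on v by the reflection s_i, and on mu by the transposition (i i+1)
     if i <= m-2 and trivially if i is a spin node.
   Hence (w_{0,J}, pi_J), with pi_J the permutation of the indices of mu induced by
   theta_J, intertwines f_j and e_{theta_J(j)} for free, and it is the action of
   c_J because a component of the crystal restricted to J contains a single
   element killed by all f_j, j in J. The toggles generate W(D_m) x S_{m-1},
   whence the homomorphism; its surjectivity is t_i = c_{i+1} c_{i,i+1} c_{i+1}
   for i <= m-2, and t_i = c_i at the spin nodes. *)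

From HB Require Import structures.
From mathcomp Require Import all_boot all_order all_algebra all_fingroup.
From mathcomp Require Import boolp zify ring.
From mathcomp Require classical_sets.
Require Import Defs.

Set Implicit Arguments.
Unset Strict Implicit.
Unset Printing Implicit Defensive.

Import Order.TTheory GRing.Theory Num.Theory.

(** * Roots and longest elements *)

(** The definitions of [w0] and [theta] choose an arbitrary longest reduced word, so nothing can be
    computed from them directly. The way out is a criterion: a word of W_J sending each alpha_j, j
    in J, to -alpha_{f j} with f J inside J acts as w_{0,J}, and then f is theta_J. It follows from
    the action of W on heights of roots, through the exchange condition; explicit words in signed
    permutations then settle every connected J. The toggles t_i with i <= m-2 tie the reflection of
    the weight to a transposition of the multiplicities, and this coupling must be undone to reach
    the pairs (w_{0,J}, pi_J). It is undone by descending induction from the spin nodes, whose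
    toggles are pure reflections: a braid word in t_i, t_{i+1} and the pure s_{i+1} is s_i on
    weights and trivial on multiplicities. The two actions, the same in every length n, determine an
    element of Tog(w), so the cactus relations are checked on w_{0,J} and pi_J separately. The
    delicate case is that of two commuting subdiagrams, each with one spin node, for these share the
    index m-1 of the multiplicities. *)

Section Nodes.
Variable p : nat.
Local Notation m := p.+3.
Implicit Types i : 'I_m.

(* Here m = p + 3 and nodes are counted from 0, so that the spin nodes are p + 1
   and p + 2; alpha i is eps at lo i minus sg i times eps at hi i. *)
Lemma lo_subproof i : minn i p.+1 < m.
Proof. by have := ltn_ord i; lia. Qed.
Definition lo i : 'I_m := Ordinal (lo_subproof i).

Lemma hi_subproof i : (minn i p.+1).+1 < m.
Proof. by have := ltn_ord i; lia. Qed.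
Definition hi i : 'I_m := Ordinal (hi_subproof i).

Definition lastn i : bool := val i == p.+2.

Definition sg i : int := ((-1) ^+ lastn i)%R.

Lemma lo_neq_hi i : (lo i == hi i) = false.
Proof. by rewrite -val_eqE /=; lia. Qed.

End Nodes.

Section Roots.
Variable p : nat.
Local Notation m := p.+3.
Local Open Scope ring_scope.
Implicit Types (i j k : 'I_m) (u v x y : 'rV[int]_m) (s t : seq 'I_m) (J : {set 'I_m}).

Definition dot u v : int := \sum_k u 0 k * v 0 k.

Lemma dotC u v : dot u v = dot v u.
Proof. by apply: eq_bigr => k _; rewrite mulrC. Qed.

Lemma dotDr u v w : dot u (v + w) = dot u v + dot u w.
Proof. by rewrite -big_split; apply: eq_bigr => k _; rewrite !mxE mulrDr. Qed.

Lemma dotNr u v : dot u (- v) = - dot u v.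
Proof. by rewrite -sumrN; apply: eq_bigr => k _; rewrite !mxE mulrN. Qed.

Lemma dotBr u v w : dot u (v - w) = dot u v - dot u w.
Proof. by rewrite dotDr dotNr. Qed.

Lemma dotZr c u v : dot u (c *: v) = c * dot u v.
Proof. by rewrite mulr_sumr; apply: eq_bigr => k _; rewrite !mxE mulrCA. Qed.

Lemma dotDl u v w : dot (v + w) u = dot v u + dot w u.
Proof. by rewrite !(dotC _ u) dotDr. Qed.

Lemma dotBl u v w : dot (v - w) u = dot v u - dot w u.
Proof. by rewrite !(dotC _ u) dotBr. Qed.

Lemma dotZl c u v : dot (c *: v) u = c * dot v u.
Proof. by rewrite !(dotC _ u) dotZr. Qed.

Lemma alphaE i k : alpha i 0 k = (k == lo i)%:R - sg i * (k == hi i)%:R.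
Proof.
rewrite /alpha /lab /sg /lastn; have im := ltn_ord i; have km := ltn_ord k.
case: ifP => hi_; rewrite !mxE /lab -!val_eqE /=.
  have -> : (val i == p.+2) = false by move: hi_ => /=; lia.
  rewrite mul1r; congr (_%:R - _%:R); lia.
have -> : (val i == p.+2) = true by move: hi_ => /=; lia.
rewrite mulN1r opprK; congr (_%:R + _%:R); lia.
Qed.

Lemma sum_delta (F : 'I_m -> int) j : \sum_k F k * (k == j)%:R = F j.
Proof.
rewrite (bigD1 j) //= eqxx mulr1 big1 ?addr0 // => k /negbTE->.
by rewrite mulr0.
Qed.

Lemma dot_alpha v i : dot v (alpha i) = v 0 (lo i) - sg i * v 0 (hi i).
Proof.
rewrite /dot -[v 0 (lo i)](sum_delta (fun k => v 0 k)).
rewrite -[v 0 (hi i)](sum_delta (fun k => v 0 k)) mulr_sumr -sumrB.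
by apply: eq_bigr => k _; rewrite alphaE; ring.
Qed.

Lemma sgK i : sg i * sg i = 1.
Proof. by rewrite /sg; case: (lastn i). Qed.

Lemma sreflE i v k : srefl i v 0 k =
  if k == lo i then sg i * v 0 (hi i)
  else if k == hi i then sg i * v 0 (lo i) else v 0 k.
Proof.
rewrite /srefl -/(dot v (alpha i)) dot_alpha 3!mxE alphaE.
case: (eqVneq k (lo i)) => [->|klo].
  rewrite lo_neq_hi /= mulr0; ring.
case: (eqVneq k (hi i)) => [->|_].
  rewrite /= mulr1 sub0r; have := sgK i; move: (sg i) (v _ _) (v _ _) => e a b ee.
  transitivity (b + (a * e - (e * e) * b)); [ring|rewrite ee; ring].
by rewrite mulr0 subrr mulr0 subr0.
Qed.

Lemma alpha_norm i : dot (alpha i) (alpha i) = 2%:Z.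
Proof.
rewrite dot_alpha !alphaE eqxx [hi i == _]eq_sym lo_neq_hi eqxx.
by rewrite /sg; case: (lastn i).
Qed.

Lemma sreflK i : involutive (srefl i).
Proof.
move=> v; rewrite /srefl -!/(dot _ (alpha i)) dotBl dotZl alpha_norm.
rewrite -addrA -opprD -scalerDl.
have -> : dot v (alpha i) + (dot v (alpha i) - dot v (alpha i) * 2%:Z) = 0 by ring.
by rewrite scale0r subr0.
Qed.

Lemma srefl_dot i u v : dot (srefl i u) (srefl i v) = dot u v.
Proof.
rewrite /srefl -!/(dot _ (alpha i)) !(dotBl, dotBr, dotZl, dotZr) alpha_norm.
rewrite (dotC (alpha i) v); ring.
Qed.

Lemma srefl_alpha i : srefl i (alpha i) = - alpha i.
Proof.
rewrite /srefl -/(dot _ (alpha i)) alpha_norm.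
apply/rowP => k; rewrite !mxE; ring.
Qed.

Lemma sreflD i u v : srefl i (u + v) = srefl i u + srefl i v.
Proof.
rewrite /srefl -!/(dot _ (alpha i)) dotDl scalerDl.
by rewrite opprD addrACA.
Qed.

Lemma sreflZ i c v : srefl i (c *: v) = c *: srefl i v.
Proof.
by rewrite /srefl -!/(dot _ (alpha i)) dotZl scalerBr scalerA.
Qed.

Lemma wactD t u v : wact t (u + v) = wact t u + wact t v.
Proof. by elim: t => //= i t ->; rewrite sreflD. Qed.

Lemma wactZ t c v : wact t (c *: v) = c *: wact t v.
Proof. by elim: t => //= i t ->; rewrite sreflZ. Qed.

Lemma wactN t v : wact t (- v) = - wact t v.
Proof. by rewrite -scaleN1r wactZ scaleN1r. Qed.

Lemma wactB t u v : wact t (u - v) = wact t u - wact t v.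
Proof. by rewrite wactD wactN. Qed.

Lemma wact_cons i t v : wact (i :: t) v = srefl i (wact t v).
Proof. by []. Qed.

Lemma wact_cat s t v : wact (s ++ t) v = wact s (wact t v).
Proof. by rewrite /wact foldr_cat. Qed.

Lemma wact_rcons s i v : wact (rcons s i) v = wact s (srefl i v).
Proof. by rewrite -cats1 wact_cat. Qed.

Lemma wact_dot t u v : dot (wact t u) (wact t v) = dot u v.
Proof. by elim: t => //= i t <-; rewrite srefl_dot. Qed.

Lemma wact_revK t v : wact (rev t) (wact t v) = v.
Proof.
elim: t v => //= i t IH v.
by rewrite rev_cons wact_rcons sreflK IH.
Qed.

Lemma wactK_rev t v : wact t (wact (rev t) v) = v.
Proof. by rewrite -{1}(revK t) wact_revK. Qed.

Lemma wact_inj t : injective (wact t).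
Proof. exact: can_inj (wact_revK t). Qed.

Lemma wact_srefl t j v :
  wact t (srefl j v) = wact t v - dot (wact t v) (wact t (alpha j)) *: wact t (alpha j).
Proof. by rewrite wact_dot /srefl wactB wactZ. Qed.

(** The half sum of the positive roots of D_m, (m-1, ..., 1, 0). Pairing with it gives 1 on each
    simple root, so [ht] is the height, and its sign tells positive roots from negative ones without
    a list. *)
Definition rho : 'rV[int]_m := \row_k (m - k.+1)%:Z.
Definition ht v : int := dot rho v.

Lemma ht_alpha i : ht (alpha i) = 1.
Proof.
rewrite /ht dot_alpha !mxE /sg /lastn /=; have := ltn_ord i.
by case: eqP => /=; lia.
Qed.

Lemma htN v : ht (- v) = - ht v. Proof. exact: dotNr. Qed.
Lemma htB u v : ht (u - v) = ht u - ht v. Proof. exact: dotBr. Qed.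
Lemma htZ c v : ht (c *: v) = c * ht v. Proof. exact: dotZr. Qed.

(** The integral vectors of norm 2 are the +-eps_k +- eps_l with k <> l, that is, the roots of D_m;
    in this form invariance under W is that of the scalar product. *)
Definition isroot v := dot v v = 2%:Z.

Lemma root_wact t i : isroot (wact t (alpha i)).
Proof. by rewrite /isroot wact_dot alpha_norm. Qed.

Lemma int_sq_ge0 (a : int) : 0 <= a * a.
Proof. by rewrite -expr2 sqr_ge0. Qed.

Lemma int_sq_unit (a c : int) :
  0 <= c -> a * a + c <= 2%:Z -> a != 0 -> a = 1 \/ a = -1.
Proof.
move=> c0 ac a0; have a1 : a <= 1 by nia.
have a2 : -1 <= a by nia.
by lia.
Qed.

(** Norm 2 leaves exactly two nonzero coordinates, each 1 or -1. The entries of [rho] are distinct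
    and nonnegative, so no signed sum of two of them vanishes. *)
Lemma root_ht v : isroot v -> ht v != 0.
Proof.
rewrite /isroot /ht => v2.
have [k vk] : exists k, v 0 k != 0.
  apply/existsP; apply: contraT => /existsPn v0.
  by move: v2; rewrite /dot big1 // => k _; move: (v0 k); rewrite negbK => /eqP->.
move: v2; rewrite /dot (bigD1 k) //=; set S := \sum_(i | _) _ => v2.
have S0 : 0 <= S by apply: sumr_ge0 => i _; apply: int_sq_ge0.
have vk1 : v 0 k = 1 \/ v 0 k = -1 by apply: int_sq_unit S0 _ vk; rewrite v2.
have S1 : S = 1 by move: v2; case: vk1 => ->; lia.
have [l lk vl] : exists2 l, l != k & v 0 l != 0.
  apply/exists_inP; apply: contraT => /exists_inPn v0.
  move: S1; rewrite /S big1 // => l lk; move: (v0 l lk); rewrite negbK => /eqP->.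
  by rewrite mul0r.
move: S1; rewrite /S (bigD1 l) //=; set S' := \sum_(i | _) _ => S'1.
have S'0 : 0 <= S' by apply: sumr_ge0 => i _; apply: int_sq_ge0.
have vl1 : v 0 l = 1 \/ v 0 l = -1 by apply: int_sq_unit S'0 _ vl; rewrite S'1.
have {}S'1 : S' = 0 by move: S'1; case: vl1 => ->; lia.
have vi i : (i != k) && (i != l) -> v 0 i = 0.
  move=> ikl; move: S'1; rewrite /S' (bigD1 i) //=; set S2 := \sum_(j | _) _.
  have : 0 <= S2 by apply: sumr_ge0 => j _; apply: int_sq_ge0.
  by have := int_sq_ge0 (v 0 i); nia.
rewrite (bigD1 k) //= (bigD1 l) //= big1 => [|i /vi ->]; last by rewrite mulr0.
rewrite !mxE; have := ltn_ord k; have := ltn_ord l.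
move: lk; rewrite -val_eqE /=.
by case: vk1 => ->; case: vl1 => ->; lia.
Qed.

Lemma dot_root_le u v : isroot u -> isroot v -> u != v -> dot u v <= 1.
Proof.
rewrite /isroot => u2 v2 uv; have : 0 < dot (u - v) (u - v).
  have [k wk] : exists k, (u - v) 0 k != 0.
    apply/existsP; apply: contraT => /existsPn w0; case/negP: uv.
    rewrite -subr_eq0; apply/eqP/rowP => k; rewrite [RHS]mxE.
    by move: (w0 k); rewrite negbK => /eqP.
  rewrite /dot (bigD1 k) //=; apply: ltr_pwDl; last first.
    by apply: sumr_ge0 => i _; apply: int_sq_ge0.
  by rewrite lt_def int_sq_ge0 mulf_neq0.
by rewrite dotBl !dotBr u2 v2 (dotC v u); lia.
Qed.

(** Two distinct roots pair to at most 1, so s_i lowers the height by at most 1. A positive height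
    thus stays nonnegative, and no root has height 0. *)
Lemma srefl_pos i v : isroot v -> 0 < ht v -> v != alpha i -> 0 < ht (srefl i v).
Proof.
move=> rv hv vi; rewrite lt_def root_ht; last by rewrite /isroot srefl_dot.
rewrite /srefl -/(dot _ _) htB htZ ht_alpha mulr1 subr_ge0.
by have := dot_root_le rv (alpha_norm i) vi; lia.
Qed.

(** The exchange condition. As the letters of t are applied to alpha_j from the right, the root
    first turns negative at some letter k, where it must equal alpha_k. Then s_k t' s_j = t' for the
    part t' to the right of k, and k is the letter to drop. *)
Lemma deletion t j : ht (wact t (alpha j)) < 0 ->
  exists t', [/\ (size t').+1 = size t, {subset t' <= t} &
                 wact t' =1 wact (rcons t j)].
Proof.
elim: t => [|k t IH] /=; first by rewrite ht_alpha.
have [neg _|pos] := ltP (ht (wact t (alpha j))) 0.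
  have [t' [st' sub e]] := IH neg; exists (k :: t'); split.
  - by rewrite /= st'.
  - by move=> x; rewrite !inE => /orP[->//|/sub ->]; rewrite orbT.
  - by move=> v /=; rewrite e.
have [e _|ne] := eqVneq (wact t (alpha j)) (alpha k).
  exists t; split=> //; first by move=> x; rewrite inE orbC => ->.
  move=> v; rewrite wact_cons wact_rcons wact_srefl e.
  by rewrite -[X in _ = srefl _ X]/(srefl k (wact t v)) sreflK.
have r := root_wact t j.
have pos' : 0 < ht (wact t (alpha j)) by rewrite lt_def pos (root_ht r).
by move=> h; have := srefl_pos r pos' ne; lia.
Qed.

(** The last letter k of a nonempty word negates alpha_k, so the part before it makes alpha_k
    negative, and exchange rewrites the word with two letters fewer. *)
Lemma wact_pos_id J t : {subset t <= J} ->
  (forall j, j \in J -> 0 < ht (wact t (alpha j))) -> wact t =1 id.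
Proof.
have [n] := ubnP (size t); elim: n t => // n IH t.
case/lastP: t => [//|t k] szt tJ pos.
have kJ : k \in J by apply: tJ; rewrite mem_rcons mem_head.
have tJ' : {subset t <= J} by move=> x xt; apply: tJ; rewrite mem_rcons inE xt orbT.
have neg : ht (wact t (alpha k)) < 0.
  by have := pos k kJ; rewrite wact_rcons srefl_alpha wactN htN; lia.
have [t' [st' sub e]] := deletion neg.
move=> v; rewrite -e; apply: IH.
- by move: szt; rewrite size_rcons; lia.
- by move=> x /sub /tJ'.
- by move=> j jJ; rewrite e; apply: pos.
Qed.

Lemma reduced_rcons t j : reduced t -> 0 < ht (wact t (alpha j)) -> reduced (rcons t j).
Proof.
move=> rt pos u eu; rewrite size_rcons leqNgt; apply/negP => szu.
have neg : ht (wact u (alpha j)) < 0.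
  by rewrite eu wact_rcons srefl_alpha wactN htN; lia.
have [u' [su' _ e]] := deletion neg.
have /rt : wact u' =1 wact t by move=> v; rewrite e wact_rcons eu wact_rcons sreflK.
by lia.
Qed.

Lemma reduced_rconsP t j : reduced (rcons t j) ->
  reduced t /\ 0 < ht (wact t (alpha j)).
Proof.
move=> r; split.
  move=> u eu; have := r (rcons u j); rewrite !size_rcons ltnS; apply.
  by move=> v; rewrite !wact_rcons eu.
rewrite ltNge; apply/negP => le.
have neg : ht (wact t (alpha j)) < 0.
  by rewrite lt_neqAle le (root_ht (root_wact _ _)).
have [u' [su' _ e]] := deletion neg.
by have := r _ e; rewrite size_rcons; lia.
Qed.

(* Each letter of a reduced word lowers the pairing of rho with its image. *)
Lemma reduced_bound t : reduced t -> (size t)%:Z <= dot rho rho - ht (wact t rho).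
Proof.
elim/last_ind: t => [|t j IH]; first by rewrite /= subrr.
case/reduced_rconsP => /IH le pos; rewrite size_rcons wact_rcons.
rewrite wact_srefl htB wact_dot htZ -/(ht (alpha j)) ht_alpha mul1r; lia.
Qed.

(** The squared norm of rho + w rho is nonnegative, so -(rho, w rho) is at most (rho, rho); the
    previous bound becomes uniform in the word. *)
Lemma reduced_size t : reduced t -> (size t <= absz (dot rho rho + dot rho rho)%R)%N.
Proof.
move/reduced_bound.
have : 0 <= dot (rho + wact t rho) (rho + wact t rho).
  by apply: sumr_ge0 => k _; apply: int_sq_ge0.
by rewrite dotDl !dotDr wact_dot (dotC _ rho) -/(ht (wact t rho)); lia.
Qed.

(** [w0] falls back on the empty word if there is no longest word; the bound on reduced words
    excludes this. *)
Lemma longest_ex J : exists t, longest_word J t.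
Proof.
pose P n := `[< exists t, [/\ {subset t <= J}, reduced t & size t = n] >].
have P0 : exists n, P n.
  by exists 0%N; apply/asboolP; exists [::]; split=> // u _; rewrite leq0n.
have Pb n : P n -> (n <= absz (dot rho rho + dot rho rho)%R)%N.
  by move=> /asboolP [t [_ /reduced_size r <-]].
case: (ex_maxnP P0 Pb) => n /asboolP [t [tJ rt <-]] mx.
exists t; split=> // u uJ ru; apply: mx; apply/asboolP; by exists u.
Qed.

Lemma longest_neg J t j : longest_word J t -> j \in J -> ht (wact t (alpha j)) < 0.
Proof.
move=> [tJ rt mx] jJ; rewrite ltNge; apply/negP => ge.
have pos : 0 < ht (wact t (alpha j)) by rewrite lt_def ge (root_ht (root_wact _ _)).
have := mx (rcons t j); rewrite size_rcons ltnn => H.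
suff: false by []. apply: H; last exact: reduced_rcons.
by move=> x; rewrite mem_rcons inE => /orP[/eqP->//|/tJ].
Qed.

Lemma dot_wact_perp J t y v : {subset t <= J} ->
  (forall j, j \in J -> dot y (alpha j) = 0) -> dot y (wact t v) = dot y v.
Proof.
move=> tJ yJ; elim: t tJ => //= i t IH tJ.
rewrite /srefl -/(dot _ _) dotBr dotZr yJ ?tJ ?mem_head // mulr0 subr0 IH //.
by move=> x xt; apply: tJ; rewrite inE xt orbT.
Qed.

Lemma alpha_inj : injective (@alpha m).
Proof.
move=> i j e; apply/eqP; apply: contraT => ij.
have := alpha_norm i; rewrite {1}e dot_alpha !alphaE.
move: ij; rewrite -!val_eqE /= /sg /lastn; have := ltn_ord i; have := ltn_ord j.
move=> jm im ij.
by do 6!(case: eqP => ? /=); lia.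
Qed.

(** A certificate that the word t, reduced or not, acts as w_{0,J} and that f is theta_J on J. *)
Definition w0_data J t (f : 'I_m -> 'I_m) :=
  [/\ {subset t <= J}, forall j, j \in J -> f j \in J &
      forall j, j \in J -> wact t (alpha j) = - alpha (f j)].

Lemma w0_dataE J t f : w0_data J t f -> w0 J =1 wact t.
Proof.
move=> [tJ fJ tE]; have [s0 ls0] := longest_ex J.
have lw : longest_word J (classical_sets.xget [::] (longest_word J)).
  by apply: classical_sets.xgetI ls0.
rewrite /w0; move: (classical_sets.xget _ _) lw => s ls v.
suff e : wact (t ++ s) =1 id.
  have e' : wact t (wact t v) = v.
    rewrite -wact_cat; apply: (@wact_pos_id J) => [x|j jJ].
      by rewrite mem_cat => /orP[]; apply: tJ.
    by rewrite wact_cat !(tE, wactN, opprK) ?fJ // ht_alpha.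
  by apply: (@wact_inj t); rewrite -wact_cat e e'.
have [sJ _ _] := ls.
apply: (@wact_pos_id J) => [x|j jJ]; first by rewrite mem_cat => /orP[/tJ|/sJ].
rewrite wact_cat.
have neg := longest_neg ls jJ.
(* Since t sends alpha_k to the negative of a simple root, t^-1 rho + rho is orthogonal to the roots
   of J; its pairing with s alpha_j equals that with alpha_j, which is 0. Hence ht (t s alpha_j) = -
   ht (s alpha_j) > 0, and t s is the identity. *)
have perp k : k \in J -> dot (wact (rev t) rho + rho) (alpha k) = 0.
  move=> kJ; rewrite dotDl -(wact_dot t) wactK_rev tE // dotNr.
  by rewrite -/(ht (alpha (f k))) -/(ht (alpha k)) !ht_alpha addNr.
have := dot_wact_perp (alpha j) sJ perp; rewrite perp // dotDl.
by rewrite -(wact_dot t) wactK_rev -/(ht (wact t _)) -/(ht (wact s _)); lia.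
Qed.

Lemma theta_dataE J t f j : w0_data J t f -> j \in J -> theta J j = f j.
Proof.
move=> D jJ; rewrite /theta; have [_ fJ tE] := D; case: pickP => [k|/(_ (f j))] /=.
  by rewrite (w0_dataE D) tE // opprK => /andP[_ /eqP /alpha_inj].
by rewrite fJ // (w0_dataE D) tE // opprK eqxx.
Qed.

End Roots.

(** * Explicit words in type D *)

Section Words.
Variable p : nat.
Local Notation m := p.+3.
Local Open Scope ring_scope.
Implicit Types (i j k x : 'I_m) (u v : 'rV[int]_m) (s t : seq 'I_m) (J : {set 'I_m}).

Lemma srefl_swap i v k : ~~ lastn i -> srefl i v 0 k = v 0 (tperm (lo i) (hi i) k).
Proof.
move=> il; rewrite sreflE /sg (negbTE il) !mul1r.
by case: tpermP => [->|->|/eqP/negbTE-> /eqP/negbTE->]; rewrite ?eqxx // eq_sym lo_neq_hi.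
Qed.

Lemma word_swap i j : (i < j)%N ->
  exists2 t, {in t, forall x, (i <= x < j)%N} &
    forall v k, wact t v 0 k = v 0 (tperm i j k).
Proof.
have [n] := ubnP j; elim: n j => // n IH j jn ij.
have jm := ltn_ord j; have jm1 : (j.-1 < m)%N by lia.
pose l : 'I_m := Ordinal jm1.
have ll : ~~ lastn l by rewrite /lastn /=; lia.
have lol : lo l = l by apply: val_inj; rewrite /=; lia.
have hil : hi l = j by apply: val_inj; rewrite /=; lia.
have [il|il] := ltnP i l; last first.
  exists [:: l] => [x|v k]; first by rewrite inE => /eqP ->; move: il => /=; lia.
  rewrite /= srefl_swap // lol hil; congr (v 0 (tperm _ _ k)).
  by apply: val_inj; move: il => /=; lia.
have [|t tin tE] := IH l _ il; first by move: jn => /=; lia.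
exists (l :: t ++ [:: l]) => [x|v k].
  rewrite inE mem_cat inE => /orP[/eqP->|/orP[/tin|/eqP->]]; move: il => /=; lia.
rewrite wact_cons wact_cat srefl_swap // tE srefl_swap // lol hil; congr (v 0 _).
have ne1 : i != l by rewrite neq_ltn il.
have ne2 : i != j by rewrite neq_ltn ij.
have ne3 : l != j by rewrite -val_eqE /=; lia.
have : (tperm i l ^ tperm l j)%g k = tperm i j k.
  by rewrite tpermJ tpermL (@tpermD _ l j i) // eq_sym.
by rewrite /conjg tpermV !permM.
Qed.

Definition rev_ord_in a b k : 'I_m := insubd k (if (a <= k <= b)%N then (a + b - k)%N else k).

Lemma val_rev_ord_in a b k : (b < m)%N ->
  rev_ord_in a b k = (if (a <= k <= b)%N then a + b - k else k)%N :> nat.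
Proof.
by move=> bm; rewrite val_insubd; have := ltn_ord k; case: ifP => //; case: ifP; lia.
Qed.

Lemma word_rev a b : (b < m)%N ->
  exists2 t, {in t, forall x, (a <= x < b)%N} &
    forall v k, wact t v 0 k = v 0 (rev_ord_in a b k).
Proof.
have [n] := ubnP (b - a); elim: n a b => // n IH a b ban bm.
have [ab|ba] := ltnP a b; last first.
  exists [::] => [x //|v k /=]; congr (v 0 _); apply: val_inj.
  by rewrite /= val_rev_ord_in //; case: ifP; lia.
have am : (a < m)%N by lia.
have [t1 t1in t1E] := @word_swap (Ordinal am) (Ordinal bm) ab.
have [||t2 t2in t2E] := IH a.+1 b.-1; [lia|lia|].
exists (t1 ++ t2) => [x|v k]; first by rewrite mem_cat => /orP[/t1in|/t2in] /=; lia.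
rewrite wact_cat t1E t2E; congr (v 0 _); apply: val_inj.
rewrite /= !val_rev_ord_in //; last by lia.
by case: tpermP => [->|->|/eqP + /eqP]; rewrite -?val_eqE /=; repeat case: ifP; lia.
Qed.

Definition spin0 : 'I_m := inord p.+1.
Definition spin1 : 'I_m := ord_max.

Lemma spin0E : spin0 = p.+1 :> nat. Proof. by rewrite inordK. Qed.
Lemma lo_spin0 : lo spin0 = spin0. Proof. by apply: val_inj; rewrite /= spin0E; lia. Qed.
Lemma hi_spin0 : hi spin0 = spin1. Proof. by apply: val_inj; rewrite /= spin0E; lia. Qed.
Lemma lo_spin1 : lo spin1 = spin0. Proof. by apply: val_inj; rewrite /= spin0E; lia. Qed.
Lemma hi_spin1 : hi spin1 = spin1. Proof. by apply: val_inj; rewrite /=; lia. Qed.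
Lemma sg_spin0 : sg spin0 = 1. Proof. by rewrite /sg /lastn /= spin0E eqn_leq ltnn andbF. Qed.
Lemma sg_spin1 : sg spin1 = -1. Proof. by rewrite /sg /lastn eqxx. Qed.

(** s_{m-1} s_m negates the last two coordinates; conjugation by a transposition moves one of the
    two signs to i. *)
Lemma word_neg2 i : (i < p.+2)%N ->
  exists2 t, {in t, forall x, (i <= x)%N} &
    forall v k, wact t v 0 k = if (k == i) || (k == spin1) then - v 0 k else v 0 k.
Proof.
have s01 : (spin0 == spin1) = false by rewrite -val_eqE /= spin0E; lia.
have base v k : wact [:: spin0; spin1] v 0 k =
    if (k == spin0) || (k == spin1) then - v 0 k else v 0 k.
  rewrite /= !sreflE lo_spin0 hi_spin0 lo_spin1 hi_spin1 sg_spin0 sg_spin1.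
  rewrite eqxx [spin1 == _]eq_sym s01 eqxx.
  by case: eqP => [->|_]; [rewrite mul1r mulN1r|case: eqP => [->|] //=; rewrite mul1r mulN1r].
rewrite ltnS leq_eqVlt => /orP[/eqP ip|ip].
  have -> : i = spin0 by apply: val_inj; rewrite /= spin0E.
  by exists [:: spin0; spin1] => // x; rewrite !inE => /orP[]/eqP->; rewrite spin0E.
have ip' : (i < spin0)%N by rewrite spin0E.
have [t tin tE] := word_swap ip'.
exists (t ++ [:: spin0; spin1] ++ t) => [x|v k].
  rewrite !mem_cat !inE => /orP[/tin|/orP[/orP[]/eqP->|/tin]] //=; rewrite ?spin0E; lia.
have i1 : (i == spin1) = false by rewrite -val_eqE /=; lia.
rewrite !wact_cat tE base tE tpermK.
case: (tpermP i spin0 k) => [->|->|/eqP/negbTE-> /eqP/negbTE->] //.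
  by rewrite !eqxx.
by rewrite i1 s01 eq_sym -val_eqE /= (gtn_eqF ip').
Qed.

(** In type D signs change in pairs, so each coordinate from a on is negated together with the last
    one, which collects one sign for each of the p+2-a others. *)
Lemma word_neg a : (a <= p.+2)%N ->
  exists2 t, {in t, forall x, (a <= x)%N} &
    forall v k, wact t v 0 k =
      if (k < a)%N then v 0 k else if k == spin1 then (-1) ^+ (p.+2 - a) * v 0 k else - v 0 k.
Proof.
have [n] := ubnP (p.+2 - a); elim: n a => // n IH a an.
rewrite leq_eqVlt => /orP[/eqP ap|ap].
  exists [::] => // v k; have km := ltn_ord k; rewrite -val_eqE /= ap subnn mul1r.
  case: ltnP => // kp; suff -> : (k == p.+2 :> nat) = true by [].
  by lia.
have am : (a < m)%N by lia.
have [t1 t1in t1E] := @word_neg2 (Ordinal am) ap.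
have [|//|t2 t2in t2E] := IH a.+1; first lia.
exists (t1 ++ t2) => [x|v k]; first by rewrite mem_cat => /orP[/t1in|/t2in] /=; lia.
rewrite wact_cat t1E t2E -!val_eqE /=.
have -> : (p.+2 - a = (p.+2 - a.+1).+1)%N by lia.
rewrite exprS mulN1r ltnS.
case: (eqVneq (k : nat) p.+2) => [kp|kp]; last first.
  case: (eqVneq (k : nat) a) => [->|ka] /=; first by rewrite leqnn ltnn.
  by rewrite leq_eqVlt (negbTE ka).
have -> : (k <= a)%N = false by lia.
have -> : (k < a)%N = false by lia.
by rewrite orbT mulNr.
Qed.

(** The diagram automorphism exchanging the spin nodes, realised on weights by [tauv]. It carries
    chains ending at one spin node to chains ending at the other, so only one kind needs explicit
    words. *)
Definition taun i : 'I_m :=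
  if i == spin0 then spin1 else if i == spin1 then spin0 else i.

Definition tauv v : 'rV[int]_m := \row_k (if k == spin1 then - v 0 k else v 0 k).

Lemma spin_neq : (spin0 == spin1) = false.
Proof. by rewrite -val_eqE /= spin0E; lia. Qed.

Lemma taunK : involutive taun.
Proof.
move=> i; rewrite /taun; case: (eqVneq i spin0) => [->|i0].
  by rewrite eq_sym spin_neq eqxx.
by case: (eqVneq i spin1) => [->|i1]; rewrite ?eqxx // (negbTE i0) (negbTE i1).
Qed.

Lemma lo_taun i : lo (taun i) = lo i.
Proof.
rewrite /taun; case: eqP => [->|_]; first by rewrite lo_spin1 lo_spin0.
by case: eqP => [->|//]; rewrite lo_spin1 lo_spin0.
Qed.

Lemma hi_taun i : hi (taun i) = hi i.
Proof.
rewrite /taun; case: eqP => [->|_]; first by rewrite hi_spin1 hi_spin0.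
by case: eqP => [->|//]; rewrite hi_spin1 hi_spin0.
Qed.

Lemma hi_spin1E i : (hi i == spin1) = (i == spin0) || (i == spin1).
Proof. by rewrite -!val_eqE /= spin0E; have := ltn_ord i; lia. Qed.

Lemma lo_spin1E i : (lo i == spin1) = false.
Proof. by rewrite -!val_eqE /=; lia. Qed.

Lemma srefl_taun i v : srefl (taun i) (tauv v) = tauv (srefl i v).
Proof.
apply/rowP => k; rewrite sreflE [RHS]mxE sreflE lo_taun hi_taun !mxE.
rewrite hi_spin1E lo_spin1E.
have sgt : sg (taun i) = if (i == spin0) || (i == spin1) then - sg i else sg i.
  rewrite /taun; case: (eqVneq i spin0) => [->|_]; first by rewrite sg_spin0 sg_spin1.
  by case: (eqVneq i spin1) => [->|//] /=; rewrite sg_spin0 sg_spin1.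
rewrite sgt; case: (eqVneq k (lo i)) => [->|_].
  by rewrite lo_spin1E; case: ifP => _ //; rewrite mulrNN.
case: (eqVneq k (hi i)) => [->|_] //.
by rewrite hi_spin1E; case: ifP => _ //; rewrite mulNr.
Qed.

Lemma wact_taun t v : wact [seq taun i | i <- t] (tauv v) = tauv (wact t v).
Proof. by elim: t => //= i t ->; rewrite srefl_taun. Qed.

Lemma alpha_taun i : alpha (taun i) = tauv (alpha i).
Proof.
apply/rowP => k; rewrite [RHS]mxE !alphaE lo_taun hi_taun.
rewrite /taun; case: (eqVneq i spin0) => [->|i0].
  rewrite sg_spin0 sg_spin1 lo_spin0 hi_spin0.
  by case: (eqVneq k spin1) => [->|_]; rewrite // eq_sym spin_neq.
case: (eqVneq i spin1) => [->|i1].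
  rewrite sg_spin0 sg_spin1 lo_spin1 hi_spin1.
  by case: (eqVneq k spin1) => [->|_]; rewrite // eq_sym spin_neq.
case: (eqVneq k spin1) => [->|_] //.
rewrite [spin1 == lo _]eq_sym lo_spin1E [spin1 == _]eq_sym hi_spin1E.
by rewrite (negbTE i0) (negbTE i1) mulr0 subr0 oppr0.
Qed.

Lemma tauvN v : tauv (- v) = - tauv v.
Proof. by apply/rowP => k; rewrite !mxE; case: eqP. Qed.

Lemma w0_data_taun J t f : w0_data J t f ->
  w0_data (taun @: J) [seq taun i | i <- t] (taun \o f \o taun).
Proof.
move=> [tJ fJ tE]; split=> [x /mapP[y yt ->]|x /imsetP[j jJ ->]|x /imsetP[j jJ ->]].
- by apply: imset_f; apply: tJ.
- by rewrite /= taunK imset_f // fJ.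
- by rewrite /= taunK !alpha_taun wact_taun tE // tauvN.
Qed.

Definition nodesA a b : {set 'I_m} := [set j : 'I_m | (a <= j <= b)%N].
Definition nodesD a : {set 'I_m} := [set j : 'I_m | (a <= j)%N].

Lemma w0_dataA a b : (b < p.+2)%N -> exists t, w0_data (nodesA a b) t (rev_ord_in a b).
Proof.
(* The nodes a..b act on the coordinates a..b+1: the reversal runs to b+1 on coordinates but to b on
   nodes. *)
move=> bp; have [|t tin tE] := @word_rev a b.+1; first by lia.
exists t; split=> [x /tin|x|j]; rewrite ?inE //.
  by rewrite val_rev_ord_in; [case: ifP|]; lia.
move=> ab; apply/rowP => k; rewrite tE [RHS]mxE !alphaE /sg.
have rj : rev_ord_in a b j = (a + b - j)%N :> nat by rewrite val_rev_ord_in ?ab //; lia.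
have -> : lastn j = false by rewrite /lastn /=; lia.
have -> : lastn (rev_ord_in a b j) = false by rewrite /lastn /= rj; lia.
have bp1 : (b.+1 < m)%N by lia.
rewrite -!val_eqE /= rj !(val_rev_ord_in _ _ bp1) !mul1r opprB.
by congr (_%:R - _%:R); case: ifP; lia.
Qed.

(** The rank is p+3-a. For even rank w_0 is -1 on the coordinates from a on; for odd rank the last
    coordinate keeps its sign, which amounts to -1 followed by [tauv]. *)
Lemma w0_dataD a : (a <= p)%N ->
  exists t, w0_data (nodesD a) t (if odd (p.+2 - a) then id else taun).
Proof.
move=> ap; have [|t tin tE] := @word_neg a; first by lia.
exists t; split=> [x /tin|x|j]; rewrite ?inE //.
  by case: ifP => // _; rewrite /taun; case: eqP => [_ _|_]; [|case: eqP => [_ _|//]];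
     rewrite ?spin0E //=; lia.
move=> aj; case: ifP => par.
  apply/rowP => k; rewrite tE [RHS]mxE -signr_odd par mulN1r if_same.
  case: ltnP => // ka; rewrite alphaE -!val_eqE /=.
  have -> : (k == minn j p.+1 :> nat) = false by lia.
  have -> : (k == (minn j p.+1).+1 :> nat) = false by lia.
  by rewrite mulr0 subrr oppr0.
rewrite alpha_taun -tauvN; apply/rowP => k; rewrite tE !mxE -signr_odd par mul1r.
case: ltnP => ka; last by case: eqP; rewrite ?opprK.
have -> : alpha j 0 k = 0.
  rewrite alphaE -!val_eqE /=.
  have -> : (k == minn j p.+1 :> nat) = false by lia.
  have -> : (k == (minn j p.+1).+1 :> nat) = false by lia.
  by rewrite mulr0 subrr.
by rewrite oppr0; case: ifP; rewrite ?oppr0.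
Qed.

End Words.

(** * Connected subdiagrams *)

Section Connected.
Variable p : nat.
Local Notation m := p.+3.
Local Open Scope ring_scope.
Implicit Types (i j k x : 'I_m) (u v : 'rV[int]_m) (s t : seq 'I_m) (J K L : {set 'I_m}).

Lemma dadjE i j : dadj i j =
  [|| (j == i.+1 :> nat) && (i <= p)%N, (i == j.+1 :> nat) && (j <= p)%N,
      (i == p :> nat) && (j == p.+2 :> nat) | (j == p :> nat) && (i == p.+2 :> nat)].
Proof. by rewrite /dadj /lab; have := ltn_ord i; have := ltn_ord j; lia. Qed.

Lemma dconnected_cut J (P : pred 'I_m) i j : dconnected J -> i \in J -> j \in J ->
  P i -> ~~ P j -> exists k l, [/\ k \in J, l \in J, P k, ~~ P l & dadj k l].
Proof.
move=> /andP[_ /forall_inP cJ] iJ jJ Pi Pj.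
apply: contrapT => no.
have cl : closed (fun a b => [&& a \in J, b \in J & dadj a b]) P.
  move=> a b /and3P[aJ bJ ab]; rewrite !unfold_in.
  case Pa: (P a); case Pb: (P b) => //; case: no.
    by exists a, b; rewrite Pa Pb.
  by exists b, a; rewrite Pa Pb; split=> //; move: ab; rewrite /dadj orbC.
have /forall_inP /(_ j jJ) := cJ i iJ.
move/(closed_connect cl); rewrite !unfold_in Pi => /esym Pj'.
by rewrite Pj' in Pj.
Qed.

(** The only edge that jumps over a node joins p to p+2, so the cut just below k <= p can be crossed
    only at k itself. *)
Lemma dconnected_between J i j k : dconnected J -> i \in J -> j \in J ->
  (i < k)%N -> (k < j)%N -> (k <= p)%N -> k \in J.
Proof.
move=> cJ iJ jJ ik kj kp; apply: contraT => kJ.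
have [||a [b [aJ bJ /= ak bk]]] := @dconnected_cut J (fun x => x < k)%N i j cJ iJ jJ.
- by [].
- by rewrite -leqNgt ltnW.
have bk' : b != k by apply: contraNneq kJ => <-.
by rewrite dadjE; move: bk'; rewrite -val_eqE /=; lia.
Qed.

Lemma dconnected_spin J x j : dconnected J -> x \in J -> j \in J -> (p < x)%N -> j != x ->
  exists2 k, k \in J & k = p :> nat.
Proof.
move=> cJ xJ jJ px jx.
have [|//|k [l [kJ lJ /eqP -> /= lx]]] := @dconnected_cut J (pred1 x) x j cJ xJ jJ.
  by rewrite /= eqxx.
rewrite dadjE => H; exists l => //.
by have := ltn_ord l; have := ltn_ord x; move: lx H; rewrite -val_eqE /=; lia.
Qed.

Lemma spin_cases i : [\/ (i <= p)%N, i = spin0 p | i = spin1 p].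
Proof.
case: (ltngtP i p.+1) => [ip|ip|ip]; first by constructor 1; move: ip; rewrite ltnS.
  constructor 3; apply: val_inj => /=; have := ltn_ord i; lia.
by constructor 2; apply: val_inj => /=; rewrite spin0E.
Qed.

(** The cases are that J omits the last spin node, contains it but not the other, or contains both.
    The second is an image under [taun], so that it inherits its longest element from the first. *)
Variant shape J : Prop :=
| ShapeA a b of (a <= b)%N & (b < p.+2)%N & J = nodesA p a b
| ShapeA' a of (a <= p.+1)%N & J = (@taun p) @: nodesA p a p.+1
| ShapeD a of (a <= p)%N & J = nodesD p a.

Lemma dconnectedP J : dconnected J -> shape J.
Proof.
move=> cJ; have [/set0Pn [j0 j0J] _] := andP cJ.
have [i iJ imin] : exists2 i, i \in J & forall j, j \in J -> (i <= j)%N.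
  by case: (arg_minnP (P := mem J) val j0J) => i iJ imin; exists i.
have [l lJ lmax] : exists2 l, l \in J & forall j, j \in J -> (j <= l)%N.
  by case: (arg_maxnP (P := mem J) val j0J) => i' iJ' imax; exists i'.
have s0 := spin0E p; have lm := ltn_ord l; have il := imin _ lJ.
have [s1J|s1J] := boolP (spin1 p \in J); last first.
  have lp : (l < p.+2)%N.
    rewrite ltn_neqAle -ltnS lm andbT; apply: contraNneq s1J => e.
    by rewrite (_ : spin1 p = l) //; apply: val_inj.
  apply: (@ShapeA J i l) => //; apply/setP => k; rewrite inE.
  apply/idP/idP => [kJ|/andP[]]; first by rewrite imin // lmax.
  rewrite leq_eqVlt => /orP[/eqP e _|ik]; first by rewrite -(val_inj e).
  rewrite leq_eqVlt => /orP[/eqP e|kl]; first by rewrite (val_inj e).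
  by apply: (dconnected_between cJ iJ lJ) => //; lia.
have between k : (i <= k)%N -> (k <= p)%N -> k \in J.
  rewrite leq_eqVlt => /orP[/eqP e _|ik kp]; first by rewrite -(val_inj e).
  by apply: (dconnected_between cJ iJ s1J) => //; rewrite /=; lia.
have [s0J|s0J] := boolP (spin0 p \in J).
  have [||k kJ kp] := dconnected_spin cJ s0J s1J.
  - by rewrite s0.
  - by rewrite eq_sym spin_neq.
  have ip : (i <= p)%N by have := imin k kJ; rewrite kp.
  apply: (@ShapeD J i) => //; apply/setP => x; rewrite inE.
  apply/idP/idP => [/imin //|ix].
  by case: (spin_cases x) => [xp|->|->] //; apply: between.
(* If J is the last spin node alone, its least element is p+2 while its image under [taun] starts at
   p+1; hence the minimum. *)
have ip : (minn i p.+1 <= p.+1)%N by apply: geq_minr.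
apply: (@ShapeA' J (minn i p.+1)) => //; apply/setP => x.
have -> (A : {set 'I_m}) : (x \in (@taun p) @: A) = (taun x \in A).
  by rewrite -[in LHS](taunK x) (mem_imset _ _ (inv_inj (@taunK p))).
rewrite inE /taun; case: (eqVneq x (spin0 p)) => [->|xs0].
  by rewrite (negbTE s0J) -[nat_of_ord (spin1 p)]/p.+2 ltnn andbF.
case: (eqVneq x (spin1 p)) => [->|xs1].
  by rewrite s1J s0 leqnn andbT.
have xp : (x <= p)%N by case: (spin_cases x) xs0 xs1 => // ->; rewrite eqxx.
apply/idP/idP => [xJ|]; first by rewrite geq_min imin //=; lia.
by move=> /andP[ix _]; apply: between => //; lia.
Qed.

(** With [theta] itself as the map of the certificate, the involution, commutation and nesting laws
    of [w0] follow without cases on the shape of J. *)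
Lemma w0_data_ex J : dconnected J -> exists t, w0_data J t (theta J).
Proof.
move=> /dconnectedP sJ.
suff [t [f D]] : exists t f, w0_data J t f.
  exists t; have [tJ fJ tE] := D; split=> // j jJ; rewrite (theta_dataE D) //.
    exact: fJ.
  exact: tE.
case: sJ => [a b ab bp ->|a ap ->|a ap ->].
- by have [t D] := w0_dataA a bp; exists t, (rev_ord_in a b).
- have [t D] := w0_dataA a (leqnn p.+2).
  by eexists; eexists; apply: w0_data_taun D.
- by have [t D] := w0_dataD ap; eexists; eexists; apply: D.
Qed.

Lemma theta_in J j : dconnected J -> j \in J -> theta J j \in J.
Proof. by move=> /w0_data_ex [t [_ h _]] /h. Qed.

Lemma w0_alpha J j : dconnected J -> j \in J -> w0 J (alpha j) = - alpha (theta J j).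
Proof. by move=> /w0_data_ex [t D] jJ; rewrite (w0_dataE D); case: D => _ _ ->. Qed.

Lemma thetaK J j : dconnected J -> j \in J -> theta J (theta J j) = j.
Proof.
move=> /w0_data_ex [t D] jJ; have [tJ fJ tE] := D; apply: alpha_inj.
apply: oppr_inj; rewrite -tE ?fJ // -[alpha (theta J j)]opprK -tE // wactN.
rewrite -wact_cat; congr (- _); apply: (@wact_pos_id _ J) => [x|k kJ].
  by rewrite mem_cat => /orP[]; apply: tJ.
by rewrite wact_cat !(tE, wactN, opprK) ?fJ // ht_alpha.
Qed.

Lemma w0K J v : dconnected J -> w0 J (w0 J v) = v.
Proof.
move=> cJ; have [t D] := w0_data_ex cJ; have [tJ fJ tE] := D.
rewrite !(w0_dataE D) -wact_cat; apply: (@wact_pos_id _ J) => [x|k kJ].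
  by rewrite mem_cat => /orP[]; apply: tJ.
by rewrite wact_cat !(tE, wactN, opprK) ?fJ // ht_alpha.
Qed.

Lemma srefl_comm i j v : i != j -> ~~ dadj i j -> srefl i (srefl j v) = srefl j (srefl i v).
Proof.
move=> ij; rewrite dadjE => nij.
have d : dot (alpha i) (alpha j) = 0.
  rewrite dot_alpha !alphaE /sg /lastn; move: ij nij; rewrite -!val_eqE /=.
  have := ltn_ord i; have := ltn_ord j; move: (val i) (val j) => /= {}i {}j im jm ij nij.
  by do 6!(case: eqP => ? /=); lia.
have sE l w : srefl l w = w - dot w (alpha l) *: alpha l by [].
rewrite !sE !dotBl !dotZl d [dot (alpha j) _]dotC d !mulr0 !subr0.
by rewrite addrAC.
Qed.

Lemma wact_comm s t v :
  (forall i j, i \in s -> j \in t -> i != j /\ ~~ dadj i j) ->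
  wact s (wact t v) = wact t (wact s v).
Proof.
elim: s v => // i s IH v H; rewrite wact_cons IH; last first.
  by move=> a b sa tb; apply: H; rewrite // inE sa orbT.
have {}H j : j \in t -> i != j /\ ~~ dadj i j by move=> jt; apply: H; rewrite // mem_head.
rewrite wact_cons; elim: t (wact s v) H {IH} => // j t IH w H; rewrite !wact_cons.
have [ij nij] := H j (mem_head _ _); rewrite srefl_comm // IH // => k kt.
by apply: H; rewrite inE kt orbT.
Qed.

Lemma w0_comm J K v : dconnected J -> dconnected K -> [disjoint J & K] ->
  (forall j k, j \in J -> k \in K -> ~~ dadj j k) -> w0 J (w0 K v) = w0 K (w0 J v).
Proof.
move=> /w0_data_ex [s Ds] /w0_data_ex [t Dt] dis nadj.
rewrite !(w0_dataE Ds) !(w0_dataE Dt); apply: wact_comm => i j si tj.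
have [sJ _ _] := Ds; have [tK _ _] := Dt.
split; last by apply: nadj; [apply: sJ|apply: tK].
apply/eqP => ij; move/pred0P: dis => /(_ i) /=.
by rewrite (sJ _ si) ij (tK _ tj).
Qed.

(** Conjugation by w_{0,K} turns the reflection in alpha_i into the reflection in -alpha_{theta_K
    i}, which is s_{theta_K i}. *)
Lemma wact_map_theta K s v : dconnected K -> {subset s <= K} ->
  wact [seq theta K i | i <- s] v = w0 K (wact s (w0 K v)).
Proof.
move=> cK; have [t D] := w0_data_ex cK; have [tJ fJ tE] := D.
elim: s => [|i s IH] sK; first by rewrite /= w0K.
have iK : i \in K by apply: sK; rewrite mem_head.
rewrite map_cons wact_cons IH; last by move=> x xs; apply: sK; rewrite inE xs orbT.
rewrite wact_cons; set w := wact s _; rewrite !(w0_dataE D) wact_srefl tE //.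
by rewrite dotNr scalerN scaleNr opprK.
Qed.

(** A certificate for L conjugated by w_{0,K} is one for J. As certificates determine [w0] and
    [theta], both halves of the nesting relation follow. *)
Lemma w0_data_conj J K L : dconnected K -> dconnected J -> dconnected L ->
  J \subset K -> L = theta K @: J ->
  exists2 t, w0_data J t (theta K \o theta L \o theta K) &
    forall v, wact t v = w0 K (w0 L (w0 K v)).
Proof.
move=> cK cJ cL /subsetP JK LE; have [s D] := w0_data_ex cL; have [sL fL sE] := D.
have LK l : l \in L -> l \in K.
  by rewrite LE => /imsetP[j jJ ->]; apply: theta_in => //; apply: JK.
have back l : l \in L -> theta K l \in J.
  by rewrite LE => /imsetP[j jJ ->]; rewrite thetaK // JK.
have to j : j \in J -> theta K j \in L by move=> jJ; rewrite LE imset_f.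
have tE v : wact [seq theta K i | i <- s] v = w0 K (w0 L (w0 K v)).
  by rewrite wact_map_theta // => [|x /sL/LK //]; rewrite -(w0_dataE D).
exists [seq theta K i | i <- s] => //; split=> [x /mapP[l /sL lL ->]|j jJ|j jJ].
- exact: back.
- by apply: back; apply: fL; apply: to.
rewrite tE w0_alpha ?JK //; have [t D'] := w0_data_ex cK.
rewrite (w0_dataE D) (w0_dataE D') !wactN -(w0_dataE D) -(w0_dataE D').
rewrite w0_alpha ?to // (w0_dataE D') wactN -(w0_dataE D') w0_alpha ?opprK //.
by apply: LK; apply: fL; apply: to.
Qed.

Lemma w0_nest J K L v : dconnected K -> dconnected J -> dconnected L ->
  J \subset K -> L = theta K @: J -> w0 J (w0 K v) = w0 K (w0 L v).
Proof.
move=> cK cJ cL JK LE; have [t D tE] := w0_data_conj cK cJ cL JK LE.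
by rewrite (w0_dataE D) tE w0K.
Qed.

Lemma theta_nest J K L j : dconnected K -> dconnected J -> dconnected L ->
  J \subset K -> L = theta K @: J -> j \in J ->
  theta J j = theta K (theta L (theta K j)).
Proof.
move=> cK cJ cL JK LE jJ; have [t D tE] := w0_data_conj cK cJ cL JK LE.
by rewrite (theta_dataE D).
Qed.

(* The node j moves the multiplicity with index lo j; the two spin nodes share
   theirs. *)
Definition pi J k : 'I_m :=
  if [pick j in J | lo j == k] is Some j then lo (theta J j) else k.

(** This makes [pi] independent of the node picked. Distinct nodes share their index only if they
    are the two spin nodes; J contains both only in the D shape, where theta_J fixes or exchanges
    them. *)
Lemma theta_lo J j l : dconnected J -> j \in J -> l \in J -> lo j = lo l ->
  lo (theta J j) = lo (theta J l).
Proof.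
move=> cJ jJ lJ jl; have [->//|ne] := eqVneq j l.
have loE : minn j p.+1 = minn l p.+1 :> nat by have := congr1 val jl.
have jm := ltn_ord j; have lm := ltn_ord l.
have sne : j != l :> nat by [].
case: (dconnectedP cJ) jJ lJ => [a b ab bp JE|a ap JE|a ap JE].
- by rewrite JE !inE; lia.
- rewrite JE => /imsetP[j' + jE] /imsetP[l' + lE]; rewrite !inE.
  move: ne loE; rewrite jE lE (inj_eq (inv_inj (@taunK p))).
  move=> ne; rewrite -[minn _ _]/(val (lo _)) -[RHS]/(val (lo (taun l'))) !lo_taun /=.
  by move: ne; rewrite -val_eqE /=; lia.
- have [t D] := w0_dataD ap; rewrite -JE in D => jJ lJ.
  by rewrite !(theta_dataE D) //; case: ifP => // _; rewrite !lo_taun.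
Qed.

Lemma pi_lo J j : dconnected J -> j \in J -> pi J (lo j) = lo (theta J j).
Proof.
move=> cJ jJ; rewrite /pi; case: pickP => [l /andP[lJ /eqP e]|/(_ j)].
  exact: theta_lo.
by rewrite jJ eqxx.
Qed.

Lemma pi_out J k : k \notin [set lo j | j in J] -> pi J k = k.
Proof.
move=> kJ; rewrite /pi; case: pickP => // j /andP[jJ /eqP e].
by case/imsetP: kJ; exists j.
Qed.

Lemma piK J : dconnected J -> involutive (pi J).
Proof.
move=> cJ k; have [/imsetP[j jJ ->]|kJ] := boolP (k \in [set lo j | j in J]).
  by rewrite !pi_lo ?theta_in // thetaK.
by rewrite !(pi_out kJ).
Qed.

Lemma lo_spins i j : lo i = lo j -> i != j -> (p < i)%N.
Proof. by move=> /(congr1 val) /=; rewrite -val_eqE /=; lia. Qed.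

(** J and K can share an index only if each contains one spin node. Node p is adjacent to both spin
    nodes, so neither J nor K contains it; by connectedness each is then a single node, fixed by
    theta. *)
Lemma pi_comm_in J K j : dconnected J -> dconnected K -> [disjoint J & K] ->
  (forall j k, j \in J -> k \in K -> ~~ dadj j k) -> j \in J ->
  pi J (pi K (lo j)) = pi K (pi J (lo j)).
Proof.
move=> cJ cK dis nadj jJ.
have [/imsetP[k kK e]|jK] := boolP (lo j \in [set lo j | j in K]); last first.
  rewrite (pi_out jK) pi_lo //.
  have [/imsetP[k kK e]|jK'] := boolP (lo (theta J j) \in [set lo j | j in K]); last by rewrite pi_out.
  have ne : theta J j != k.
    apply/eqP => jk; move/pred0P: dis => /(_ k) /=.
    by rewrite kK -jk theta_in.
  have sp := lo_spins e ne.
  suff e' : theta J j = j by rewrite e' in e; move: jK; rewrite e imset_f.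
  have [->//|jt] := eqVneq (theta J j) j.
  have [|l lJ lp] := dconnected_spin cJ (theta_in cJ jJ) jJ sp; first by rewrite eq_sym.
  have := nadj _ _ lJ kK; rewrite dadjE lp.
  have /(congr1 val) /= := e; have := ltn_ord k.
  by move: ne; rewrite -val_eqE /=; have := ltn_ord (theta J j); lia.
have ne : j != k.
  by apply/eqP => jk; move/pred0P: dis => /(_ k) /=; rewrite kK -jk jJ.
have sp := lo_spins e ne; have sp' : (p < k)%N.
  by apply: (@lo_spins k j); rewrite // eq_sym.
have tJ : theta J j = j.
  have [->//|jt] := eqVneq (theta J j) j.
  have [|l lJ lp] := dconnected_spin cJ jJ (theta_in cJ jJ) sp; first by [].
  have := nadj _ _ lJ kK; rewrite dadjE lp.
  by move: ne; rewrite -val_eqE /=; have := ltn_ord j; have := ltn_ord k; lia.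
have tK : theta K k = k.
  have [->//|jt] := eqVneq (theta K k) k.
  have [|l lK lp] := dconnected_spin cK kK (theta_in cK kK) sp'; first by [].
  have := nadj _ _ jJ lK; rewrite dadjE lp.
  by move: ne; rewrite -val_eqE /=; have := ltn_ord j; have := ltn_ord k; lia.
by rewrite (pi_lo cJ jJ) tJ e (pi_lo cK kK) tK -e (pi_lo cJ jJ) tJ.
Qed.

Lemma pi_comm J K k : dconnected J -> dconnected K -> [disjoint J & K] ->
  (forall j k, j \in J -> k \in K -> ~~ dadj j k) -> pi J (pi K k) = pi K (pi J k).
Proof.
move=> cJ cK dis nadj.
have [/imsetP[j jJ ->]|kJ] := boolP (k \in [set lo j | j in J]).
  exact: pi_comm_in.
have [/imsetP[j jK ->]|kK] := boolP (k \in [set lo j | j in K]).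
  symmetry; apply: pi_comm_in => //; first by rewrite disjoint_sym.
  by move=> a b aK bJ; rewrite /dadj orbC; apply: nadj.
by rewrite !(pi_out kJ, pi_out kK).
Qed.

Lemma pi_nest J K L k : dconnected K -> dconnected J -> dconnected L ->
  J \subset K -> L = theta K @: J -> pi L (pi K k) = pi K (pi J k).
Proof.
move=> cK cJ cL JK LE; have JK' := subsetP JK.
have to j : j \in J -> theta K j \in L by move=> jJ; rewrite LE imset_f.
have [/imsetP[j jJ ->]|kJ] := boolP (k \in [set lo j | j in J]).
  have inK x : x \in L -> x \in K.
    by rewrite LE => /imsetP[y yJ ->]; rewrite theta_in ?JK'.
  rewrite (pi_lo cK (JK' _ jJ)) (pi_lo cL (to _ jJ)) (pi_lo cJ jJ).
  rewrite (pi_lo cK) ?JK' ?theta_in // (theta_nest cK cJ cL JK LE jJ) thetaK //.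
  by apply: inK; rewrite theta_in ?to.
rewrite (pi_out kJ).
have [/imsetP[l lK kE]|kK] := boolP (k \in [set lo j | j in K]); last first.
  rewrite !(pi_out kK) pi_out //; apply: contra kK => /imsetP[x xL ->].
  by apply: imset_f; move: xL; rewrite LE => /imsetP[j jJ ->]; rewrite theta_in ?JK'.
rewrite kE (pi_lo cK lK) pi_out //; apply: contra kJ.
rewrite LE => /imsetP[_ /imsetP[j jJ ->] e].
apply/imsetP; exists j => //; rewrite kE.
by have := theta_lo cK (theta_in cK lK) (theta_in cK (JK' _ jJ)) e; rewrite (thetaK cK lK) (thetaK cK (JK' _ jJ)).
Qed.

End Connected.

(** * Rows as pairs of a weight and multiplicities *)

Section Rows.
Variable p : nat.
Local Notation m := p.+3.
Implicit Types (i j k : 'I_m) (x y z : letter m).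

Lemma letter_le_refl x : letter_le x x.
Proof. by case: x => k []; rewrite /= ?leqnn. Qed.

Lemma letter_le_trans : transitive (@letter_le m).
Proof.
move=> [j b] [i a] [k c]; case: a b c => [] [] [] //=; rewrite /lab;
  have := ltn_ord i; have := ltn_ord j; have := ltn_ord k; lia.
Qed.

Lemma letter_le_anti : antisymmetric (@letter_le m).
Proof.
move=> [j []] [i []] //=; rewrite ?andbF // -?eqn_leq => /eqP e; congr (_, _);
  by apply: val_inj.
Qed.

Lemma pairwise_mem (T : eqType) (r : rel T) (s : seq T) (x y : T) :
  pairwise r s -> x \in s -> y \in s -> [\/ x = y, r x y | r y x].
Proof.
elim: s => //= z s IH /andP[/allP zs ps]; rewrite !inE.
case/orP=> [/eqP->|xs] /orP[/eqP->|ys]; first by constructor 1.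
- by constructor 2; apply: zs.
- by constructor 3; apply: zs.
- exact: IH.
Qed.

Lemma sum_cnt_seq (T : finType) (F : T -> nat) (s : seq T) :
  \sum_(x <- s) F x = \sum_x count_mem x s * F x.
Proof.
elim: s => [|y s IH]; first by rewrite big_nil big1.
rewrite big_cons IH; under [RHS]eq_bigr do rewrite /= mulnDl.
rewrite big_split; congr (_ + _).
rewrite (bigD1 y) //= eqxx mul1n big1 ?addn0 // => x.
by rewrite eq_sym => /negbTE->.
Qed.

Section OneRow.
Variable n : nat.
Implicit Type b : row m n.

Definition cnt b x : nat := count_mem x (val b).

Definition mult b k : nat := minn (cnt b (k, false)) (cnt b (k, true)).

Lemma row_pairwise b : pairwise (@letter_le m) (val b).
Proof. by have := valP b; rewrite sorted_pairwise //; apply: letter_le_trans. Qed.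

Lemma cnt_inj b b' : (forall x, cnt b x = cnt b' x) -> b = b'.
Proof.
move=> e; apply/val_inj/val_inj.
apply: (sorted_eq letter_le_trans letter_le_anti (valP b) (valP b')).
by apply/allP => x _ /=; apply/eqP; apply: e.
Qed.

Lemma wt_cnt b k : wt b 0%R k = ((cnt b (k, false))%:Z - (cnt b (k, true))%:Z)%R.
Proof.
rewrite /wt /cnt; elim: (tval _) => [|[j s] l IH].
  by rewrite big_nil mxE.
rewrite big_cons mxE IH /= /letter_wt /= !xpair_eqE /eps /lab.
have -> : (j == k) = (k == j) by rewrite eq_sym.
by case: s; rewrite !mxE /lab eqSS -[k == j :> nat]/(k == j); case: (k == j) => /=; lia.
Qed.

(** Of a letter and its bar, the rarer occurs mu_k times and the other exceeds it by |v_k|, so the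
    coordinates give back all counts. *)
Lemma cnt_state b k s :
  cnt b (k, s) = mult b k + absz (Num.max 0 (if s then - wt b 0 k else wt b 0 k))%R.
Proof. by rewrite wt_cnt /mult; case: s; lia. Qed.

Lemma state_inj b b' : wt b = wt b' -> mult b =1 mult b' -> b = b'.
Proof. by move=> ew eM; apply: cnt_inj => -[k s]; rewrite !cnt_state ew eM. Qed.

Lemma cnt_gt0 b x : (0 < cnt b x) = (x \in val b).
Proof. by rewrite /cnt -has_count has_pred1. Qed.

Lemma row_comparable b x y : x \in val b -> y \in val b -> letter_le x y || letter_le y x.
Proof.
by move=> xb yb; case: (pairwise_mem (row_pairwise b) xb yb) => [->|->|->];
  rewrite ?letter_le_refl ?orbT.
Qed.

Lemma cnt_spin1 b : cnt b (spin1 p, false) = 0 \/ cnt b (spin1 p, true) = 0.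
Proof.
case: (posnP (cnt b (spin1 p, false))) => [|c1]; first by left.
case: (posnP (cnt b (spin1 p, true))) => [|c2]; first by right.
by have := @row_comparable b _ _ (etrans (esym (cnt_gt0 _ _)) c1)
  (etrans (esym (cnt_gt0 _ _)) c2); rewrite /= /lab eqxx.
Qed.

Lemma mult_spin1 b : mult b (spin1 p) = 0.
Proof. by rewrite /mult; case: (cnt_spin1 b) => ->; rewrite ?min0n ?minn0. Qed.

Lemma sum_letters (F : letter m -> nat) :
  \sum_x F x = \sum_k (F (k, false) + F (k, true)).
Proof.
transitivity (\sum_k \sum_s F (k, s)); first by rewrite pair_bigA; apply: eq_bigr => -[].
by apply: eq_bigr => k _; rewrite big_bool addnC.
Qed.

Lemma sum_cnt b : \sum_x cnt b x = n.
Proof.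
rewrite -[RHS](size_tuple (val b)) -sum1_size [RHS]sum_cnt_seq.
by apply: eq_bigr => x _; rewrite muln1.
Qed.

Lemma row_length b : \sum_k (absz (wt b 0 k)%R + (mult b k).*2) = n.
Proof.
rewrite -[RHS](sum_cnt b) sum_letters.
by apply: eq_bigr => k _; rewrite wt_cnt /mult -addnn; move: (cnt _ _) (cnt _ _) => a c; lia.
Qed.

Lemma row_of_cnt (c : letter m -> nat) :
  c (spin1 p, false) = 0 \/ c (spin1 p, true) = 0 -> \sum_x c x = n ->
  exists b, forall x, cnt b x = c x.
Proof.
(* [letter_le] is not total and cannot be used for sorting. [rk] is a linear extension that puts m
   before its bar; by [c0] these two never both occur, so the sorted word is a row. *)
move=> c0 cn; pose rk x := if x.2 then m.*2 - x.1 else x.1 : nat.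
pose s := sort (fun x y => rk x <= rk y) (flatten [seq nseq (c x) x | x <- enum {: letter m}]).
have cs y : count_mem y s = c y.
  rewrite count_sort count_flatten -map_comp sumnE big_map big_enum /=.
  rewrite (bigD1 y) //= count_nseq /= eqxx mul1n big1 ?addn0 // => x /negbTE xy.
  by rewrite count_nseq /= xy.
have ss : sorted (@letter_le m) s.
  apply: (@sub_in_sorted _ (mem s) (fun x y => rk x <= rk y)); last first.
  - by apply: sort_sorted => x y; apply: leq_total.
  - by apply/allP.
  have inS x : x \in s -> 0 < c x by rewrite -cs -has_count has_pred1.
  move=> [i []] [j []] /inS ci /inS cj; rewrite /rk /= /lab;
    have := ltn_ord i; have := ltn_ord j; try lia.
  move=> jm im _; apply/negP => /andP[/eqP im' /eqP jm'].
  have ei : i = spin1 p by apply: val_inj => /=; lia.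
  have ej : j = spin1 p by apply: val_inj => /=; lia.
  by move: ci cj; rewrite ei ej; case: c0 => ->.
have sn : size s == n.
  rewrite -cn -sum1_size; apply/eqP; rewrite [LHS]sum_cnt_seq.
  by apply: eq_bigr => x _; rewrite muln1 cs.
by exists (Sub (Tuple sn) ss : row m n) => x; apply: cs.
Qed.

Lemma row_of_state (v : 'rV[int]_m) (M : 'I_m -> nat) :
  M (spin1 p) = 0 -> \sum_k (absz (v 0 k)%R + (M k).*2) = n ->
  exists b, wt b = v /\ mult b =1 M.
Proof.
move=> M0 vn.
pose c x := M x.1 + absz (Num.max 0 (if x.2 then - v 0 x.1 else v 0 x.1))%R.
have [||b cb] := @row_of_cnt c.
- by rewrite /c /= M0; lia.
- by rewrite sum_letters -vn; apply: eq_bigr => k _; rewrite /c /=; lia.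
exists b; split=> [|k]; last by rewrite /mult !cb /c /=; lia.
by apply/rowP => k; rewrite wt_cnt !cb /c /=; lia.
Qed.

End OneRow.
End Rows.

(** * The signature rule *)

Section Signature.
Variable p : nat.
Local Notation m := p.+3.
Implicit Types (i : 'I_m) (x y z : letter m).

(* The arrows of f_i on letters are l1 -> l2 and l3 -> l4; in a row, the letters
   l1 precede the others and the letters l4 come last. *)
Definition l1 i : letter m := (lo i, false).
Definition l2 i : letter m := (hi i, lastn i).
Definition l3 i : letter m := (hi i, ~~ lastn i).
Definition l4 i : letter m := (lo i, true).

Lemma letter_arrowE i x y :
  letter_arrow i x y = (x == l1 i) && (y == l2 i) || (x == l3 i) && (y == l4 i).
Proof.
case: x y => [a s] [c t]; rewrite /letter_arrow /l1 /l2 /l3 /l4 !xpair_eqE -!val_eqE /=.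
rewrite /lab /lastn /=; have := ltn_ord i; have := ltn_ord a; have := ltn_ord c.
by case: s t => [] [] /=; case: ifP; lia.
Qed.

Lemma letters_neq i : [/\ (l1 i == l2 i) = false, (l1 i == l3 i) = false,
  (l1 i == l4 i) = false, (l2 i == l3 i) = false & (l2 i == l4 i) = false /\ (l3 i == l4 i) = false].
Proof.
by rewrite /l1 /l2 /l3 /l4 !xpair_eqE -!val_eqE /=; case: (lastn i) => /=; do !split; lia.
Qed.

Lemma fletterE i x : fletter i x =
  if x == l1 i then Some (l2 i) else if x == l3 i then Some (l4 i) else None.
Proof.
have [_ n13 _ _ _] := letters_neq i.
rewrite /fletter; case: pickP => [y|no] /=.
  rewrite letter_arrowE => /orP[] /andP[/eqP -> /eqP->]; first by rewrite eqxx.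
  by rewrite eq_sym n13 eqxx.
case: eqP => [e|_]; first by have := no (l2 i); rewrite letter_arrowE e !eqxx.
case: eqP => [e|//]; by have := no (l4 i); rewrite letter_arrowE e !eqxx orbT.
Qed.

Lemma eletterE i x : eletter i x =
  if x == l2 i then Some (l1 i) else if x == l4 i then Some (l3 i) else None.
Proof.
have [_ _ _ _ [n24 _]] := letters_neq i.
rewrite /eletter; case: pickP => [y|no] /=.
  rewrite letter_arrowE => /orP[] /andP[/eqP -> /eqP->]; first by rewrite eqxx.
  by rewrite eq_sym n24 eqxx.
case: eqP => [e|_]; first by have := no (l1 i); rewrite letter_arrowE e !eqxx.
case: eqP => [e|//]; by have := no (l3 i); rewrite letter_arrowE e !eqxx orbT.
Qed.

Lemma letters_order i : [/\ letter_le (l2 i) (l1 i) = false, letter_le (l3 i) (l1 i) = false,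
  letter_le (l4 i) (l1 i) = false, letter_le (l3 i) (l2 i) = false &
  letter_le (l4 i) (l2 i) = false /\ letter_le (l4 i) (l3 i) = false].
Proof.
rewrite /l1 /l2 /l3 /l4 /lastn; case: eqP => e; do !split => //=; rewrite /lab /= ?e; lia.
Qed.

Section OneNode.
Variables (n : nat) (i : 'I_m) (b : row m n).
Implicit Types (k : 'I_n) (l : seq 'I_n).

Let t (k : 'I_n) : letter m := tnth (val b) k.
Let c x l := count (fun k => t k == x) l.
Let st l := foldl (sig_step i b) [::] l.

Lemma sig_stepE s k : sig_step i b s k =
  if (t k == l1 i) || (t k == l3 i) then
    if s is (_, false) :: s' then s' else (k, true) :: s
  else if (t k == l2 i) || (t k == l4 i) then (k, false) :: s else s.
Proof.
rewrite /sig_step fletterE eletterE -/(t k).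
by case: (t k == l1 i); case: (t k == l3 i) => //; case: (t k == l2 i); case: (t k == l4 i).
Qed.

(** A and P list the positions of the uncancelled minus and plus signs, latest first like the stack.
    In a sorted row each l2 precedes each l3, and only these cancel; l1 and l4 always survive. The
    last two clauses put the letter changed by f_i at the end, and the one changed by e_i at the
    start, of its block of equal letters, so that the row stays sorted. *)
Definition sig_inv l (A P : seq 'I_n) :=
  [/\ st l = [seq (k, false) | k <- A] ++ [seq (k, true) | k <- P],
      map t A = nseq (c (l4 i) l) (l4 i) ++ nseq (c (l2 i) l - c (l3 i) l) (l2 i),
      map t P = nseq (c (l3 i) l - c (l2 i) l) (l3 i) ++ nseq (c (l1 i) l) (l1 i),
      (forall k P', P = k :: P' -> exists s1 s2, l = s1 ++ k :: s2 /\ t k \notin map t s2)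
    & (forall k A', A = rcons A' k -> exists s1 s2, l = s1 ++ k :: s2 /\ t k \notin map t s1)].

Lemma notin_count x l : c x l = 0 -> x \notin map t l.
Proof.
move=> cx; apply/mapP => -[k kl xk]; move/eqP: cx; apply/negP; rewrite -lt0n -has_count.
by apply/hasP; exists k => //; rewrite -xk.
Qed.

Lemma count_le0 x y l : all (fun k => letter_le (t k) y) l -> letter_le x y = false -> c x l = 0.
Proof.
move=> /allP al xy; apply/eqP; rewrite -leqn0 leqNgt -has_count; apply/hasP => -[k /al].
by move=> ky /eqP e; rewrite -e ky in xy.
Qed.

Lemma sig_invP l : pairwise (fun j k => letter_le (t j) (t k)) l -> exists A P, sig_inv l A P.
Proof.
have [n12 n13 n14 n23 [n24 n34]] := letters_neq i.
have [o21 o31 o41 o32 [o42 o43]] := letters_order i.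
elim/last_ind: l => [|l k IH]; first by exists [::], [::]; split=> //= k [].
rewrite pairwise_rcons => /andP[al /IH [A [P [sE AE PE Pl Al]]]].
have ck x : c x (rcons l k) = c x l + (t k == x) by rewrite /c -cats1 count_cat /= addn0.
have stk : st (rcons l k) = sig_step i b (st l) k by rewrite /st foldl_rcons.
have Plk : (forall k' P', P = k' :: P' -> t k' != t k) -> forall k' P', P = k' :: P' ->
    exists s1 s2, rcons l k = s1 ++ k' :: s2 /\ t k' \notin map t s2.
  move=> ne k' P' e; have [s1 [s2 [-> ns]]] := Pl _ _ e.
  exists s1, (rcons s2 k); rewrite rcons_cat; split=> //.
  by rewrite map_rcons mem_rcons inE negb_or ns (ne _ _ e).
have Alk k' A' : A = rcons A' k' ->
    exists s1 s2, rcons l k = s1 ++ k' :: s2 /\ t k' \notin map t s1.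
  by move=> /Al [s1 [s2 [-> ns]]]; exists s1, (rcons s2 k); rewrite rcons_cat.
have Pt k' P' : P = k' :: P' -> t k' = l3 i \/ t k' = l1 i.
  move=> e; have : t k' \in map t P by rewrite e /= mem_head.
  by rewrite PE mem_cat !mem_nseq => /orP[] /andP[_ /eqP->]; [left|right].
rewrite /sig_inv stk sig_stepE sE.
have [tk|k1] := eqVneq (t k) (l1 i).
  rewrite tk in al.
  have c2 := count_le0 al o21; have c3 := count_le0 al o31; have c4 := count_le0 al o41.
  have A0 : A = [::] by apply/nilP; rewrite /nilp -(size_map t) AE c2 c4.
  exists [::], (k :: P); rewrite !ck tk eqxx n12 n13 n14 A0 c2 c3 c4 /=; split=> //.
  - by case: {sE PE Pl Plk Pt} P.
  - by rewrite PE c3 c2 addn1 /= tk.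
  - by move=> k' P' [-> _]; exists l, [::]; rewrite cats1.
  - by move=> k' [].
have [tk|k3] := eqVneq (t k) (l3 i).
  rewrite tk in al; have c4 := count_le0 al o43.
  rewrite !ck tk eqxx n34 [l3 i == l1 i]eq_sym n13 [l3 i == l2 i]eq_sym n23 !addn0 addn1.
  (* With more l2 than l3 read so far, the top of the stack is the minus of an l2, which the new
     plus cancels; otherwise the plus is pushed. *)
  have [c32|c23] := ltnP (c (l3 i) l) (c (l2 i) l).
    move: AE; rewrite c4 /= -(subnSK c32).
    case: A sE Al Alk => // a A sE Al Alk [_ AE].
    have e3 : c (l3 i) l - c (l2 i) l = 0 by apply/eqP; rewrite subn_eq0 ltnW.
    have e3' : (c (l3 i) l).+1 - c (l2 i) l = 0 by apply/eqP; rewrite subn_eq0.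
    exists A, P; split.
    - by [].
    - by rewrite AE.
    - by rewrite PE e3 e3'.
    - apply: Plk => k' P' e; rewrite tk.
      have : t k' \in map t P by rewrite e /= mem_head.
      by rewrite PE e3 mem_nseq => /andP[_ /eqP->]; rewrite n13.
    by move=> k' A' e; apply: (Alk k' (a :: A')); rewrite e.
  have A0 : A = [::].
    by apply/nilP; rewrite /nilp -(size_map t) AE c4 /= size_nseq subn_eq0.
  exists [::], (k :: P); rewrite A0 c4 /=; split=> //.
  - by case: {sE PE Pl Plk Pt} P.
  - by move: c23; rewrite -subn_eq0 => /eqP e; rewrite subnS e.
  - by rewrite PE tk subSn.
  - by move=> k' P' [-> _]; exists l, [::]; rewrite cats1.
  - by move=> k' [].
have [tk|k2] := eqVneq (t k) (l2 i).
  rewrite tk in al; have c4 := count_le0 al o42; have c3 := count_le0 al o32.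
  rewrite !ck tk eqxx [l2 i == l1 i]eq_sym n12 n23 n24 !addn0 addn1 c4 c3 !subn0 sub0n /=.
  exists (k :: A), P; split=> //.
  - by rewrite /= AE c4 c3 subn0 tk.
  - by rewrite PE c3.
  - apply: Plk => k' P' e; rewrite tk; have : t k' \in map t P by rewrite e /= mem_head.
    by rewrite PE c3 mem_nseq => /andP[_ /eqP->]; rewrite n12.
  move=> k' A'; case: A' => [|a A'] /=; last by move=> [_ /Alk].
  move=> [<- A0]; exists l, [::]; rewrite cats1; split=> //; rewrite tk.
  apply: notin_count; have := congr1 size AE; rewrite A0 c4 c3 /= size_nseq subn0 => <- //.
have [tk|k4] := eqVneq (t k) (l4 i).
  rewrite !ck tk eqxx [l4 i == l1 i]eq_sym n14 [l4 i == l2 i]eq_sym n24 [l4 i == l3 i]eq_sym n34.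
  rewrite !addn0 addn1 /=.
  exists (k :: A), P; split=> //.
  - by rewrite /= AE tk.
  - apply: Plk => k' P' /Pt [->|->]; rewrite tk ?n14 ?n34 //.
  move=> k' A'; case: A' => [|a A'] /=; last by move=> [_ /Alk].
  move=> [<- A0]; exists l, [::]; rewrite cats1; split=> //; rewrite tk.
  apply: notin_count; have := congr1 size AE; by rewrite A0 size_cat !size_nseq => /esym/eqP; rewrite addn_eq0 => /andP[/eqP].
exists A, P; rewrite !ck (negbTE k1) (negbTE k2) (negbTE k3) (negbTE k4) !addn0 /=; split=> //.
by apply: Plk => k' P' /Pt [->|->]; rewrite eq_sym.
Qed.

End OneNode.
End Signature.

(** * Crystal operators in terms of letter counts *)

Section Arrows.
Variable p : nat.
Local Notation m := p.+3.
Implicit Types (i : 'I_m) (x y z : letter m).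

(** These bounds keep a row sorted when its last l1 or l3 is raised, or its first l2 or l4 lowered.
    The exceptions for l3 and l2 come from the spin nodes, where these are the incomparable m and
    its bar. *)
Lemma letters_next i z : [/\
  letter_le (l1 i) z -> z != l1 i -> z != l3 i -> letter_le (l2 i) z,
  letter_le (l3 i) z -> z != l3 i -> letter_le (l4 i) z,
  letter_le z (l2 i) -> z != l2 i -> letter_le z (l1 i) &
  letter_le z (l4 i) -> z != l4 i -> z != l2 i -> letter_le z (l3 i)].
Proof.
case: z => q s; rewrite /l1 /l2 /l3 /l4; have := ltn_ord q; have := ltn_ord i.
by case: (boolP (lastn i)); rewrite /lastn /= => e; case: s; split;
  rewrite ?xpair_eqE -?val_eqE /= /lab /=; lia.
Qed.

Lemma letters_arrow_le i : letter_le (l1 i) (l2 i) /\ letter_le (l3 i) (l4 i).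
Proof.
have im := ltn_ord i; rewrite /l1 /l2 /l3 /l4 /lastn.
by case: eqP => e; split; rewrite /= /lab /=; lia.
Qed.

Section OneRow.
Variables (n : nat) (i : 'I_m) (b : row m n).
Let t (k : 'I_n) : letter m := tnth (val b) k.
Implicit Types (k : 'I_n) (A P : seq 'I_n).

Lemma row_enum : val b = map t (enum 'I_n) :> seq _.
Proof. exact: esym (map_tnth_enum (val b)). Qed.

Lemma mem_row_enum z : (z \in val b) = (z \in map t (enum 'I_n)).
Proof. by rewrite -row_enum. Qed.

Lemma cnt_enum x : count (fun k => t k == x) (enum 'I_n) = cnt b x.
Proof. by rewrite /cnt row_enum [in RHS]count_map; apply: eq_count. Qed.

Lemma enum_pairwise : pairwise (fun j k => letter_le (t j) (t k)) (enum 'I_n).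
Proof. by have := row_pairwise b; rewrite row_enum pairwise_map. Qed.

Lemma rightmost_plusE A P : sig_inv i b (enum 'I_n) A P -> rightmost_plus i b = ohead P.
Proof.
case=> e _ _ _ _; rewrite /rightmost_plus /signature e filter_rev map_rev revK.
rewrite filter_cat map_cat !filter_map.
rewrite (eq_filter (a2 := pred0)) // filter_pred0 /= (eq_filter (a2 := predT)) //.
by rewrite filter_predT -map_comp map_id_in.
Qed.

Lemma leftmost_minusE A P : sig_inv i b (enum 'I_n) A P -> leftmost_minus i b = ohead (rev A).
Proof.
case=> e _ _ _ _; rewrite /leftmost_minus /signature e filter_rev map_rev.
rewrite filter_cat map_cat !filter_map.
rewrite (eq_filter (a2 := predT)) // filter_predT (eq_filter (a2 := pred0)) //.
by rewrite filter_pred0 cats0 -map_comp map_id_in.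
Qed.

Lemma change_letterP g k y s1 s2 : enum 'I_n = s1 ++ k :: s2 -> g (t k) = Some y ->
  {in map t s1, forall z, letter_le z y} -> {in map t s2, forall z, letter_le y z} ->
  exists b', change_letter g b k = Some b' /\
    forall z, cnt b' z + (t k == z) = cnt b z + (y == z).
Proof.
move=> es gk s1y ys2; have := enum_uniq 'I_n; rewrite es cat_uniq /= => /and4P[_ ks1 ks2 _].
have {}ks1 : k \notin s1 by move: ks1; rewrite negb_or => /andP[].
pose w := [tuple (if l == k then y else tnth (val b) l) | l < n].
have wE : w = map t s1 ++ y :: map t s2 :> seq _.
  have -> : w = [seq (if l == k then y else t l) | l <- enum 'I_n] :> seq _ by [].
  rewrite es map_cat /= eqxx; congr (_ ++ _ :: _); apply/eq_in_map => l ls.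
    by case: eqP => // e; rewrite -e ls in ks1.
  by case: eqP => // e; rewrite -e ls in ks2.
have ws : sorted (@letter_le m) w.
  have := row_pairwise b; rewrite row_enum es map_cat sorted_pairwise; last exact: letter_le_trans.
  rewrite wE !pairwise_cat /= !allrel_consr => /and3P[/andP[_ a12] p1 /andP[_ p2]].
  apply/and3P; split; [apply/andP; split | by [] | apply/andP; split] => //.
  - by apply/allP => z /s1y.
  - by apply/allP => z /ys2.
exists (Sub w ws); rewrite /change_letter -/(t k) gk /= -/w; split.
  by rewrite insubT.
move=> z; rewrite /cnt row_enum es /= wE map_cat !count_cat /=.
by rewrite -!addnA; congr (_ + _); rewrite addnC -addnA [RHS]addnCA.
Qed.

(** The rightmost surviving plus belongs to an l3 if l3 is more frequent than l2, so that some l3 is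
    left uncancelled, and to an l1 otherwise. *)
Lemma frow_cnt :
  if frow i b is Some b' then
    exists x y, [\/ [/\ x = l1 i, y = l2 i & cnt b (l3 i) <= cnt b (l2 i)] |
                    [/\ x = l3 i, y = l4 i & cnt b (l2 i) < cnt b (l3 i)]] /\
      forall z, cnt b' z + (x == z) = cnt b z + (y == z)
  else cnt b (l1 i) = 0 /\ cnt b (l3 i) <= cnt b (l2 i).
Proof.
have [_ n13 _ _ [_ _]] := letters_neq i.
have [A [P sP]] := @sig_invP p n i b _ enum_pairwise.
have [_ _ PE Pl _] := sP; rewrite /frow (rightmost_plusE sP) !cnt_enum in PE *.
case: P PE Pl {sP} => [|k P] /= PE Pl.
  have := congr1 size PE; rewrite size_cat !size_nseq /= => /esym/eqP.
  by rewrite addn_eq0 subn_eq0 => /andP[? /eqP].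
have [s1 [s2 [es ns]]] := Pl _ _ erefl.
have kb z : z \in map t s1 \/ z \in map t s2 -> z \in val b.
  by rewrite mem_row_enum es map_cat mem_cat inE => -[] ->; rewrite ?orbT.
have [le1 le2] : {in map t s1, forall z, letter_le z (t k)} /\ {in map t s2, forall z, letter_le (t k) z}.
  have := row_pairwise b; rewrite row_enum es map_cat pairwise_cat /= allrel_consr.
  by move=> /and3P[/andP[/allP ? _] _ /andP[/allP ? _]].
have [a12 a34] := letters_arrow_le i.
have [c32|c23] := leqP (cnt b (l3 i)) (cnt b (l2 i)).
  move: PE; move: (c32); rewrite -subn_eq0 => /eqP -> /=; case c1: (cnt b (l1 i)) => [//|c] [tk' _].
  have {tk'} tk : t k = l1 i := tk'.
  have [|||b' [-> cE]] := @change_letterP (fletter i) k (l2 i) s1 s2 es _ _ _.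
  - by rewrite fletterE -/(t k) tk eqxx.
  - by move=> z /le1; rewrite -/(t k) tk => /letter_le_trans; apply.
  - move=> z zs2; have := le2 z zs2; rewrite -/(t k) tk => lz.
    have zn : z != l1 i by apply: contraNneq ns => e; rewrite -/(t k) tk -e.
    (* An l3 further on does no harm: by [c32] the row then contains l2 as well, and two letters of
       a row are comparable. *)
    have [z3|z3] := eqVneq z (l3 i); last by have [h _ _ _] := letters_next i z; apply: h.
    have b3 : l3 i \in val b by rewrite -z3; apply: kb; right.
    have b2 : l2 i \in val b by rewrite -cnt_gt0; apply: leq_trans c32; rewrite cnt_gt0.
    have [_ _ _ o32 _] := letters_order i.
    by have := row_comparable b2 b3; rewrite o32 orbF z3.
  by exists (l1 i), (l2 i); split; [left|rewrite -tk].
have : 0 < cnt b (l3 i) - cnt b (l2 i) by rewrite subn_gt0.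
move: PE; case: (_ - _) => //= d [tk' _] _.
have {tk'} tk : t k = l3 i := tk'.
have [|||b' [-> cE]] := @change_letterP (fletter i) k (l4 i) s1 s2 es _ _ _.
- by rewrite fletterE -/(t k) tk eq_sym n13 eqxx.
- by move=> z /le1; rewrite -/(t k) tk => /letter_le_trans; apply.
- move=> z zs2; have := le2 z zs2; rewrite -/(t k) tk => lz.
  have zn : z != l3 i by apply: contraNneq ns => e; rewrite -/(t k) tk -e.
  by have [_ h _ _] := letters_next i z; apply: h.
by exists (l3 i), (l4 i); split; [right|rewrite -tk].
Qed.

Lemma erow_cnt :
  if erow i b is Some b' then
    exists x y, [\/ [/\ x = l2 i, y = l1 i & cnt b (l3 i) < cnt b (l2 i)] |
                    [/\ x = l4 i, y = l3 i & cnt b (l2 i) <= cnt b (l3 i)]] /\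
      forall z, cnt b' z + (x == z) = cnt b z + (y == z)
  else cnt b (l4 i) = 0 /\ cnt b (l2 i) <= cnt b (l3 i).
Proof.
have [_ _ _ _ [n24 _]] := letters_neq i.
have [A [P sP]] := @sig_invP p n i b _ enum_pairwise.
have [_ AE _ _ Al] := sP; rewrite /erow (leftmost_minusE sP) !cnt_enum in AE *.
case/lastP: A AE Al {sP} => [|A k] AE Al.
  have := congr1 size AE; rewrite size_cat !size_nseq /= => /esym/eqP.
  by rewrite addn_eq0 subn_eq0 => /andP[/eqP].
rewrite rev_rcons /=; have [s1 [s2 [es ns]]] := Al _ _ erefl.
have kb z : z \in map t s1 \/ z \in map t s2 -> z \in val b.
  by rewrite mem_row_enum es map_cat mem_cat inE => -[] ->; rewrite ?orbT.
have [le1 le2] : {in map t s1, forall z, letter_le z (t k)} /\ {in map t s2, forall z, letter_le (t k) z}.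
  have := row_pairwise b; rewrite row_enum es map_cat pairwise_cat /= allrel_consr.
  by move=> /and3P[/andP[/allP ? _] _ /andP[/allP ? _]].
have [a12 a34] := letters_arrow_le i.
have tk0 : t k = last (t k) (map t (rcons A k)) by rewrite map_rcons last_rcons.
have last_nseq (x y : letter m) d : last y (nseq d x) = if d is 0 then y else x.
  by elim: d y => // d IH y /=; rewrite IH; case: d {IH}.
rewrite AE last_cat !last_nseq in tk0.
have [c23|c32] := leqP (cnt b (l2 i)) (cnt b (l3 i)).
  have c230 : cnt b (l2 i) - cnt b (l3 i) = 0 by apply/eqP; rewrite subn_eq0.
  have tk : t k = l4 i.
    move: tk0 (congr1 size AE); rewrite c230 size_map size_rcons size_cat !size_nseq addn0.
    by case: (cnt b (l4 i)).
  have [|||b' [-> cE]] := @change_letterP (eletter i) k (l3 i) s1 s2 es _ _ _.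
  - by rewrite eletterE -/(t k) tk eq_sym n24 eqxx.
  - move=> z zs1; have := le1 z zs1; rewrite -/(t k) tk => lz.
    have zn : z != l4 i by apply: contraNneq ns => e; rewrite -/(t k) tk -e.
    have [z2|z2] := eqVneq z (l2 i); last by have [_ _ _ h] := letters_next i z; apply: h.
    have b2 : l2 i \in val b by rewrite -z2; apply: kb; left.
    have b3 : l3 i \in val b by rewrite -cnt_gt0; apply: leq_trans c23; rewrite cnt_gt0.
    have [_ _ _ o32 _] := letters_order i.
    by have := row_comparable b2 b3; rewrite o32 orbF z2.
  - by move=> z /le2; rewrite -/(t k) tk; apply: letter_le_trans.
  by exists (l4 i), (l3 i); split; [right|rewrite -tk].
have tk : t k = l2 i by have := subn_gt0 (cnt b (l3 i)) (cnt b (l2 i)); move: tk0; rewrite c32; case: (_ - _).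
have [|||b' [-> cE]] := @change_letterP (eletter i) k (l1 i) s1 s2 es _ _ _.
- by rewrite eletterE -/(t k) tk eqxx.
- move=> z zs1; have := le1 z zs1; rewrite -/(t k) tk => lz.
  have zn : z != l2 i by apply: contraNneq ns => e; rewrite -/(t k) tk -e.
  by have [_ _ h _] := letters_next i z; apply: h.
- by move=> z /le2; rewrite -/(t k) tk; apply: letter_le_trans.
by exists (l2 i), (l1 i); split; [left|rewrite -tk].
Qed.

End OneRow.
End Arrows.

(** * Crystal operators as linear relations *)

Section Steps.
Variables (p n : nat).
Local Notation m := p.+3.
Implicit Types (i k : 'I_m) (x y z : letter m) (b d : row m n).
Local Open Scope nat_scope.

(** This is f_i(b) = d in coordinates. The multiplicity at [lo i] is left out, as the length of the
    row determines it; f_i and e_i become one relation read in both directions. *)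
Definition step i b d :=
  wt b = (wt d + alpha i)%R /\ forall k, k != lo i -> mult b k = mult d k.

Lemma cnt_step i b d x y :
  (x = l1 i /\ y = l2 i \/ x = l3 i /\ y = l4 i) ->
  (forall z, cnt d z + (x == z) = cnt b z + (y == z)) ->
  wt b = (wt d + alpha i)%R.
Proof.
move=> xy H; apply/rowP => k; rewrite !mxE alphaE !wt_cnt.
have := H (k, false); have := H (k, true).
move: (cnt b _) (cnt b _) (cnt d _) (cnt d _) => b1 b2 d1 d2.
rewrite /sg; have := lo_neq_hi i; case: xy => -[-> ->]; rewrite /l1 /l2 /l3 /l4 !xpair_eqE;
  rewrite [lo i == k]eq_sym [hi i == k]eq_sym.
  case: (eqVneq k (lo i)) => [->|_] /=; first by move=> ->; case: (lastn i) => /=; lia.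
  by case: (k == hi i); case: (lastn i) => /=; lia.
case: (eqVneq k (lo i)) => [->|_] /=; first by move=> ->; case: (lastn i) => /=; lia.
by case: (k == hi i); case: (lastn i) => /=; lia.
Qed.

Lemma mult_hi i b : mult b (hi i) = minn (cnt b (l2 i)) (cnt b (l3 i)).
Proof. by rewrite /mult /l2 /l3; case: (lastn i) => //=; rewrite minnC. Qed.

Lemma wt_lo i b : wt b 0%R (lo i) = ((cnt b (l1 i))%:Z - (cnt b (l4 i))%:Z)%R.
Proof. exact: wt_cnt. Qed.

Lemma mult_lo i b : mult b (lo i) = minn (cnt b (l1 i)) (cnt b (l4 i)).
Proof. by []. Qed.

Lemma wt_hi i b : (sg i * wt b 0 (hi i))%R = ((cnt b (l2 i))%:Z - (cnt b (l3 i))%:Z)%R.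
Proof. by rewrite wt_cnt /sg /l2 /l3; case: (lastn i) => /=; rewrite ?mul1r ?mulN1r ?opprB. Qed.

Lemma cnt_off i b d x y k : x \in [:: l1 i; l2 i; l3 i; l4 i] -> y \in [:: l1 i; l2 i; l3 i; l4 i] ->
  (forall z, cnt d z + (x == z) = cnt b z + (y == z)) ->
  k != lo i -> k != hi i -> mult b k = mult d k.
Proof.
move=> xi yi H kl kh; rewrite /mult.
have off s z : z \in [:: l1 i; l2 i; l3 i; l4 i] -> (z == (k, s)) = false.
  rewrite /l1 /l2 /l3 /l4 !inE => zE; apply/negbTE; apply: contraNneq kl => e.
  by move: zE kh; rewrite e !xpair_eqE => /or4P[] /andP[/eqP -> _]; rewrite eqxx.
by have := H (k, false); have := H (k, true); rewrite !(off _ x) // !(off _ y) // !addn0 => -> ->.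
Qed.

Lemma letters_eqE i : (((l1 i == l2 i) = false) *
  ((l1 i == l3 i) = false) *
  ((l1 i == l4 i) = false) *
  ((l2 i == l1 i) = false) *
  ((l2 i == l3 i) = false) *
  ((l2 i == l4 i) = false) *
  ((l3 i == l1 i) = false) *
  ((l3 i == l2 i) = false) *
  ((l3 i == l4 i) = false) *
  ((l4 i == l1 i) = false) *
  ((l4 i == l2 i) = false) *
  ((l4 i == l3 i) = false))%type.
Proof.
have [n12 n13 n14 n23 [n24 n34]] := letters_neq i.
by do !split=> //; rewrite eq_sym.
Qed.

Lemma frow_step i b d : frow i b = Some d -> step i b d.
Proof.
have := frow_cnt i b; case: frow => // d' [x [y [xy H]]] [<-]; split.
  by apply: cnt_step H; case: xy => -[-> -> _]; [left|right].
move=> k kl; have [->|kh] := eqVneq k (hi i); last first.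
  by apply: cnt_off H kl kh; case: xy => -[ex ey _]; rewrite ?ex ?ey !inE eqxx ?orbT.
have := H (l2 i); have := H (l3 i); rewrite !mult_hi.
case: xy => -[-> ->]; rewrite !letters_eqE ?eqxx /=;
  move: (cnt b _) (cnt b _) (cnt d' _) (cnt d' _) => ? ? ? ?; lia.
Qed.

Lemma erow_step i b d : erow i b = Some d -> step i d b.
Proof.
have := erow_cnt i b; case: erow => // d' [x [y [xy H]]] [<-]; split.
  apply: (@cnt_step i d' b y x); first by case: xy => -[-> -> _]; [left|right].
  by move=> z; rewrite H.
move=> k kl; have [->|kh] := eqVneq k (hi i); last first.
  by symmetry; apply: cnt_off H kl kh; case: xy => -[ex ey _]; rewrite ?ex ?ey !inE eqxx ?orbT.
have := H (l2 i); have := H (l3 i); rewrite !mult_hi.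
case: xy => -[-> ->]; rewrite !letters_eqE ?eqxx /=;
  move: (cnt b _) (cnt b _) (cnt d' _) (cnt d' _) => ? ? ? ?; lia.
Qed.

Lemma frow_none i b : frow i b = None ->
  [/\ (wt b 0 (lo i) <= 0)%R, (0 <= sg i * wt b 0 (hi i))%R & mult b (lo i) = 0].
Proof.
have := frow_cnt i b; case: frow => // -[c1 c32] _.
by rewrite wt_hi wt_lo mult_lo c1 min0n; split=> //; lia.
Qed.

Lemma erow_none i b : erow i b = None ->
  [/\ (0 <= wt b 0 (lo i))%R, (sg i * wt b 0 (hi i) <= 0)%R & mult b (lo i) = 0].
Proof.
have := erow_cnt i b; case: erow => // -[c1 c32] _.
by rewrite wt_hi wt_lo mult_lo c1 minn0; split=> //; lia.
Qed.

Lemma row_length_off i b d :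
  (forall k, k != lo i -> k != hi i -> wt b 0%R k = wt d 0%R k) ->
  (forall k, k != lo i -> mult b k = mult d k) ->
  absz (wt b 0%R (lo i)) + absz (wt b 0%R (hi i)) + (mult b (lo i)).*2 =
  absz (wt d 0%R (lo i)) + absz (wt d 0%R (hi i)) + (mult d (lo i)).*2.
Proof.
move=> w u; have lh := lo_neq_hi i.
have := etrans (row_length b) (esym (row_length d)).
rewrite (bigD1 (lo i)) //= (bigD1 (hi i)) ?[hi i == _]eq_sym ?lh //=.
rewrite [in RHS](bigD1 (lo i)) //= [in RHS](bigD1 (hi i)) ?[hi i == _]eq_sym ?lh //=.
under eq_bigr => k /andP[kl kh] do rewrite w // u //.
rewrite (u (hi i)) ?[hi i == _]eq_sym ?lh //.
move: (\sum_(k | _) _) (absz _) (absz _) (absz _) (absz _) (mult _ _) (mult _ _) (mult _ _).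
by move=> *; lia.
Qed.

Lemma step_off i b d k : step i b d -> k != lo i -> k != hi i -> wt b 0%R k = wt d 0%R k.
Proof.
by case=> -> _ /negbTE kl /negbTE kh; rewrite !mxE alphaE kl kh mulr0 subr0.
Qed.

Lemma step_lo i b d : step i b d -> (wt b 0 (lo i) = wt d 0 (lo i) + 1)%R.
Proof. by case=> -> _; rewrite !mxE alphaE lo_neq_hi eqxx mulr0 subr0. Qed.

Lemma step_hi i b d : step i b d -> (wt b 0 (hi i) = wt d 0 (hi i) - sg i)%R.
Proof. by case=> -> _; rewrite !mxE alphaE eq_sym lo_neq_hi eqxx mulr1 sub0r. Qed.

Lemma step_length i b d : step i b d ->
  absz (wt b 0%R (lo i)) + absz (wt b 0%R (hi i)) + (mult b (lo i)).*2 =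
  absz (wt d 0%R (lo i)) + absz (wt d 0%R (hi i)) + (mult d (lo i)).*2.
Proof. by move=> s; apply: row_length_off => [k|]; [apply: step_off|case: s]. Qed.

Lemma step_fun i b d d' : step i b d -> step i b d' -> d = d'.
Proof.
move=> s s'; have wdd : wt d = wt d'.
  by case: s s' => [e _] [e' _]; apply: (addIr (alpha i)); rewrite -e.
apply: state_inj => // k; have [->|kl] := eqVneq k (lo i).
  by have := step_length s; rewrite (step_length s') wdd => /addnI /double_inj.
by case: s s' => [_ e] [_ e']; rewrite -e // e'.
Qed.

Lemma step_inj i b b' d : step i b d -> step i b' d -> b = b'.
Proof.
move=> s s'; have wdd : wt b = wt b' by case: s s' => [-> _] [-> _].
apply: state_inj => // k; have [->|kl] := eqVneq k (lo i).
  by have := step_length s; rewrite -(step_length s') wdd => /addnI /double_inj.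
by case: s s' => [_ e] [_ e']; rewrite e // e'.
Qed.

(** If f_i(b) were 0, the signs in [frow_none] would make both |v_lo| and |v_hi| grow by 1 from b to
    d, while the multiplicity of b at [lo i] is already 0 and cannot compensate: the lengths would
    differ. *)
Lemma frowP i b d : frow i b = Some d <-> step i b d.
Proof.
split=> [|s]; first exact: frow_step.
case e: (frow i b) => [d'|]; first by rewrite (step_fun s (frow_step e)).
have [] := frow_none e; have := step_length s.
rewrite (step_hi s) (step_lo s) /sg.
move: (wt d 0%R (lo i)) (wt d 0%R (hi i)) (mult b (lo i)) (mult d (lo i)) => u v M M'.
by case: (lastn i) => /=; lia.
Qed.

Lemma erowP i b d : erow i b = Some d <-> step i d b.
Proof.
split=> [|s]; first exact: erow_step.
case e: (erow i b) => [d'|]; first by rewrite (step_inj s (erow_step e)).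
have [] := erow_none e; have := step_length s.
rewrite (step_hi s) (step_lo s) /sg.
move: (wt b 0%R (lo i)) (wt b 0%R (hi i)) (mult b (lo i)) (mult d (lo i)) => u v M M'.
by case: (lastn i) => /=; lia.
Qed.

End Steps.

(** * Components and the cactus maps *)

Section Components.
Variables (p n : nat).
Local Notation m := p.+3.
Local Open Scope ring_scope.
Implicit Types (i j k : 'I_m) (b d : row m n) (J : {set 'I_m}) (v w y : 'rV[int]_m).

Lemma w0D J u v : dconnected J -> w0 J (u + v) = w0 J u + w0 J v.
Proof. by move=> /w0_data_ex [t D]; rewrite !(w0_dataE D) wactD. Qed.

(** Invariants of a component of the crystal restricted to J. For connected J they determine a
    lowest element ([lowest_uniq]), so equal invariants mean equal components. *)
Definition comp_inv J b d :=
  (forall y, (forall j, j \in J -> dot y (alpha j) = 0) -> dot y (wt b) = dot y (wt d)) /\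
  (forall k, k \notin [set lo j | j in J] -> mult b k = mult d k).

Lemma comp_inv_sym J b d : comp_inv J b d -> comp_inv J d b.
Proof. by case=> h1 h2; split=> [y yJ|k kJ]; [rewrite h1|rewrite h2]. Qed.

Lemma comp_inv_trans J b d e : comp_inv J b d -> comp_inv J d e -> comp_inv J b e.
Proof. by case=> h1 h2 [g1 g2]; split=> [y yJ|k kJ]; [rewrite h1 ?g1|rewrite h2 ?g2]. Qed.

Lemma step_inv J j b d : j \in J -> step j b d -> comp_inv J b d.
Proof.
move=> jJ [e M]; split=> [y yJ|k kJ]; first by rewrite e dotDr yJ // addr0.
by apply: M; apply: contraNneq kJ => ->; apply: imset_f.
Qed.

Lemma component_inv J b d : same_component J b d -> comp_inv J b d.
Proof.
case/connectP => s; elim: s b => [|b' s IH] b /=; first by move=> _ ->.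
case/andP => /exists_inP [j jJ e] es /(IH _ es); apply: comp_inv_trans.
case/orP: e => /eqP/frowP st; first exact: step_inv st.
by apply: comp_inv_sym; apply: step_inv st.
Qed.

Lemma component_sym J : connect_sym (@crystal_edge m n J).
Proof.
apply: sym_connect_sym => b d; rewrite /crystal_edge.
by apply: eq_existsb => j; rewrite orbC.
Qed.

Definition lowest J b := forall j, j \in J -> frow j b = None.

Lemma ht_step j b d : step j b d -> ht (wt d) < ht (wt b).
Proof. by case=> -> _; rewrite /ht dotDr -/(ht (alpha j)) ht_alpha ltrDl. Qed.

Lemma component_lowest J b : exists2 d, same_component J b d & lowest J d.
Proof.
have bb : same_component J b b by apply: connect0.
case: (@Order.TotalTheory.arg_minP _ _ _ b (same_component J b) (fun d => ht (wt d)) bb).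
move=> d bd dmin; exists d => // j jJ.
case e: (frow j d) => [d'|] //; have /frowP st := e.
have bd' : same_component J b d'.
  apply: connect_trans bd (connect1 _).
  by apply/exists_inP; exists j => //; rewrite e eqxx.
by have := lt_le_trans (ht_step st) (dmin _ bd'); rewrite ltxx.
Qed.

Lemma row_length2 a e b d : a != e ->
  (forall k, k != a -> k != e -> wt b 0 k = wt d 0 k) -> mult b =1 mult d ->
  (absz (wt b 0%R a) + absz (wt b 0%R e) = absz (wt d 0%R a) + absz (wt d 0%R e))%N.
Proof.
move=> ae w u; have := etrans (row_length b) (esym (row_length d)).
rewrite (bigD1 a) //= (bigD1 e) 1?eq_sym //=.
rewrite [in RHS](bigD1 a) //= [in RHS](bigD1 e) 1?eq_sym //=.
under eq_bigr => k /andP[ka ke] do rewrite w // u.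
rewrite !u; move: (\sum_(k | _) _)%N (absz _) (absz _) (absz _) (absz _) (mult _ _) (mult _ _).
by move=> *; lia.
Qed.

Lemma dot2 a e v w y : a != e -> (forall k, k != a -> k != e -> v 0 k = w 0 k) ->
  dot y v = dot y w ->
  y 0 a * v 0 a + y 0 e * v 0 e = y 0 a * w 0 a + y 0 e * w 0 e.
Proof.
move=> ae vw; rewrite /dot (bigD1 a) //= (bigD1 e) 1?eq_sym //=.
rewrite [in RHS](bigD1 a) //= [in RHS](bigD1 e) 1?eq_sym //=.
under eq_bigr => k /andP[ka ke] do rewrite vw //.
by rewrite !addrA => /addIr.
Qed.

Lemma comp_inv_off J b d k : comp_inv J b d ->
  (forall j, j \in J -> k != lo j /\ k != hi j) -> wt b 0 k = wt d 0 k.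
Proof.
move=> [h _] kJ; pose y : 'rV[int]_m := \row_l (l == k)%:R.
have yE v : dot y v = v 0 k.
  by rewrite -[RHS](sum_delta (fun l => v 0 l)); apply: eq_bigr => l _; rewrite !mxE mulrC.
rewrite -!yE; apply: h => j jJ; have [/negbTE kl /negbTE kh] := kJ j jJ.
by rewrite yE alphaE kl kh mulr0 subr0.
Qed.

Lemma lowest_mult J b d : comp_inv J b d -> lowest J b -> lowest J d -> mult b =1 mult d.
Proof.
move=> [_ h] lb ld k; have [/imsetP[j jJ ->]|kJ] := boolP (k \in [set lo j | j in J]).
  by have [_ _ ->] := frow_none (lb j jJ); have [_ _ ->] := frow_none (ld j jJ).
exact: h.
Qed.

Lemma lowest_le0 J b j k : lowest J b -> j \in J -> val (lo j) = val k -> wt b 0 k <= 0.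
Proof. by move=> lb jJ /val_inj <-; have [] := frow_none (lb j jJ). Qed.

Lemma lowest_ge0 J b j k : lowest J b -> j \in J -> val (hi j) = val k -> 0 <= sg j * wt b 0 k.
Proof. by move=> lb jJ /val_inj <-; have [] := frow_none (lb j jJ). Qed.

Lemma sg_nlast j : (j <= p.+1)%N -> sg j = 1.
Proof. by move=> jp; rewrite /sg /lastn /=; case: eqP => //; lia. Qed.

(** The lengths equate |v_a| + |v_e|. If v_e is known, so is v_a <= 0; otherwise that sum is -v_a +
    s v_e, and together with v_a + s v_e it determines both. *)
Lemma two_coord_uniq a e b d : a != e ->
  (forall k, k != a -> k != e -> wt b 0 k = wt d 0 k) -> mult b =1 mult d ->
  wt b 0 a <= 0 -> wt d 0 a <= 0 ->
  (wt b 0 e = wt d 0 e \/ exists s, [/\ s * s = 1, 0 <= s * wt b 0 e, 0 <= s * wt d 0 e &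
     wt b 0 a + s * wt b 0 e = wt d 0 a + s * wt d 0 e]) -> b = d.
Proof.
move=> ae off Mb ba da H; have L := row_length2 ae off Mb.
have [ea ee] : wt b 0 a = wt d 0 a /\ wt b 0 e = wt d 0 e.
  case: H => [e1|[s [ss h1 h2 h3]]]; first by move: L; rewrite e1; lia.
  have [s1|s1] : s = 1 \/ s = -1 by nia.
    by move: h1 h2 h3; rewrite s1 !mul1r; lia.
  by move: h1 h2 h3; rewrite s1 !mulN1r; lia.
apply: state_inj => //; apply/rowP => k.
have [->//|ka] := eqVneq k a; have [->//|ke] := eqVneq k e.
exact: off.
Qed.

(** A coordinate inside the chain is nonpositive as the [lo] of one node and nonnegative as the [hi]
    of the previous one, so it vanishes. Only the two end coordinates remain. *)
Lemma lowest_uniqA J a c b d : (a <= c)%N -> (c < p.+2)%N -> J = nodesA p a c ->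
  comp_inv J b d -> lowest J b -> lowest J d -> b = d.
Proof.
move=> ac cp JE bd lb ld.
have am : (a < m)%N by lia.
have cm : (c < m)%N by lia.
have em : (c.+1 < m)%N by lia.
have nodeJ (x : nat) (xm : (x < m)%N) : (a <= x <= c)%N -> Ordinal xm \in J.
  by move=> ?; rewrite JE inE.
have ae : Ordinal am != Ordinal em by rewrite -val_eqE /=; lia.
have off k : k != Ordinal am -> k != Ordinal em -> wt b 0 k = wt d 0 k.
  rewrite -!val_eqE /= => ka ke.
  have [kin|kout] := boolP ((a <= k <= c)%N); last first.
    apply: (comp_inv_off bd) => j; rewrite JE inE -!val_eqE /= => jin.
    by split; lia.
  have km := ltn_ord k; have km1 : (k.-1 < m)%N by lia.
  have kJ : k \in J by rewrite JE inE.
  have k1J : Ordinal km1 \in J by apply: nodeJ; lia.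
  have lok : val (lo k) = val k by rewrite /=; lia.
  have hik : val (hi (Ordinal km1)) = val k by rewrite /=; lia.
  have := lowest_le0 lb kJ lok; have := lowest_le0 ld kJ lok.
  have := lowest_ge0 lb k1J hik; have := lowest_ge0 ld k1J hik.
  by rewrite sg_nlast /= ?mul1r; lia.
have aJ : Ordinal am \in J by apply: nodeJ; lia.
have cJ : Ordinal cm \in J by apply: nodeJ; lia.
have loa : val (lo (Ordinal am)) = val (Ordinal am) by rewrite /=; lia.
have hic : val (hi (Ordinal cm)) = val (Ordinal em) by rewrite /=; lia.
apply: (two_coord_uniq ae off (lowest_mult bd lb ld)).
- exact: lowest_le0 lb aJ loa.
- exact: lowest_le0 ld aJ loa.
right; exists 1; rewrite !mul1r.
have s1 : sg (Ordinal cm) = 1 by rewrite sg_nlast //=; lia.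
split=> //.
- by have := lowest_ge0 lb cJ hic; rewrite s1 mul1r.
- by have := lowest_ge0 ld cJ hic; rewrite s1 mul1r.
(* The all-one vector is orthogonal to every eps_i - eps_{i+1}; its pairing gives the sum of the two
   end coordinates. *)
pose y : 'rV[int]_m := const_mx 1.
have [inv _] := bd; have := @dot2 _ _ _ _ y ae off; rewrite !mxE !mul1r; apply.
apply: inv => j; rewrite JE inE => jin.
by rewrite dot_alpha !mxE sg_nlast ?mul1r ?subrr; lia.
Qed.

Lemma lowest_uniqA' J a b d : (a <= p.+1)%N -> J = (@taun p) @: nodesA p a p.+1 ->
  comp_inv J b d -> lowest J b -> lowest J d -> b = d.
Proof.
move=> ap JE bd lb ld.
have inJ j : (j \in J) = (a <= j <= p)%N || (j == spin1 p).
  rewrite JE -{1}(taunK j) (mem_imset _ _ (inv_inj (@taunK p))) inE /taun.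
  have := spin0E p; case: (eqVneq j (spin0 p)) => [->|j0] s0.
    by rewrite spin_neq s0 /=; lia.
  case: (eqVneq j (spin1 p)) => [->|j1]; first by rewrite s0 orbT; lia.
  by rewrite orbF; case: (spin_cases j) j0 j1 => [jp _ _|->|->]; rewrite ?eqxx //; lia.
have am : (a < m)%N by lia.
have ae : Ordinal am != spin1 p by rewrite -val_eqE /=; lia.
have s1J : spin1 p \in J by rewrite inJ eqxx orbT.
have lospin : val (lo (spin1 p)) = p.+1 by rewrite lo_spin1 /= spin0E.
have node_lo k : (a <= k)%N -> k != spin1 p -> exists2 j, j \in J & val (lo j) = val k.
  case: (spin_cases k) => [kp ak _|-> _ _|->]; last by rewrite eqxx.
    by exists k; [rewrite inJ ak kp|rewrite /=; lia].
  by exists (spin1 p); rewrite // lospin /= spin0E.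
have off k : k != Ordinal am -> k != spin1 p -> wt b 0 k = wt d 0 k.
  move=> ka ke; have [kin|kout] := leqP a k; last first.
    apply: (comp_inv_off bd) => j; rewrite inJ -!val_eqE /= => jin.
    by split; lia.
  have km := ltn_ord k; have km1 : (k.-1 < m)%N by lia.
  have [j jJ jE] := node_lo k kin ke.
  have k1J : Ordinal km1 \in J.
    by rewrite inJ /=; move: ka ke; rewrite -!val_eqE /=; lia.
  have hik : val (hi (Ordinal km1)) = val k.
    by move: ka ke; rewrite -!val_eqE /=; lia.
  have := lowest_le0 lb jJ jE; have := lowest_le0 ld jJ jE.
  have := lowest_ge0 lb k1J hik; have := lowest_ge0 ld k1J hik.
  by rewrite sg_nlast /= ?mul1r; move: ka ke; rewrite -!val_eqE /=; lia.
have [j jJ jE] := node_lo (Ordinal am) (leqnn a) ae.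
apply: (two_coord_uniq ae off (lowest_mult bd lb ld)).
- exact: lowest_le0 lb jJ jE.
- exact: lowest_le0 ld jJ jE.
have his : val (hi (spin1 p)) = val (spin1 p) by rewrite hi_spin1.
right; exists (-1); split=> //.
- by have := lowest_ge0 lb s1J his; rewrite sg_spin1.
- by have := lowest_ge0 ld s1J his; rewrite sg_spin1.
(* The all-one vector with the sign of the last coordinate changed, which makes it orthogonal to
   eps_{m-1} + eps_m. *)
pose y : 'rV[int]_m := \row_k (if k == spin1 p then -1 else 1).
have [inv _] := bd; have := @dot2 _ _ _ _ y ae off; rewrite !mxE eqxx (negbTE ae) !mul1r; apply.
apply: inv => k; rewrite inJ dot_alpha !mxE lo_spin1E hi_spin1E => /orP[kp|/eqP->].
  have -> : (k == spin0 p) = false by rewrite -val_eqE /= spin0E; lia.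
  have -> : (k == spin1 p) = false by rewrite -val_eqE /=; lia.
  by rewrite sg_nlast ?mulr1 ?subrr //; lia.
by rewrite eqxx orbT sg_spin1 mulrNN mulr1 subrr.
Qed.

(** With both spin nodes present the last coordinate too is bounded by 0 from both sides. From a on
    only coordinate a can be nonzero, and its sign and the length fix it. *)
Lemma lowest_uniqD J a b d : (a <= p)%N -> J = nodesD p a ->
  comp_inv J b d -> lowest J b -> lowest J d -> b = d.
Proof.
move=> ap JE bd lb ld.
have am : (a < m)%N by lia.
have inJ j : (j \in J) = (a <= j)%N by rewrite JE inE.
have ae : Ordinal am != spin1 p by rewrite -val_eqE /=; lia.
have s0 := spin0E p.
have zero b' k : lowest J b' -> (a < k)%N -> wt b' 0 k = 0.
  move=> lb' ak; have [ke|ke] := eqVneq k (spin1 p).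
    have s0J : spin0 p \in J by rewrite inJ s0; lia.
    have s1J : spin1 p \in J by rewrite inJ /=; lia.
    have h0 : val (hi (spin0 p)) = val k by rewrite hi_spin0 ke.
    have h1 : val (hi (spin1 p)) = val k by rewrite hi_spin1 ke.
    have := lowest_ge0 lb' s0J h0; have := lowest_ge0 lb' s1J h1.
    by rewrite sg_spin0 sg_spin1 mul1r mulN1r; lia.
  have km := ltn_ord k; have km1 : (k.-1 < m)%N by lia.
  have kp : (k <= p.+1)%N by move: ke; rewrite -val_eqE /=; lia.
  have kJ : k \in J by rewrite inJ ltnW.
  have k1J : Ordinal km1 \in J by rewrite inJ /=; lia.
  have lok : val (lo k) = val k by rewrite /=; lia.
  have hik : val (hi (Ordinal km1)) = val k by rewrite /=; lia.
  have := lowest_le0 lb' kJ lok; have := lowest_ge0 lb' k1J hik.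
  by rewrite sg_nlast /= ?mul1r; lia.
have off k : k != Ordinal am -> k != spin1 p -> wt b 0 k = wt d 0 k.
  move=> ka ke; have [ak|] := ltnP a k; first by rewrite !zero.
  rewrite leq_eqVlt => /orP[/eqP e|ka']; first by move: ka; rewrite -val_eqE /= e eqxx.
  apply: (comp_inv_off bd) => j; rewrite inJ -!val_eqE /= => jin.
  by split; lia.
have aJ : Ordinal am \in J by rewrite inJ.
have loa : val (lo (Ordinal am)) = val (Ordinal am) by rewrite /=; lia.
apply: (two_coord_uniq ae off (lowest_mult bd lb ld)).
- exact: lowest_le0 lb aJ loa.
- exact: lowest_le0 ld aJ loa.
by left; rewrite !zero //=; lia.
Qed.

Lemma lowest_uniq J b d : dconnected J -> comp_inv J b d ->
  lowest J b -> lowest J d -> b = d.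
Proof.
case/dconnectedP => [a c ac cp JE|a ap JE|a ap JE].
- exact: lowest_uniqA JE.
- exact: lowest_uniqA' JE.
- exact: lowest_uniqD JE.
Qed.

(** * The cactus map of J in coordinates *)

Section CactusMap.
Variables (J : {set 'I_m}) (cJ : dconnected J) (c : row m n -> row m n).
Hypotheses (cw : forall b, wt (c b) = w0 J (wt b))
           (cm : forall b k, mult (c b) k = mult b (pi J k)).

Lemma cactus_fun_inv : involutive c.
Proof.
move=> b; apply: state_inj => [|k]; first by rewrite !cw w0K.
by rewrite !cm piK.
Qed.

Lemma cactus_fun_step j b d : j \in J -> step j b d -> step (theta J j) (c d) (c b).
Proof.
move=> jJ [e M]; split=> [|k kj].
  by rewrite !cw e w0D // w0_alpha // subrK.
rewrite !cm M //; apply: contraNneq kj => kj.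
by rewrite -(piK cJ k) kj pi_lo.
Qed.

Lemma cactus_fun_stepE j b d : j \in J -> step (theta J j) b d <-> step j (c d) (c b).
Proof.
move=> jJ; split=> [|/(cactus_fun_step jJ)]; last by rewrite !cactus_fun_inv.
by move/(cactus_fun_step (theta_in cJ jJ)); rewrite thetaK.
Qed.

Lemma option_ext (T : Type) (x y : option T) : (forall d : T, x = Some d <-> y = Some d) -> x = y.
Proof.
case: x => [d|] H; first by symmetry; apply/(H d).
by case: y H => // d H; apply/(H d).
Qed.

Lemma cactus_fun_erow j b : j \in J -> erow j (c b) = omap c (frow (theta J j) b).
Proof.
move=> jJ; apply: option_ext => d; split.
  move/erowP => st; have {}st : step j (c (c d)) (c b) by rewrite cactus_fun_inv.
  by move/(cactus_fun_stepE _ _ jJ)/frowP: st => -> /=; rewrite cactus_fun_inv.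
case e: (frow _ _) => [d'|] //= -[<-]; apply/erowP/cactus_fun_stepE => //.
exact/frowP.
Qed.

Lemma cactus_fun_frow j b : j \in J -> frow j (c b) = omap c (erow (theta J j) b).
Proof.
move=> jJ; apply: option_ext => d; split.
  move/frowP => st; have {}st : step j (c b) (c (c d)) by rewrite cactus_fun_inv.
  by move/(cactus_fun_stepE _ _ jJ)/erowP: st => -> /=; rewrite cactus_fun_inv.
case e: (erow _ _) => [d'|] //= -[<-]; apply/frowP/cactus_fun_stepE => //.
exact/erowP.
Qed.

Lemma cactus_fun_comp_inv b : comp_inv J b (c b).
Proof.
split=> [y yJ|k kJ]; last by rewrite cm pi_out.
have [t D] := w0_data_ex cJ; have [tJ _ _] := D.
by rewrite cw (w0_dataE D) (dot_wact_perp _ tJ yJ).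
Qed.

(** A row and its image have the same invariants, so their components have the same lowest
    element. *)
Lemma cactus_fun_component b : same_component J b (c b).
Proof.
have [l bl ll] := component_lowest J b; have [l' cl ll'] := component_lowest J (c b).
suff e : l = l'.
  by apply: connect_trans bl _; rewrite component_sym e.
apply: (@lowest_uniq J) => //.
apply: comp_inv_trans (comp_inv_sym (component_inv bl)) _.
exact: comp_inv_trans (cactus_fun_comp_inv b) (component_inv cl).
Qed.

Lemma cactus_fun_map : cactus_map J c.
Proof.
split=> // [|j b jJ]; first exact: cactus_fun_component.
by split; [apply: cactus_fun_erow|apply: cactus_fun_frow].
Qed.

(** Take a row b of minimal height where the two maps differ. If some f_j(b) is nonzero, agreement
    there passes back to b by intertwining. If b is lowest, its image under c' is killed by all e_j,
    and c sends such an element of the component to the lowest one, b. *)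
Lemma cactus_fun_uniq c' : cactus_map J c' -> c' =1 c.
Proof.
move=> [comp' _ int'] b0; apply/eqP; apply: contraT => ne0.
case: (@Order.TotalTheory.arg_minP _ _ _ b0 (fun b => c' b != c b) (fun b => ht (wt b)) ne0).
move=> b /negP ne bmin; case: ne; apply/eqP.
have [low|] := pselect (lowest J b).
  have lowc d : same_component J b d -> (forall j, j \in J -> erow j d = None) -> c d = b.
    move=> bd hd; apply: (@lowest_uniq J) => //.
      exact: comp_inv_sym (comp_inv_trans (component_inv bd) (cactus_fun_comp_inv d)).
    by move=> j jJ; rewrite cactus_fun_frow // hd // theta_in.
  apply: (inv_inj cactus_fun_inv); rewrite cactus_fun_inv; apply: lowc => // j jJ.
  by have [-> _] := int' j b jJ; rewrite low // theta_in.
move=> /existsNP [j /not_implyP [jJ]]; case e: (frow j b) => [d|] // _.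
have /frowP st := e.
have ed : c' d = c d.
  apply/eqP; apply: contraT => /bmin h.
  by have := le_lt_trans h (ht_step st); rewrite ltxx.
have /erowP eb := st.
have tJ := theta_in cJ jJ.
have [_] := int' _ d tJ; rewrite thetaK // eb /= ed.
by rewrite cactus_fun_frow // thetaK // eb => -[].
Qed.

End CactusMap.
End Components.

(** * Toggles on rows *)

Section Toggles.
Variable p : nat.
Local Notation m := p.+3.
Implicit Types (i j k : 'I_m) (x y z : letter m) (h : heap m).

Definition mem_x x (a : nat) := if x.2 then (x.1 == p.+2 :> nat) ==> (a != p.+1) else a < x.1.
Definition mem_y x (a : nat) := x.2 && (x.1 <= a).

Lemma letter_ideal_inl x i : (inl i \in val (letter_ideal x)) = mem_x x i.
Proof. by case: x => q []; rewrite inE. Qed.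

Lemma letter_ideal_inr x (i : 'I_(m - 2)) : (inr i \in val (letter_ideal x)) = mem_y x i.
Proof. by case: x => q []; rewrite inE. Qed.

Lemma hcover_ll i j : hcover (inl i) (inl j) =
  (j == i.+1 :> nat) && (j <= p) || (i == p :> nat) && (p < j).
Proof. by rewrite /hcover /lab; lia. Qed.

Lemma hcover_lr i (j : 'I_(m - 2)) : hcover (inl i) (inr j) = (p < i) && (j == p :> nat).
Proof. by rewrite /hcover /lab; lia. Qed.

Lemma hcover_rr (i j : 'I_(m - 2)) : hcover (inr i : heap m) (inr j) = (i == j.+1 :> nat).
Proof. by rewrite /hcover /lab; lia. Qed.

Lemma ltn_ordr (i : 'I_(m - 2)) : i < p.+1.
Proof. by have := ltn_ord i; lia. Qed.

(** With nodes counted from 0, x_i sits on x_{i-1}, except that both spin elements sit on x_p;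
    [minn i.-1 p] covers the two cases. *)
Lemma lower_in_inl x i :
  lower_in (inl i) (letter_ideal x) = (i == 0 :> nat) || mem_x x (minn i.-1 p).
Proof.
have im := ltn_ord i; apply/forallP/idP => [H|H [j|j]].
- case: (posnP i) => [->//|i0]; have jm : minn i.-1 p < m by lia.
  have := H (inl (Ordinal jm)); rewrite hcover_ll letter_ideal_inl /=.
  by move=> /implyP ->; lia.
- rewrite hcover_ll letter_ideal_inl; apply/implyP => c.
  by have -> : j = minn i.-1 p :> nat by [lia|]; move: H; case: eqP => //; lia.
- by [].
Qed.

Lemma upper_out_inl x i : upper_out (inl i) (letter_ideal x) =
  if i < p then ~~ mem_x x i.+1
  else if i == p :> nat then ~~ mem_x x p.+1 && ~~ mem_x x p.+2 else ~~ mem_y x p.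
Proof.
have im := ltn_ord i; apply/forallP/idP => [H|H [j|j]].
- have hx a (am : a < m) : (a == i.+1) && (a <= p) || (i == p :> nat) && (p < a) -> ~~ mem_x x a.
    by move=> c; have := H (inl (Ordinal am)); rewrite hcover_ll letter_ideal_inl /= c.
  case: ltnP => ip; first by apply: hx; lia.
  case: eqP => ip'; first by rewrite !hx //; lia.
  have pm : p < m - 2 by lia.
  have := H (inr (Ordinal pm)); rewrite hcover_lr letter_ideal_inr /= => /implyP; apply; lia.
- rewrite hcover_ll letter_ideal_inl; apply/implyP => c; have jm := ltn_ord j; move: H.
  case: ltnP => ip; first by have -> : j = i.+1 :> nat by lia.
  case: eqP => ip'; last by lia.
  have [->|->] : j = p.+1 :> nat \/ j = p.+2 :> nat by lia.
    by case/andP.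
  by case/andP.
- rewrite hcover_lr letter_ideal_inr; apply/implyP => c; move: H.
  have [ip jp] : p < i /\ j = p :> nat by lia.
  case: ltnP => ?; first by lia.
  by case: eqP => ?; [lia|rewrite jp].
Qed.

Lemma lower_in_inr x (i : 'I_(m - 2)) : lower_in (inr i : heap m) (letter_ideal x) =
  if i < p then mem_y x i.+1 else mem_x x p.+1 && mem_x x p.+2.
Proof.
have im := ltn_ordr i; apply/forallP/idP => [H|H [j|j]].
- case: ltnP => ip.
    have jm : i.+1 < m - 2 by lia.
    have := H (inr (Ordinal jm)); rewrite hcover_rr letter_ideal_inr /= => /implyP; apply; lia.
  have hx a (am : a < m) : p < a -> mem_x x a.
    move=> c; have := H (inl (Ordinal am)); rewrite hcover_lr letter_ideal_inl /= => /implyP; apply; lia.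
  by rewrite !hx.
- rewrite hcover_lr letter_ideal_inl; apply/implyP => c; have jm := ltn_ord j; move: H.
  case: ltnP => ip; first by lia.
  have [->|->] : j = p.+1 :> nat \/ j = p.+2 :> nat by lia.
    by case/andP.
  by case/andP.
- rewrite hcover_rr letter_ideal_inr; apply/implyP => /eqP c; have jm := ltn_ordr j; move: H.
  by case: ltnP; [rewrite c|lia].
Qed.

Lemma upper_out_inr x (i : 'I_(m - 2)) : upper_out (inr i : heap m) (letter_ideal x) =
  (i == 0 :> nat) || ~~ mem_y x i.-1.
Proof.
have im := ltn_ordr i; apply/forallP/idP => [H|H [j|j]].
- case: (posnP i) => [->//|i0]; have jm : i.-1 < m - 2 by lia.
  by have := H (inr (Ordinal jm)); rewrite hcover_rr letter_ideal_inr /= => /implyP; apply; lia.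
- by [].
- rewrite hcover_rr letter_ideal_inr; apply/implyP => /eqP c; move: H.
  by rewrite c.
Qed.

(** The simple reflection s_i on letters, seen as weights of the vector representation. *)
Definition refl_letter i x : letter m :=
  if x == l1 i then l2 i else if x == l2 i then l1 i
  else if x == l3 i then l4 i else if x == l4 i then l3 i else x.

Lemma refl_letterK i : involutive (refl_letter i).
Proof.
move=> x; have E := letters_eqE i; rewrite /refl_letter.
have [->|/negbTE x1] := eqVneq x (l1 i); first by rewrite !E eqxx.
have [->|/negbTE x2] := eqVneq x (l2 i); first by rewrite !eqxx.
have [->|/negbTE x3] := eqVneq x (l3 i); first by rewrite !E eqxx.
have [->|/negbTE x4] := eqVneq x (l4 i); first by rewrite !E eqxx.
by rewrite x1 x2 x3 x4.
Qed.

Lemma toggle_letter i x : toggle i (letter_ideal x) = letter_ideal (refl_letter i x).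
Proof.
apply/val_inj/setP => h; rewrite toggleE.
have im := ltn_ord i; case: x => q s; have qm := ltn_ord q.
case: h => [a|a].
  have am := ltn_ord a.
  rewrite lower_in_inl upper_out_inl !letter_ideal_inl /refl_letter /l1 /l2 /l3 /l4 !xpair_eqE.
  rewrite -!val_eqE /= /lastn /=.
  rewrite !(fun_if (fun y => mem_x y a)) /mem_x /mem_y /=.
  case: s => /=; rewrite ?andbT ?andbF /=; do ?[case: ifP => /=]; lia.
have am := ltn_ordr a.
rewrite lower_in_inr upper_out_inr !letter_ideal_inr /refl_letter /l1 /l2 /l3 /l4 !xpair_eqE.
rewrite -!val_eqE /= /lastn /=.
rewrite !(fun_if (fun y => mem_y y a)) /mem_x /mem_y /=.
case: s => /=; rewrite ?andbT ?andbF /=; do ?[case: ifP => /=]; lia.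
Qed.

End Toggles.

(** * Rows and reverse plane partitions *)

Section RowRpp.
Variable p : nat.
Local Notation m := p.+3.
Implicit Types (i j k : 'I_m) (x y z : letter m) (h : heap m) (I : ideal m).

Lemma letter_le_subset x y h : letter_le x y ->
  h \in val (letter_ideal x) -> h \in val (letter_ideal y).
Proof.
case: h => [a|a]; rewrite ?(letter_ideal_inl, letter_ideal_inr) /mem_x /mem_y.
  have := ltn_ord a; case: x y => [q []] [r []]; have := ltn_ord q; have := ltn_ord r;
    rewrite /= /lab; lia.
have := ltn_ordr a; case: x y => [q []] [r []]; have := ltn_ord q; have := ltn_ord r;
    rewrite /= /lab; lia.
Qed.

Lemma subset_letter_le x y :
  (forall h, h \in val (letter_ideal x) -> h \in val (letter_ideal y)) -> letter_le x y.
Proof.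
move=> H.
have Hx a : a < m -> mem_x x a -> mem_x y a.
  by move=> am; have := H (inl (Ordinal am)); rewrite !letter_ideal_inl.
have Hy a : a < m - 2 -> mem_y x a -> mem_y y a.
  by move=> am; have := H (inr (Ordinal am)); rewrite !letter_ideal_inr.
move: Hx Hy; rewrite /mem_x /mem_y; case: x y {H} => [q s] [r t] /=.
have := ltn_ord q; have := ltn_ord r; case: s t => [] [] rm qm Hx Hy /=; rewrite /lab.
- have := Hx p.+1; have := Hx p.+2; have := Hy q; lia.
- have := Hx p.+2; lia.
- have := Hx p.+1; lia.
- have := Hx r; lia.
Qed.

Lemma letter_ideal_inj : injective (@letter_ideal m).
Proof.
by move=> x y e; apply: letter_le_anti; rewrite !subset_letter_le // => h; rewrite e.
Qed.

Lemma ideal_inl I j k : j <= k -> k <= p -> inl k \in val I -> inl j \in val I.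
Proof.
move=> jk; have [d] := ubnP (k - j); elim: d k jk => // d IH k jk kd kp kI.
have [e|ne] := eqVneq j k; first by rewrite e.
have km := ltn_ord k; have km1 : k.-1 < m by lia.
have jk' : j < k by move: ne; rewrite -val_eqE /=; lia.
apply: (IH (Ordinal km1)); rewrite /=; try lia.
by apply: ideal_down kI; rewrite hcover_ll /=; lia.
Qed.

Lemma ideal_spin I j k : j <= p -> p < k -> inl k \in val I -> inl j \in val I.
Proof.
move=> jp pk kI; have pm : p < m by lia.
apply: (@ideal_inl I j (Ordinal pm)) => //.
by apply: ideal_down kI; rewrite hcover_ll /=; have := ltn_ord k; lia.
Qed.

Lemma ideal_inr I (j k : 'I_(m - 2)) : k <= j -> inr k \in val I -> inr j \in val I.
Proof.
have [d] := ubnP (j - k); elim: d j => // d IH j jd kj kI.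
have [e|ne] := eqVneq k j; first by rewrite -e.
have jm := ltn_ord j; have jm1 : j.-1 < m - 2 by lia.
have kj' : k < j by move: ne; rewrite -val_eqE /=; lia.
have : inr (Ordinal jm1) \in val I by apply: IH => //=; lia.
by apply: ideal_down; rewrite hcover_rr /=; lia.
Qed.

Lemma ideal_inr_spin I (j : 'I_(m - 2)) k : p < k -> inr j \in val I -> inl k \in val I.
Proof.
move=> pk jI; have pm : p < m - 2 by lia.
have : inr (Ordinal pm) \in val I by apply: ideal_inr jI; have := ltn_ordr j; rewrite /=; lia.
by apply: ideal_down; rewrite hcover_lr /= pk eqxx.
Qed.

(** If I contains some y_q, the least such q gives the barred letter. Otherwise x_{m-1} and x_m
    decide, and if both are missing the first missing x_q gives the letter. *)
Lemma ideal_letter I : exists x, I = letter_ideal x.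
Proof.
suff [x [Hl Hr]] : exists x, (forall k, (inl k \in val I) = mem_x x k) /\
    (forall k : 'I_(m - 2), (inr k \in val I) = mem_y x k).
  exists x; apply/val_inj/setP => -[k|k]; first by rewrite letter_ideal_inl.
  by rewrite letter_ideal_inr.
have s0 := spin0E p.
have [/existsP [k0 k0I]|/existsPn no] := boolP [exists k : 'I_(m - 2), inr k \in val I].
  case: (arg_minnP (P := fun k : 'I_(m - 2) => inr k \in val I) val k0I) => k kI kmin.
  have km := ltn_ordr k; have km' : k < m by lia.
  have spins j : p < j -> inl j \in val I by move=> pj; apply: ideal_inr_spin kI.
  exists (Ordinal km', true); split=> j; rewrite /mem_x /mem_y /=.
    have -> : (k == p.+2 :> nat) = false by lia.
    have [pj|jp] := ltnP p j; first by rewrite spins.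
    by rewrite (@ideal_spin I j (spin1 p)) // spins //=; lia.
  by apply/idP/idP => [/kmin //|kj]; apply: ideal_inr kI.
have nor x : x.2 = false \/ p < x.1 -> forall k : 'I_(m - 2), (inr k \in val I) = mem_y x k.
  move=> xp k; rewrite (negbTE (no k)) /mem_y; have := ltn_ordr k.
  by case: x xp => q [] /= [] // ?; lia.
case S0: (inl (spin0 p) \in val I); case S1: (inl (spin1 p) \in val I).
- exists (spin0 p, true); split; last by apply: nor; right; rewrite /= s0.
  move=> k; rewrite /mem_x /= s0; have -> : (p.+1 == p.+2) = false by lia.
  case: (spin_cases k) => [kp|->|->] //.
  by rewrite (@ideal_spin I k (spin1 p)).
- exists (spin1 p, false); split; last by apply: nor; left.
  move=> k; rewrite /mem_x /=; case: (spin_cases k) => [kp|->|->].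
  + by rewrite (@ideal_spin I k (spin0 p)) // ?s0 //; lia.
  + by rewrite S0 s0; lia.
  + by rewrite S1 /= ltnn.
- exists (spin1 p, true); split; last by apply: nor; right.
  move=> k; rewrite /mem_x /= eqxx /=; case: (spin_cases k) => [kp|->|->].
  + by rewrite (@ideal_spin I k (spin1 p)) //; lia.
  + by rewrite S0 s0 eqxx.
  + by rewrite S1 /=; lia.
case: (arg_minnP (P := fun k => inl k \notin val I) val (negbT S0)) => k kI kmin.
have kp : k <= p.+1 by have := kmin (spin0 p); rewrite S0 /= s0; apply.
exists (k, false); split; last by apply: nor; left.
move=> j; rewrite /mem_x /=; apply/idP/idP => [jI|jk]; last first.
  by apply: contraLR jk => /kmin; rewrite -leqNgt.
rewrite ltnNge; apply/negP => kj; case/negP: kI.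
case: (spin_cases j) => [jp|jE|jE]; last 2 first.
- by rewrite jE S0 in jI.
- by rewrite jE S1 in jI.
exact: ideal_inl kj jp jI.
Qed.

Section OneLength.
Variable n : nat.
Implicit Types (b : row m n) (Phi : rpp m n).

Lemma tnth_le b (k l : 'I_n) : k <= l -> letter_le (tnth (val b) k) (tnth (val b) l).
Proof.
move=> kl; pose x0 := tnth (val b) k; rewrite !(tnth_nth x0).
have H := @sorted_leq_nth _ _ (@letter_le_trans p) (@letter_le_refl p) x0 _ (valP b).
by apply: H; rewrite // inE size_tuple.
Qed.

(** The ideals of a row increase, so h lies in those of a final segment of positions; it is counted
    at least n-k times exactly when that segment contains k. *)
Lemma layer_row b (k : 'I_n) : layer (row_rpp b) k = letter_ideal (tnth (val b) k).
Proof.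
have kn := ltn_ord k; apply/val_inj/setP => h; rewrite inE sum_idealsE.
case hk: (h \in val (letter_ideal (tnth (val b) k))).
  rewrite -[X in X <= _](@sum_leq_sub n) ?leq_subr //.
  apply: leq_sum => l _; case nl: (n - l <= n - k) => //; have ln := ltn_ord l.
  by rewrite lt0b; apply: letter_le_subset hk; apply: tnth_le; lia.
apply/negbTE; rewrite -ltnNge -[X in _ < X]/(n - k).
apply: (@leq_ltn_trans (\sum_(l < n) (n - l <= n - k.+1))); last by rewrite sum_leq_sub; lia.
apply: leq_sum => l _; case hl: (_ \in _) => //; have ln := ltn_ord l.
case: (leqP l k) => lk; last by rewrite lt0b; lia.
by rewrite (letter_le_subset (tnth_le b lk) hl) in hk.
Qed.

Lemma row_rpp_inj : injective (@row_rpp m n).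
Proof.
move=> b b' e; apply/val_inj/eq_from_tnth => k.
by apply: letter_ideal_inj; rewrite -!layer_row e.
Qed.

Lemma row_rpp_surj Phi : exists b, row_rpp b = Phi.
Proof.
have [f fE] := choice (fun k : 'I_n => ideal_letter (layer Phi k)).
pose w := [tuple f k | k < n].
have ws : sorted (@letter_le m) w.
  apply/(sortedP (spin0 p, false)) => j; rewrite size_tuple => jn.
  have jn' : j < n by apply: ltnW.
  rewrite -[nth _ w j](tnth_nth _ w (Ordinal jn')) -[nth _ w j.+1](tnth_nth _ w (Ordinal jn)).
  rewrite !tnth_mktuple; apply: subset_letter_le => h; rewrite -!fE !inE /=; lia.
exists (Sub w ws); apply/val_inj/ffunP => h; apply: val_inj.
rewrite /= sum_idealsE -sum_layers; apply: eq_bigr => k _.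
by rewrite fE [tnth _ k]tnth_mktuple.
Qed.

(** The reflected letters need not form a row: they may be out of order, and m may occur with its
    bar. The sum of their ideals has then to be rewritten as that of a row. *)
Lemma rpp_toggle_row i b :
  rpp_toggle i (row_rpp b) =
  sum_ideals (fun k : 'I_n => letter_ideal (refl_letter i (tnth (val b) k))).
Proof.
apply/val_inj/ffunP => h; apply: val_inj; rewrite /= !sum_idealsE.
by apply: eq_bigr => k _; rewrite layer_row toggle_letter.
Qed.

Lemma sum_row b (g : letter m -> nat) :
  \sum_(k < n) g (tnth (val b) k) = \sum_x cnt b x * g x.
Proof. by rewrite -(big_tuple _ _ _ xpredT) sum_cnt_seq. Qed.

Definition mult_refl i k : 'I_m := if i <= p then tperm (lo i) (hi i) k else k.

Lemma mult_reflK i : involutive (mult_refl i).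
Proof. by move=> k; rewrite /mult_refl; case: (i <= p); rewrite ?tpermK. Qed.

Lemma srefl_absz i (v : 'rV[int]_m) k :
  absz (srefl i v 0%R k) = absz (v 0%R (tperm (lo i) (hi i) k)).
Proof.
rewrite sreflE /sg; case: tpermP => [->|->|/eqP/negbTE-> /eqP/negbTE->] //; last first.
  rewrite eq_sym lo_neq_hi eqxx; case: (lastn i) => /=; lia.
by rewrite eqxx; case: (lastn i) => /=; lia.
Qed.

Lemma row_refl_ex i b : exists b', wt b' = srefl i (wt b) /\
  forall k, mult b' k = mult b (mult_refl i k).
Proof.
have [||b' [? ?]] := @row_of_state p n (srefl i (wt b)) (fun k => mult b (mult_refl i k)).
- rewrite /mult_refl; case: ifP => [ip|_]; last exact: mult_spin1.
  rewrite tpermD ?mult_spin1 //; apply/eqP => /(congr1 val) /=; lia.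
- rewrite -[RHS](row_length b) !big_split /=; congr (_ + _).
    rewrite [RHS](reindex_inj (@perm_inj _ (tperm (lo i) (hi i)))) /=.
    by apply: eq_bigr => k _; rewrite srefl_absz.
  by rewrite [RHS](reindex_inj (inv_inj (mult_reflK i))).
by exists b'.
Qed.

Lemma refl_letter_nlast i k s : ~~ lastn i ->
  refl_letter i (k, s) = (tperm (lo i) (hi i) k, s).
Proof.
move=> il; rewrite /refl_letter /l1 /l2 /l3 /l4 !xpair_eqE (negbTE il) /=.
have lh := lo_neq_hi i.
case: tpermP => [->|->|/eqP/negbTE-> /eqP/negbTE-> //];
  by case: s; rewrite ?eqxx ?lh ?[hi i == lo i]eq_sym ?lh ?andbF.
Qed.

(** x_{m-1} and x_m lie side by side in the heap, so the ideals of m and its bar have the same sum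
    as those of m-1 and its bar. This trade turns the reflected letters at a spin node into a row,
    and it is why the multiplicity of m-1 does not move. *)
Lemma spin_letters i h : p < i ->
  (h \in val (letter_ideal (l1 i))) + (h \in val (letter_ideal (l4 i))) =
  (h \in val (letter_ideal (l2 i))) + (h \in val (letter_ideal (l3 i))).
Proof.
move=> pi; have im := ltn_ord i.
have loE : minn i p.+1 = p.+1 by lia.
case: h => [a|a]; rewrite ?letter_ideal_inl ?letter_ideal_inr /mem_x /mem_y /= loE.
  by have := ltn_ord a; case: (lastn i) => /=; rewrite eqxx; lia.
by have := ltn_ordr a; case: (lastn i) => /=; lia.
Qed.

Lemma row_rpp_refl i b b' : wt b' = srefl i (wt b) ->
  (forall k, mult b' k = mult b (mult_refl i k)) ->
  row_rpp b' = rpp_toggle i (row_rpp b).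
Proof.
move=> ew eM; rewrite rpp_toggle_row; apply/val_inj/ffunP => h; apply: val_inj.
rewrite /= !sum_idealsE (sum_row b' (fun x => h \in val (letter_ideal x))).
rewrite (sum_row b (fun x => h \in val (letter_ideal (refl_letter i x)))).
rewrite [RHS](reindex_inj (inv_inj (refl_letterK i))) /=.
under [RHS]eq_bigr do rewrite refl_letterK.
have [ip|pi] := leqP i p.
  have il : ~~ lastn i by rewrite /lastn /=; lia.
  apply: eq_bigr => -[k s] _; rewrite refl_letter_nlast // !cnt_state ew eM srefl_swap //.
  by rewrite /mult_refl ip.
have E := letters_eqE i.
have off x : [&& x != l1 i, x != l2 i, x != l3 i & x != l4 i] ->
    cnt b' x = cnt b (refl_letter i x).
  case/and4P => /negbTE x1 /negbTE x2 /negbTE x3 /negbTE x4.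
  rewrite /refl_letter x1 x2 x3 x4; case: x x1 x2 x3 x4 => k s.
  rewrite /l1 /l2 /l3 /l4 !xpair_eqE => x1 x2 x3 x4.
  have kl : (k == lo i) = false.
    by move: {x2 x3} x1 x4; case: s => /=; rewrite ?andbT.
  have kh : (k == hi i) = false.
    by move: {x1 x4} x2 x3; case: s; case: (lastn i) => /=; rewrite ?andbT.
  by rewrite !cnt_state ew eM sreflE kl kh /mult_refl leqNgt pi.
have mlo : mult b' (lo i) = mult b (lo i) by rewrite eM /mult_refl leqNgt pi.
have hi1 : hi i = spin1 p by apply: val_inj => /=; have := ltn_ord i; lia.
have m1 : mult b (hi i) = 0 by rewrite hi1 mult_spin1.
have m1' : mult b' (hi i) = 0 by rewrite hi1 mult_spin1.
have wlo : wt b' 0%R (lo i) = (sg i * wt b 0 (hi i))%R by rewrite ew sreflE eqxx.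
have whi : (sg i * wt b' 0 (hi i))%R = wt b 0%R (lo i).
  by rewrite ew sreflE [hi i == _]eq_sym lo_neq_hi eqxx mulrA sgK mul1r.
move: mlo m1 m1' wlo whi; rewrite !wt_hi !wt_lo !mult_lo !mult_hi => mlo m1 m1' wlo whi.
rewrite (bigD1 (l1 i)) //= (bigD1 (l2 i)) ?E //= (bigD1 (l3 i)) ?E //= (bigD1 (l4 i)) ?E //=.
rewrite [RHS](bigD1 (l1 i)) //= [in RHS](bigD1 (l2 i)) ?E //= [in RHS](bigD1 (l3 i)) ?E //=.
rewrite [in RHS](bigD1 (l4 i)) ?E //=.
under eq_bigr => x xE do rewrite off ?andbA //.
(* Compared with the reflected letters, b' has M more pairs (l1, l4) and M fewer pairs (l2, l3),
   where M is the multiplicity at [lo i]; [spin_letters] balances them. *)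
have := spin_letters h pi.
have r1 : refl_letter i (l1 i) = l2 i by rewrite /refl_letter eqxx.
have r2 : refl_letter i (l2 i) = l1 i by rewrite /refl_letter !E eqxx.
have r3 : refl_letter i (l3 i) = l4 i by rewrite /refl_letter !E eqxx.
have r4 : refl_letter i (l4 i) = l3 i by rewrite /refl_letter !E eqxx.
rewrite r1 r2 r3 r4.
move: (\sum_(x | _) _) mlo m1 m1' wlo whi.
move: (cnt b' _) (cnt b' _) (cnt b' _) (cnt b' _) (cnt b _) (cnt b _) (cnt b _) (cnt b _).
move=> c1' c4' c2' c3' c1 c4 c2 c3 S.
by case: (_ \in _); case: (_ \in _); case: (_ \in _); case: (_ \in _); lia.
Qed.

Lemma toggle_row i b : exists b', [/\ row_rpp b' = rpp_toggle i (row_rpp b),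
  wt b' = srefl i (wt b) & forall k, mult b' k = mult b (mult_refl i k)].
Proof.
by have [b' [ew eM]] := row_refl_ex i b; exists b'; split=> //; apply: row_rpp_refl.
Qed.

End OneLength.
End RowRpp.

(** * Elements of the toggle group *)

Section Realize.
Variable p : nat.
Local Notation m := p.+3.
Local Open Scope group_scope.
Implicit Types (i j k : 'I_m) (g : rpp_syms m) (t u : toggle_group m) (J : {set 'I_m}).

(** The same A and q serve all lengths n+1, so a pair determines an element of the whole product.
    Multiplicities are functions of the index, hence q composes in reverse order. *)
Definition realizes g (A : 'rV[int]_m -> 'rV[int]_m) (q : 'I_m -> 'I_m) :=
  forall n (b : row m n.+1), exists b', [/\ row_rpp b' = g n (row_rpp b),
    wt b' = A (wt b) & forall k, mult b' k = mult b (q k)].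

Lemma realizes1 : realizes 1 id id.
Proof. by move=> n b; exists b; split=> //; rewrite perm1. Qed.

Lemma realizesM g g' A A' q q' : realizes g A q -> realizes g' A' q' ->
  realizes (g * g') (A \o A') (q' \o q).
Proof.
move=> H H' n b; have [b1 [e1 w1 M1]] := H' n b; have [b2 [e2 w2 M2]] := H n b1.
exists b2; split=> [||k]; last by rewrite M2 M1.
- by rewrite e2 e1 -lsymM.
- by rewrite w2 w1.
Qed.

Lemma realizes_ext g A A' q q' : realizes g A q -> A =1 A' -> q =1 q' -> realizes g A' q'.
Proof.
move=> H eA eq n b; have [b' [e w M]] := H n b.
by exists b'; split=> // [|k]; rewrite -?eA -?eq.
Qed.

Lemma realizes_uniq g g' A q : realizes g A q -> realizes g' A q -> g = g'.
Proof.
move=> H H'; apply: functional_extensionality_dep => n.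
apply/permP => Phi; have [b <-] := row_rpp_surj Phi.
have [b1 [<- w1 M1]] := H n b; have [b2 [<- w2 M2]] := H' n b.
congr (row_rpp _); apply: state_inj => [|k]; first by rewrite w1 w2.
by rewrite M1 M2.
Qed.

Lemma toggle_realizes i : realizes (toggle_elt i) (srefl i) (mult_refl i).
Proof.
move=> n b; have [b' [e w M]] := toggle_row i b; exists b'; split=> //.
by rewrite e /toggle_elt /rpp_toggle_perm permE.
Qed.

Definition tog_realizes t A q := realizes (val t) A q.

Lemma tog_realizesM t u A A' q q' : tog_realizes t A q -> tog_realizes u A' q' ->
  tog_realizes (t * u) (A \o A') (q' \o q).
Proof. exact: realizesM. Qed.

Lemma tog_uniq t u A q : tog_realizes t A q -> tog_realizes u A q -> t = u.
Proof. by move=> H H'; apply: val_inj; apply: realizes_uniq H H'. Qed.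

Lemma tog_ex i : exists t, val t = toggle_elt i.
Proof.
have gi : toggle_elt i \in generated (fun t : rpp_syms m => exists i, t = toggle_elt i).
  by apply/asboolP => H _; apply; exists i.
by exists (Sub (toggle_elt i) gi).
Qed.

Lemma tog_gen_ex i : exists t, tog_realizes t (srefl i) (mult_refl i).
Proof. by have [t e] := tog_ex i; exists t; rewrite /tog_realizes e; apply: toggle_realizes. Qed.

Lemma tog1 : tog_realizes 1 id id.
Proof. exact: realizes1. Qed.

Lemma wact_adjacent i j : (i <= p)%N -> j = i.+1 :> nat ->
  wact [:: j; i] (alpha j) = alpha i /\ wact [:: i; j] (alpha i) = alpha j.
Proof.
move=> ip ji.
have d : dot (alpha i) (alpha j) = (-1)%R.
  rewrite dot_alpha !alphaE /sg /lastn -!val_eqE /= ji.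
  by do 6!(case: eqP => ? /=); lia.
have sE l w : srefl l w = (w - dot w (alpha l) *: alpha l)%R by [].
rewrite /= !sE !dotBl !dotZl [dot (alpha j) (alpha i)]dotC !d !alpha_norm.
by split; apply/rowP => k; rewrite !mxE; ring.
Qed.

(** s_j s_i maps alpha_j to alpha_i, so conjugating s_j by s_j s_i gives s_i. *)
Lemma braid i j v : (i <= p)%N -> j = i.+1 :> nat ->
  srefl j (srefl i (srefl j (srefl i (srefl j v)))) = srefl i v.
Proof.
move=> ip ji; have [e _] := wact_adjacent ip ji.
have := wact_srefl [:: j; i] j (srefl i (srefl j v)); rewrite e.
rewrite -[RHS]/(srefl i (wact [:: j; i] _)) /= => ->.
by rewrite !sreflK.
Qed.

Lemma srefl_tog i : exists t, tog_realizes t (srefl i) id.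
Proof.
have [d] := ubnP (m - i); elim: d i => // d IH i id.
have [t Ht] := tog_gen_ex i; have [ip|pi] := leqP i p; last first.
  by exists t; apply: realizes_ext Ht _ _ => // k; rewrite /mult_refl leqNgt pi.
have jm : (i.+1 < m)%N by lia.
pose j : 'I_m := Ordinal jm.
have [u Hu] := tog_gen_ex j; have jd : (m - j < d)%N by rewrite /=; lia.
have [c Hc] := IH j jd.
(* On weights this is s_j s_i s_j s_i s_j = s_i; on multiplicities c is trivial and the permutations
   of t and u cancel in pairs. *)
exists (u * (t * (c * (t * u)))).
apply: realizes_ext (tog_realizesM Hu (tog_realizesM Ht (tog_realizesM Hc (tog_realizesM Ht Hu)))) _ _.
  by move=> v; apply: braid.
by move=> k; rewrite /= !mult_reflK.
Qed.

Lemma word_tog s : exists t, tog_realizes t (wact s) id.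
Proof.
elim: s => [|i s [t Ht]]; first by exists 1; apply: tog1.
have [u Hu] := srefl_tog i; exists (u * t).
exact: realizes_ext (tog_realizesM Hu Ht) _ _.
Qed.

(** For i <= p the product of t_i and the pure reflection s_i keeps the weight and transposes
    multiplicities, so a word permuting coordinates can be copied onto the indices of the
    multiplicities. *)
Lemma mult_tog (s : seq 'I_m) (q : 'I_m -> 'I_m) : {in s, forall x : 'I_m, (x <= p)%N} ->
  (forall v k, wact s v 0%R k = v 0%R (q k)) -> exists t, tog_realizes t id q.
Proof.
elim: s q => [|i s IH] q sp sE.
  exists 1; apply: realizes_ext tog1 _ _ => // k.
  (* A vector with distinct entries shows that q is the identity when the word is empty. *)
  have := sE (\row_k (val k)%:Z)%R k; rewrite /= !mxE => -[e].
  exact: val_inj.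
have ip : (i <= p)%N by apply: sp; rewrite mem_head.
have il : ~~ lastn i by rewrite /lastn /=; lia.
have [||t Ht] := IH (q \o tperm (lo i) (hi i)).
- by move=> x xs; apply: sp; rewrite inE xs orbT.
- by move=> v k; rewrite /= -sE wact_cons srefl_swap // tpermK.
have [u Hu] := tog_gen_ex i; have [c Hc] := srefl_tog i.
exists (u * (c * t)).
apply: realizes_ext (tog_realizesM Hu (tog_realizesM Hc Ht)) _ _.
  by move=> v; rewrite /= sreflK.
by move=> k; rewrite /= /mult_refl ip tpermK.
Qed.

Lemma pi_shapeA J a c : dconnected J -> (c < p.+2)%N -> J = nodesA p a c ->
  pi J =1 rev_ord_in a c.
Proof.
move=> cJ cp JE k; have [t D] := w0_dataA a cp; rewrite -JE in D.
have cm : (c < m)%N by lia.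
have [kin|kout] := boolP ((a <= k <= c)%N).
  have kJ : k \in J by rewrite JE inE.
  have lok : lo k = k by apply: val_inj => /=; lia.
  rewrite -{1}lok pi_lo // (theta_dataE D) //.
  by apply: val_inj; rewrite /= val_rev_ord_in // kin; lia.
rewrite pi_out; first by apply: val_inj; rewrite /= val_rev_ord_in // (negbTE kout).
apply: contra kout => /imsetP[j]; rewrite JE inE => jin ->.
by rewrite /=; lia.
Qed.

Lemma pi_shapeA' J a : dconnected J -> J = (@taun p) @: nodesA p a p.+1 ->
  pi J =1 rev_ord_in a p.+1.
Proof.
move=> cJ JE k; have [t D] := w0_dataA a (leqnn p.+2).
have D' := w0_data_taun D; rewrite -JE in D'.
have cm : (p.+1 < m)%N by lia.
have [kin|kout] := boolP ((a <= k <= p.+1)%N).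
  have kJ : taun k \in J by rewrite JE imset_f // inE.
  have lok : lo (taun k) = k by rewrite lo_taun; apply: val_inj => /=; lia.
  rewrite -{1}lok pi_lo // (theta_dataE D') //= taunK lo_taun.
  by apply: val_inj; rewrite /= val_rev_ord_in // kin; lia.
rewrite pi_out; first by apply: val_inj; rewrite /= val_rev_ord_in // (negbTE kout).
apply: contra kout => /imsetP[j]; rewrite JE => /imsetP[l]; rewrite inE => lin -> ->.
by rewrite lo_taun /=; lia.
Qed.

(** theta_J at most exchanges the spin nodes, which share an index. *)
Lemma pi_shapeD J a : dconnected J -> (a <= p)%N -> J = nodesD p a -> pi J =1 id.
Proof.
move=> cJ ap JE k; have [t D] := w0_dataD ap; rewrite -JE in D.
have [/imsetP[j jJ ->]|kJ] := boolP (k \in [set lo j | j in J]); last by rewrite pi_out.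
by rewrite pi_lo // (theta_dataE D) //; case: ifP => // _; rewrite lo_taun.
Qed.

Lemma pi_tog J : dconnected J -> exists t, tog_realizes t id (pi J).
Proof.
move=> cJ; case: (dconnectedP cJ) => [a c ac cp JE|a ap JE|a ap JE].
- have cm : (c < m)%N by lia.
  (* Multiplicities are indexed by the nodes a..c, so the reversal stops at c, one short of that for
     w_{0,J}; its letters lie below c, away from the spin nodes. *)
  have [s sin sE] := @word_rev p a c cm.
  have [|t Ht] := @mult_tog s _ _ sE; first by move=> x /sin; lia.
  by exists t; apply: realizes_ext Ht _ _ => // k; rewrite (pi_shapeA cJ cp JE).
- have cm : (p.+1 < m)%N by lia.
  have [s sin sE] := @word_rev p a p.+1 cm.
  have [|t Ht] := @mult_tog s _ _ sE; first by move=> x /sin; lia.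
  by exists t; apply: realizes_ext Ht _ _ => // k; rewrite (pi_shapeA' cJ JE).
- by exists 1; apply: realizes_ext tog1 _ _ => // k; rewrite (pi_shapeD cJ ap JE).
Qed.

Lemma cactus_tog J : dconnected J -> exists t, tog_realizes t (w0 J) (pi J).
Proof.
move=> cJ; have [s D] := w0_data_ex cJ; have [u Hu] := word_tog s.
have [t Ht] := pi_tog cJ; exists (u * t).
by apply: realizes_ext (tog_realizesM Hu Ht) _ _ => // v; rewrite /= (w0_dataE D).
Qed.

End Realize.

(** * The homomorphism *)

Section PresentedLift.
Local Open Scope group_scope.
Variables (X : choiceType) (R : word X -> word X -> Prop) (G : groupType) (f : X -> G).

Definition word_eval (u : word X) : G :=
  foldr (fun a g => (if a.2 then (f a.1)^-1 else f a.1) * g) 1 u.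

Lemma word_eval_cat u v : word_eval (u ++ v) = word_eval u * word_eval v.
Proof. by elim: u => [|a u IH] /=; rewrite ?mul1g // IH mulgA. Qed.

Hypothesis fR : forall u v, R u v -> word_eval u = word_eval v.

Lemma word_eval_pres u v : pres_eq R u v -> word_eval u = word_eval v.
Proof.
elim=> {u v} [u v /fR //|x s|q r u v _ e|//|//|v u w _ e1 _ e2].
- by case: s; rewrite /= mulg1 ?mulVg ?mulgV.
- by rewrite !word_eval_cat e.
- by rewrite e1.
Qed.

Definition pres_lift (a : presented R) : G := word_eval (generic_quotient.repr a).

Lemma pres_lift_class u : pres_lift (pres_class R u) = word_eval u.
Proof. exact/word_eval_pres/pres_repr. Qed.

Lemma pres_liftM : {morph pres_lift : a b / a * b}.
Proof. by move=> a b; rewrite /pres_lift -word_eval_cat; apply/word_eval_pres/pres_repr. Qed.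

End PresentedLift.

(** * Cactus relations, surjectivity and the action on rows *)

Section Main.
Variable p : nat.
Local Notation m := p.+3.
Local Open Scope group_scope.
Implicit Types (i j k : 'I_m) (J : cnode m).

Lemma cnode_ex : exists f : cnode m -> toggle_group m,
  forall J, tog_realizes (f J) (w0 (val J)) (pi (val J)).
Proof.
have H J : exists t, tog_realizes t (w0 (val J)) (pi (val J)) by apply/cactus_tog/valP.
by have [f fP] := boolp.choice H; exists f.
Qed.

Lemma dconnected1 i : dconnected [set i].
Proof.
apply/andP; split; first by apply/set0Pn; exists i; rewrite inE.
apply/forall_inP => j /set1P ->; apply/forall_inP => k /set1P ->; exact: connect0.
Qed.

Lemma dconnected2 i j : dadj i j -> dconnected [set i; j].
Proof.
move=> ij; have ji : dadj j i by move: ij; rewrite /dadj orbC.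
apply/andP; split; first by apply/set0Pn; exists i; rewrite !inE eqxx.
by apply/forall_inP => a /set2P [] ->; apply/forall_inP => b /set2P [] ->;
  rewrite ?connect0 // connect1 // !inE !eqxx ?orbT.
Qed.

Lemma w0_data1 i : w0_data [set i] [:: i] id.
Proof.
split=> // j; first by rewrite !inE.
by move=> /set1P ->; rewrite /= srefl_alpha.
Qed.

Lemma pi1 i : pi [set i] =1 id.
Proof.
move=> k; have [/imsetP[j /set1P -> ->]|kJ] := boolP (k \in [set lo j | j in [set i]]).
  by rewrite pi_lo ?dconnected1 ?set11 // (theta_dataE (w0_data1 i)) ?set11.
by rewrite pi_out.
Qed.

Lemma w0_data2 i j : (i <= p)%N -> j = i.+1 :> nat ->
  w0_data [set i; j] [:: j; i; j] (tperm i j).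
Proof.
move=> ip ji; have [e1 e2] := wact_adjacent ip ji.
split=> [x|x|x].
- by rewrite !inE; case/or3P => /eqP ->; rewrite eqxx ?orbT.
- by case/set2P => ->; rewrite ?tpermL ?tpermR !inE eqxx ?orbT.
case/set2P => ->; rewrite ?tpermL ?tpermR wact_cons.
  by rewrite e2 srefl_alpha.
rewrite -[srefl j (wact [:: i; j] _)]/(wact [:: j; i] (srefl j (alpha j))).
by rewrite srefl_alpha wactN e1.
Qed.

Lemma pi2 i j : (i <= p)%N -> j = i.+1 :> nat -> pi [set i; j] =1 mult_refl i.
Proof.
move=> ip ji k; have D := w0_data2 ip ji.
have cJ : dconnected [set i; j] by apply: dconnected2; rewrite dadjE ji eqxx ip.
have loi : lo i = i by apply: val_inj => /=; lia.
have loj : lo j = j by apply: val_inj => /=; lia.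
have hii : hi i = j by apply: val_inj => /=; lia.
rewrite /mult_refl ip loi hii.
have [/imsetP[l lJ ->]|kJ] := boolP (k \in [set lo l | l in [set i; j]]).
  rewrite pi_lo // (theta_dataE D) //.
  by case/set2P: lJ => ->; rewrite ?loi ?loj ?tpermL ?tpermR.
rewrite pi_out // tpermD //; apply: contraNneq kJ => <-.
  by apply/imsetP; exists i; rewrite ?set21.
by apply/imsetP; exists j; rewrite ?set22.
Qed.

Section Hom.
Variables (f : cnode m -> toggle_group m)
  (fP : forall J, tog_realizes (f J) (w0 (val J)) (pi (val J))).

Lemma cactus_rel_eval u v : cactus_rel u v -> word_eval f u = word_eval f v.
Proof.
have c (J : cnode m) : dconnected (val J) := valP J.
case=> {u v} [J|J K dis nadj|J K L JK LE]; rewrite /= !mulg1.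
- apply: (@tog_uniq _ _ _ id id); last exact: tog1.
  apply: realizes_ext (tog_realizesM (fP J) (fP J)) _ _ => [v|k] /=.
    exact: w0K (c J).
  exact: piK (c J) k.
- apply: tog_uniq (tog_realizesM (fP J) (fP K)) _.
  apply: realizes_ext (tog_realizesM (fP K) (fP J)) _ _ => [v|k] /=.
    by symmetry; apply: w0_comm => //; apply: c.
  by rewrite pi_comm //; apply: c.
(* As multiplicities compose in reverse order, c_J c_K = c_K c_L becomes pi_K pi_J = pi_L pi_K. *)
- apply: tog_uniq (tog_realizesM (fP J) (fP K)) _.
  apply: realizes_ext (tog_realizesM (fP K) (fP L)) _ _ => [v|k] /=.
    by symmetry; apply: w0_nest => //; apply: c.
  by rewrite (@pi_nest _ (val J)) //; apply: c.
Qed.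

Definition cactus_hom : cactus m -> toggle_group m := pres_lift f.

Lemma cactus_homM : {morph cactus_hom : a b / a * b}.
Proof. exact: pres_liftM cactus_rel_eval. Qed.

Lemma cactus_hom_gen J : cactus_hom (cact J) = f J.
Proof. by rewrite /cactus_hom (pres_lift_class cactus_rel_eval) /= mulg1. Qed.

Definition cactus_morph : {multiplicative cactus m -> toggle_group m} :=
  HB.pack cactus_hom (isMultiplicative.Build _ _ cactus_hom cactus_homM).

Lemma cactus_morph_gen J : cactus_morph (cact J) = f J.
Proof. exact: cactus_hom_gen. Qed.

Lemma cactus_morph1 : cactus_morph 1 = 1.
Proof. exact: (pres_lift_class cactus_rel_eval [::]). Qed.

Lemma cactus_morphV a : cactus_morph a^-1 = (cactus_morph a)^-1.
Proof.
by rewrite -[LHS](mulgK (cactus_morph a)) -gmulfM mulVg cactus_morph1 mul1g.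
Qed.

Lemma tog_gen_hom i : exists g, val (cactus_morph g) = toggle_elt i.
Proof.
have [t te] := tog_ex i.
have Ht : tog_realizes t (srefl i) (mult_refl i).
  by rewrite /tog_realizes te; apply: toggle_realizes.
suff [g gE] : exists g, tog_realizes (cactus_morph g) (srefl i) (mult_refl i).
  by exists g; rewrite -te; congr (val _); apply: tog_uniq gE Ht.
have one k : tog_realizes (f (Sub [set k] (dconnected1 k))) (srefl k) id.
  apply: realizes_ext (fP _) _ _ => [v|l] /=; last exact: pi1.
  by rewrite (w0_dataE (w0_data1 k)).
have [ip|pi_] := leqP i p; last first.
  exists (cact (Sub [set i] (dconnected1 i))); rewrite cactus_morph_gen.
  by apply: realizes_ext (one i) _ _ => // k; rewrite /mult_refl leqNgt pi_.
have jm : (i.+1 < m)%N by lia.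
pose j : 'I_m := Ordinal jm.
have ij : dadj i j by rewrite dadjE eqxx ip.
pose J1 : cnode m := Sub [set j] (dconnected1 j).
pose J2 : cnode m := Sub [set i; j] (dconnected2 ij).
(* The outer s_j turn the longest element s_j s_i s_j of {i, j} into s_i, while [pi] of {i, j}
   supplies the transposition. *)
exists (cact J1 * (cact J2 * cact J1)); rewrite !gmulfM !cactus_morph_gen.
apply: realizes_ext (tog_realizesM (one j) (tog_realizesM (fP J2) (one j))) _ _ => [v|k] /=.
  by rewrite (w0_dataE (@w0_data2 i j ip erefl)) /= !sreflK.
exact: pi2.
Qed.

Lemma cactus_morph_surj t : exists g, cactus_morph g = t.
Proof.
pose H : {pred rpp_syms m} := fun x => `[< exists g, val (cactus_morph g) = x >].
have : val t \in H.
  have /asboolP := valP t; apply.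
    split=> [|_ _ /asboolP [g <-] /asboolP [h <-]]; apply/asboolP.
      by exists 1; rewrite cactus_morph1.
    by exists (g * h^-1); rewrite gmulfM cactus_morphV.
  by move=> _ [i ->]; apply/asboolP; apply: tog_gen_hom.
by case/asboolP => g e; exists g; apply: val_inj.
Qed.

Lemma cactus_action_ex n : exists act : cactus m -> row m n.+1 -> row m n.+1,
  cactus_action act /\ forall g b,
    row_rpp (act g b) = toggle_action (cactus_morph g) (row_rpp b).
Proof.
have [r rE] := choice (@row_rpp_surj p n.+1).
(* The action is transported along r, the inverse of [row_rpp]. Its axioms are then those of
   [cactus_morph], and only the generators involve the crystal. *)
exists (fun g b => r (toggle_action (cactus_morph g) (row_rpp b))); split=> //.
split=> [b|g h b|J].
- by apply: row_rpp_inj; rewrite rE cactus_morph1 /toggle_action perm1.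
- by apply: row_rpp_inj; rewrite !rE gmulfM /toggle_action -lsymM.
have cP b : wt (r (toggle_action (cactus_morph (cact J)) (row_rpp b))) = w0 (val J) (wt b) /\
    forall k, mult (r (toggle_action (cactus_morph (cact J)) (row_rpp b))) k = mult b (pi (val J) k).
  have [b' [e w M]] := fP J b.
  suff -> : r (toggle_action (cactus_morph (cact J)) (row_rpp b)) = b' by [].
  by apply: row_rpp_inj; rewrite rE e cactus_morph_gen.
split; first by apply: cactus_fun_map => [|b|b k]; [exact: valP|case: (cP b)|case: (cP b)].
by move=> c; apply: cactus_fun_uniq => [|b|b k]; [exact: valP|case: (cP b)|case: (cP b)].
Qed.

End Hom.
End Main.

Theorem mainTheorem5 (m : nat) (hm : 3 <= m) :
  exists phi : {multiplicative cactus m -> toggle_group m},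
    (forall t : toggle_group m, exists g : cactus m, phi g = t) /\
    (forall n : nat, exists act : cactus m -> row m n.+1 -> row m n.+1,
       cactus_action act /\
       forall (g : cactus m) (b : row m n.+1),
         row_rpp (act g b) = toggle_action (phi g) (row_rpp b)).
Proof.
case: m hm => [|[|[|p]]] // _; have [f fP] := cnode_ex p.
by exists (cactus_morph fP); split; [apply: cactus_morph_surj|apply: cactus_action_ex].
Qed.
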